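(* Let $k\ge 2$, let $\Gamma$ be a set of two general points on $G(k,2k)$, and let $X_\Gamma$ be the blow-up of $G(k,2k)$ along $\Gamma$, with exceptional divisors $E_1,E_2$. Then the pseudoeffective cone of divisors $\overline{\mathrm{Eff}}^1(X_\Gamma)$ is S-generated. Moreover, $\overline{\mathrm{Eff}}^1(X_\Gamma)$ is spanned by the exceptional classes $E_1$, $E_2$ and the classes $H-mE_1-(k-m)E_2$ for $0\le m\le k$, where $H$ is the pullback of the hyperplane class on $G(k,2k)$ in its Plücker embedding.
   Context: Work over an algebraically closed field. $G(k,n)$ is the Grassmannian of $k$-dimensional subspaces of a fixed $n$-dimensional vector space $V$, of dimension $k(n-k)$. For a finite set $\Gamma$ of distinct points of $G(k,n)$, $X_\Gamma$ is the blow-up of $G(k,n)$ along $\Gamma$. $\overline{\mathrm{Eff}}^1(X_\Gamma)$ is the closed convex cone of pseudoeffective codimension-1 classes (limits of effective classes) in the real vector space $N^1(X_\Gamma)$ of divisors modulo numerical equivalence. For a partition $\lambda=(\lambda_1,\dots,\lambda_k)$ with $n-k\ge\lambda_1\ge\cdots\ge\lambda_k\ge0$ and a complete flag $F_0\subset F_1\subset\cdots\subset F_n=V$, the Schubert variety is $\Sigma_\lambda(F_\bullet)=\{W\in G(k,n):\dim(W\cap F_{n-k+i-\lambda_i})\ge i,\ 1\le i\le k\}$, of codimension $|\lambda|=\sum\lambda_i$; its class $\sigma_\lambda$ (independent of the flag) is called a Schubert class. A pseudoeffective cone of $m$-dimensional cycles on $X_\Gamma$ (here $m=k(n-k)-1$)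 is called S-generated if it is the cone spanned by the classes of $m$-dimensional linear spaces contained in the exceptional divisors (each isomorphic to $\mathbb{P}^{k(n-k)-1}$) and the classes of strict transforms of $m$-dimensional Schubert classes on $G(k,n)$, possibly passing through the points of $\Gamma$, i.e. strict transforms of $m$-dimensional subvarieties of $G(k,n)$ whose class is a Schubert class. *)

(* Defs.v *)
From mathcomp Require Import all_boot all_order all_algebra.
From mathcomp Require Import boolp classical_sets cardinality functions fsbigop.
From mathcomp Require Import reals topology normedtype sequences.
From mathcomp Require Import -(notations) mpoly.

Set Implicit Arguments.
Unset Strict Implicit.
Unset Printing Implicit Defensive.

Import Order.TTheory GRing.Theory Num.Theory.
Import numFieldNormedType.Exports.
Local Open Scope classical_set_scope.
Local Open Scope ring_scope.

(** * Subvarieties of a product of projective spaces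

  The coordinates are indexed by a finite type [T], and [c : T -> S] says to
  which factor a coordinate belongs: the ambient variety is the product over
  [s : S] of the projective spaces with homogeneous coordinates [c @^-1: s].
  A point is represented by any vector [v : T -> K] of homogeneous coordinates
  (nonzero on each block), and a set of points by the set of all the vectors
  representing them. All the sets of vectors below are stable under rescaling
  of each block. *)

Section Varieties.
Context {K : closedFieldType} {S T : finType} (c : T -> S).

Notation poly := (mpoly #|T| K).
Implicit Types (F G : poly) (A X P C : set (T -> K)).

Definition proj_points : set (T -> K) :=
  [set v | forall s, exists2 t, c t = s & v t != 0].

Definition evalp F (v : T -> K) : K := meval (fun j => v (enum_val j)) F.

(* multihomogeneous of multidegree [d] (zero included) *)
Definition mhomog (d : S -> nat) F : Prop :=
  forall m, m \in msupp F ->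
  forall s, (\sum_(t | c t == s) m (enum_rank t))%N = d s.

Definition zero_locus (Fs : set poly) : set (T -> K) :=
  [set v | proj_points v /\ forall F, Fs F -> evalp F v = 0].

Definition zclosed A : Prop :=
  exists2 Fs : set poly,
    forall F, Fs F -> exists d, mhomog d F & A = zero_locus Fs.

(* As [A] is stable under rescaling and [K] is infinite, this is the ideal
   generated by the multihomogeneous polynomials vanishing on [A]. *)
Definition ideal A : set poly := [set F | forall v, A v -> evalp F v = 0].

Definition zclosure A : set (T -> K) :=
  zero_locus [set F | (exists d, mhomog d F) /\ ideal A F].

Definition irr_closed A : Prop :=
  [/\ zclosed A, A !=set0 &
      forall B C, zclosed B -> zclosed C -> A = B `|` C -> A = B \/ A = C].

(* integral closed subvarieties of codimension 1, by chains *)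
Definition prime_divisor X P : Prop :=
  [/\ irr_closed P, P `<` X &
      forall B, irr_closed B -> P `<=` B -> B `<=` X -> B = P \/ B = X].

(* integral closed subvarieties of dimension 1, by chains *)
Definition curve X C : Prop :=
  [/\ irr_closed C, C `<=` X, exists2 B, irr_closed B & B `<` C &
      forall A B, irr_closed A -> irr_closed B -> A `<` B -> B `<` C -> False].

(** ** Orders of vanishing

  [F] belongs to the [m]-th power of the maximal ideal of the local ring of [X]
  at the generic point of [P] iff [G * F] belongs to [ideal P ^ m + ideal X] for
  some [G] that does not vanish identically on [P]. *)

Definition ord_ge X P F (m : nat) : Prop :=
  exists2 G, ~ ideal P G &
  exists n (a : 'I_n -> poly) (b : 'I_n -> 'I_m -> poly),
    (forall i j, ideal P (b i j)) /\
    ideal X (G * F - \sum_i a i * \prod_j b i j).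

Definition ord X P F : nat :=
  xget 0%N [set m | ord_ge X P F m /\ ~ ord_ge X P F m.+1].

(** ** Intersection of a divisor and a curve *)

(* the quotient of the space of forms of multidegree [d] by those of
   [ideal P + ideal C] has dimension [l] *)
Definition quot_dim P C (d : S -> nat) (l : nat) : Prop :=
  exists2 b : 'I_l -> poly, forall i, mhomog d (b i) &
  forall F, mhomog d F ->
  exists! a : {ffun 'I_l -> K}, exists F1 F2,
    [/\ mhomog d F1, mhomog d F2, ideal P F1, ideal C F2 &
        F = \sum_i a i *: b i + F1 + F2].

(* The length of the scheme [P `&` C], when it is finite: its Hilbert function
   is constant, equal to the length, in large multidegrees. For a curve [C] not
   contained in a locally principal [P], this is the intersection number. *)
Definition inter_length P C : nat :=
  xget 0%N [set l | exists d0, forall d : S -> nat,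
    (forall s, (d0 <= d s)%N) -> quot_dim P C d l].

(** ** Divisors with real coefficients

  They are finitely supported functions on the prime divisors. The varieties to
  which this applies are smooth, so that Weil and Cartier divisors agree. *)

Context {R : realType}.

Notation rdiv := (set (T -> K) -> R).
Implicit Types (D E : rdiv).

Definition is_rdiv X D : Prop :=
  finite_set [set P | D P != 0] /\ forall P, D P != 0 -> prime_divisor X P.

Definition effective X D : Prop := is_rdiv X D /\ forall P, 0 <= D P.

Definition prime_div P : rdiv := fun Q => if `[< Q = P >] then 1 else 0.

(* divisor on [X] of the section [F] of a line bundle O(d), [F] not vanishing
   identically on [X] *)
Definition div_of X F : rdiv :=
  fun P => if `[< prime_divisor X P >] then (ord X P F)%:R else 0.

Definition lincomb n (a : 'I_n -> R) (D : 'I_n -> rdiv) : rdiv :=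
  fun P => \sum_i a i * D i P.

Definition principal X D : Prop :=
  exists F G, exists d, [/\ mhomog d F, mhomog d G, ~ ideal X F, ~ ideal X G &
    D = fun P => div_of X F P - div_of X G P].

Definition lin_equiv X D E : Prop :=
  exists n (a : 'I_n -> R) (N : 'I_n -> rdiv),
    (forall i, principal X (N i)) /\ (fun P => D P - E P) = lincomb a N.

(* the linear functional with value [psi P] on each prime divisor [P] *)
Definition pairing D (psi : set (T -> K) -> R) : R :=
  \sum_(P \in [set: set (T -> K)]) D P * psi P.

(* [D . C = e], computed after moving [D] in its linear equivalence class to a
   divisor whose support does not contain the curve [C] *)
Definition inter_number X D C (e : R) : Prop :=
  exists E, [/\ is_rdiv X E, lin_equiv X D E,
    forall P, E P != 0 -> ~ (C `<=` P) &
    pairing E (fun P => (inter_length P C)%:R) = e].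

Definition num_trivial X D : Prop := forall C, curve X C -> inter_number X D C 0.

Definition num_equiv X D E : Prop := num_trivial X (fun P => D P - E P).

(** ** Cones in N^1

  N^1(X) is the space of divisors modulo [num_equiv]; a subset of it is
  represented by the set of all the divisors whose class lies in it. *)

Definition cone X (gens : set rdiv) : set rdiv :=
  [set D | is_rdiv X D /\
    exists n (a : 'I_n -> R) (E : 'I_n -> rdiv),
      [/\ forall i, 0 <= a i, forall i, gens (E i) & num_equiv X D (lincomb a E)]].

(* As N^1(X) is a finite-dimensional real vector space, convergence in it means
   convergence after applying each linear functional on it, that is each linear
   functional on divisors that vanishes on the numerically trivial ones. *)
Definition N1_cvg X (u : nat -> rdiv) D : Prop :=
  forall psi : set (T -> K) -> R,
    (forall E, is_rdiv X E -> num_trivial X E -> pairing E psi = 0) ->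
    pairing (u n) psi @[n --> \oo] --> pairing D psi.

(* the pseudoeffective cone of divisors *)
Definition pseff X : set rdiv :=
  [set D | is_rdiv X D /\
    exists2 u : nat -> rdiv, forall n, effective X (u n) & N1_cvg X u D].

End Varieties.

(** * Grassmannians in their Plücker embedding *)

Definition plucker_index (k n : nat) : finType :=
  {f : {ffun 'I_k -> 'I_n} | [forall i : 'I_k, forall j : 'I_k, (i < j)%N ==> (f i < f j)%N]}.

Section Grassmannian.
Context {K : closedFieldType} (k n : nat).

Notation J := (plucker_index k n).

(* The Plücker coordinates of the row space of [A]. *)
Definition plucker (A : 'M[K]_(k, n)) : J -> K :=
  fun I => \det (colsub (val I) A).

(* As [k > 0], all the multiples of Plücker vectors are Plücker vectors. *)
Definition grassmannian : set (J -> K) :=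
  [set x | exists2 A : 'M[K]_(k, n), row_free A & x = plucker A].

Definition grass_factor (I : J) : unit := tt.

Definition complete_flag (Fl : nat -> 'M[K]_n) : Prop :=
  (forall j, (j <= n)%N -> \rank (Fl j) = j) /\
  (forall j, (j < n)%N -> (Fl j <= Fl j.+1)%MS).

Definition is_partition (la : 'I_k -> nat) : Prop :=
  (forall i, (la i <= n - k)%N) /\
  (forall i j : 'I_k, (i <= j)%N -> (la j <= la i)%N).

(* [i] is numbered from 0 *)
Definition schubert (la : 'I_k -> nat) (Fl : nat -> 'M[K]_n) : set (J -> K) :=
  [set x | exists A : 'M[K]_(k, n), [/\ row_free A, x = plucker A &
    forall i : 'I_k, (i.+1 <= \rank (A :&: Fl (n - k + i.+1 - la i)%N)%MS)%N]].

(* "[Q p] holds for [r] general points [p] of the Grassmannian": it holds on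
   a dense open subset of the [r]-fold product of the Grassmannian. *)
Definition tuple_factor r (t : 'I_r * J) : 'I_r := t.1.

Definition grass_tuples r : set ('I_r * J -> K) :=
  [set v | forall i, grassmannian (fun I => v (i, I))].

Definition general_points r (Q : ('I_r -> J -> K) -> Prop) : Prop :=
  exists Z : set ('I_r * J -> K),
  [/\ zclosed (@tuple_factor r) Z,
      @grass_tuples r `<=` zclosure (@tuple_factor r) (@grass_tuples r `\` Z) &
      forall p, (forall i, grassmannian (p i)) -> ~ Z (fun t => p t.1 t.2) -> Q p].

(** ** Blow-ups at finitely many points

  The blow-up at [p] is the closure of the graph of the rational map given by
  the generators [x_I p_J - x_J p_I] of the homogeneous ideal of [p]. With
  several points, the graph of all these maps together is used. *)

Definition wedge (x p : J -> K) : J * J -> K :=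
  fun IJ => x IJ.1 * p IJ.2 - x IJ.2 * p IJ.1.

(* proportionality of nonzero vectors *)
Definition same_point (x p : J -> K) : Prop := forall IJ, wedge x p IJ = 0.

Context {r : nat}.

Definition blowup_index : finType := (J + 'I_r * (J * J))%type.

Definition blowup_factor (t : blowup_index) : option 'I_r :=
  match t with inl _ => None | inr u => Some u.1 end.

Definition blow_down (v : blowup_index -> K) : J -> K := fun I => v (inl I).

Definition normal_dir (v : blowup_index -> K) (i : 'I_r) : J * J -> K :=
  fun IJ => v (inr (i, IJ)).

Variable p : 'I_r -> J -> K.

Definition blowup : set (blowup_index -> K) :=
  zclosure blowup_factor
    [set v | [/\ grassmannian (blow_down v),
      forall i, ~ same_point (blow_down v) (p i) &
      forall i, exists2 a : K, a != 0 &
        forall IJ, normal_dir v i IJ = a * wedge (blow_down v) (p i) IJ]].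

Definition exceptional (i : 'I_r) : set (blowup_index -> K) :=
  [set v | blowup v /\ same_point (blow_down v) (p i)].

Definition strict_transform (Y : set (J -> K)) : set (blowup_index -> K) :=
  zclosure blowup_factor
    [set v | [/\ blowup v, Y (blow_down v) &
                 forall i, ~ same_point (blow_down v) (p i)]].

(* [normal_dir ^~ i] embeds [exceptional i] linearly in a projective space, and
   the image of [L] is a linear subspace of that projective space *)
Definition linear_in_exceptional (i : 'I_r) (L : set (blowup_index -> K)) : Prop :=
  L `<=` exceptional i /\
  forall v w (a b : K), L v -> L w ->
    (exists IJ, a * normal_dir v i IJ + b * normal_dir w i IJ != 0) ->
    exists2 u, L u &
      forall IJ, normal_dir u i IJ = a * normal_dir v i IJ + b * normal_dir w i IJ.

Context {R : realType}.

Notation rdivX := (set (blowup_index -> K) -> R).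

(* pullback of a hyperplane section of the Grassmannian *)
Definition hyperplane_pullback (H : rdivX) : Prop :=
  exists F, [/\ mhomog blowup_factor (fun s => if s is None then 1%N else 0%N) F,
    ~ ideal blowup F & H = div_of blowup_factor blowup F].

Definition exc_div (i : 'I_r) : rdivX := prime_div (exceptional i).

(* Subvarieties of codimension 1 whose class is a Schubert class. *)
Definition schubert_class_divisor (Y : set (J -> K)) : Prop :=
  prime_divisor grass_factor grassmannian Y /\
  exists la Fl, [/\ is_partition la, (\sum_i la i)%N = 1%N, complete_flag Fl &
    num_equiv grass_factor grassmannian
      (prime_div Y : _ -> R) (prime_div (schubert la Fl))].

Definition S_generators : set rdivX :=
  [set D | (exists i L, [/\ prime_divisor blowup_factor blowup L,
              linear_in_exceptional i L & D = prime_div L]) \/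
           (exists2 Y, schubert_class_divisor Y &
              D = prime_div (strict_transform Y))].

Definition S_generated : Prop :=
  pseff blowup_factor blowup = cone blowup_factor blowup S_generators.

End Grassmannian.

(* Main.v *)
Require Import Defs.
From mathcomp Require Import all_boot all_order all_algebra all_fingroup.
From mathcomp Require Import finmap boolp classical_sets cardinality functions fsbigop.
From mathcomp Require Import reals topology normedtype sequences.
From mathcomp Require Import -(notations) mpoly.
From mathcomp Require Import ring lra zify.

Set Implicit Arguments.
Unset Strict Implicit.
Unset Printing Implicit Defensive.

Import Order.TTheory GRing.Theory Num.Theory.
Import numFieldNormedType.Exports.
Local Open Scope classical_set_scope.
Local Open Scope ring_scope.

(** Two general points of the Grassmannian are complementary subspaces W_0 and W_1
    of dimension k. Write i' for the other index. The subspaces that meet W_i' form a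
    Schubert divisor D_i; it is the hyperplane section given by the Plücker form
    W |-> det (W U_i), where U_i is a frame dual to W_i and killed by W_i'. In the affine
    chart of the subspaces that are graphs of A : W_i' -> W_i this form is det A. So
    D_i has multiplicity k at W_i', does not contain W_i, and, on the blow-up X,
    H ~ D_i + k E_i' (the same letter is used for a strict transform).

    No intersection number has to be computed: every prime divisor of X is linearly
    equivalent to a combination of E_0, E_1, D_0, D_1 with nonnegative coefficients
    ([prime_gen_generate]). A prime divisor of X is one of the E_i or the strict transform
    of a prime divisor Y of the Grassmannian ([prime_exc_or_strict]). The complement of D_0
    is an affine space, whose coordinate ring is factorial, so Y has an equation there;
    homogenized to a form F of degree e, it gives
                  div F = c Y + a D_0 + m_0 E_0 + m_1 E_1,    c > 0.
    Two families of rational curves in X sweep out enough to bound the multiplicities. The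
    pencils A W_0 + s B W_1 through both centers are curves of degree k, whence
    m_0 + m_1 <= k e ([two_centers]). General pencils of degree k through W_0 that meet D_0
    in k points give k a + m_0 <= k e ([center_schubert]). As
    D_0 + k E_1 ~ H ~ D_1 + k E_0, the divisor c Y is linearly equivalent to
          (e - a - m_0/k) D_0 + (m_0/k) D_1 + (k e - m_0 - m_1) E_1,
    and the two inequalities say that the coefficients are nonnegative.

    Hence the classes of effective divisors form the cone spanned by four classes. Such a
    cone is closed in every quotient of R^4, by Farkas' lemma, and this makes it equal to
    the pseudoeffective cone ([pseff_finite_cone]). The four classes are S-generators, E_0 and E_1
    being linear spaces and D_0, D_1 strict transforms of Schubert varieties; and
    H - m E_0 - (k - m) E_1 is equivalent to (m/k) D_1 + ((k - m)/k) D_0, which is a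
    class of the cone for all m, and D_0 or D_1 for m = 0 or m = k.

    The local geometry behind these computations is elementary. Irreducible closed sets are
    handled through the primality of their ideals, which is checked on parametrizations by
    vector spaces ([hprime_param]); codimension 1 is checked in affine charts, where it
    means to be the zero set of one prime polynomial ([chart_prime_divisor] and
    [prime_divisor_chart]); orders of vanishing are bounded above by restriction to arcs
    ([ord_ge_family]). *)

(** * Factorial polynomial rings *)

Section Divisibility.
Context {R : idomainType}.
Implicit Types a b p q : R.

Definition divides a b := exists c, b = c * a.

Definition prime_elt p :=
  [/\ p != 0, p \isn't a GRing.unit &
      forall a b, divides p (a * b) -> divides p a \/ divides p b].

Lemma divides_mull p a b : divides p b -> divides p (a * b).
Proof. by case=> c ->; exists (a * c); rewrite mulrA. Qed.

Lemma divides_mulr p a b : divides p a -> divides p (a * b).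
Proof. by rewrite mulrC; exact: divides_mull. Qed.

Lemma divides_trans a b c : divides a b -> divides b c -> divides a c.
Proof. by move=> [x ->] [y ->]; exists (y * x); rewrite mulrA. Qed.

Lemma divides_unit p u : u \is a GRing.unit -> divides p u -> p \is a GRing.unit.
Proof.
by move=> uU [c e]; move: uU; rewrite e unitrM => /andP[].
Qed.

Lemma prime_prod p (s : seq R) :
  prime_elt p -> divides p (\prod_(q <- s) q) ->
  exists2 q, q \in s & divides p q.
Proof.
move=> pP; elim: s => [|q s IH].
  by rewrite big_nil => /(divides_unit (unitr1 _)); case: pP => _ /negP.
rewrite big_cons; case: pP (pP) => _ _ pM pP /pM[pq|/IH[r rs pr]].
  by exists q; rewrite ?mem_head.
by exists r; rewrite // in_cons rs orbT.
Qed.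

Lemma prime_assoc p q : prime_elt p -> prime_elt q -> divides p q ->
  exists2 u, u \is a GRing.unit & q = u * p.
Proof.
move=> [p0 pU _] [q0 _ qP] [w e].
have /qP[[z ez]|[z ez]] : divides q (w * p) by exists 1; rewrite mul1r e.
  case/negP: pU; apply/unitrP; exists z.
  have : w * (z * p) = w * 1.
    by rewrite mulr1 {2}ez e mulrCA.
  have w0 : w != 0 by apply: contra_neq q0 => w0; rewrite e w0 mul0r.
  by move/(mulfI w0) => zp; rewrite [p * z]mulrC.
exists w => //; apply/unitrP; exists z.
have : p * (z * w) = p * 1 by rewrite mulr1 {2}ez e; ring.
by move/(mulfI p0) => zw; rewrite [w * z]mulrC.
Qed.

End Divisibility.

Definition factorial_ring (R : idomainType) := forall a : R, a != 0 ->
  exists u s, [/\ u \is a GRing.unit, forall p, p \in s -> prime_elt p &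
                  a = u * \prod_(p <- s) p].

Section Gauss.
Context (R : idomainType).
Context (fR : factorial_ring R).
Implicit Types f g h : {poly R}.

Lemma divides_polyC (p : R) f :
  divides p%:P f <-> forall i, divides p f`_i.
Proof.
split=> [[g ->] i|pf].
  by rewrite coefMC; exists g`_i.
have [g gE] := choice pf.
exists (\poly_(i < size f) g i); apply/polyP => i.
rewrite coefMC coef_poly; case: ltnP => [_|fi]; first exact: gE.
by rewrite mul0r nth_default.
Qed.

Lemma prime_polyC (p : R) : prime_elt p -> prime_elt p%:P.
Proof.
move=> pP; have [p0 pU pM] := pP; split.
- by rewrite polyC_eq0.
- by rewrite poly_unitE coefC eqxx (negPf pU) andbF.
move=> f g pfg; apply: contrapT => /not_orP[pf pg].
have ex h : ~ divides p%:P h -> exists i, ~ divides p h`_i /\ forall j, (j < i)%N -> divides p h`_j.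
  move=> ph; have /existsNP[i0 hi0] : ~ forall i, divides p h`_i by rewrite -divides_polyC.
  have exi : exists i, ~~ `[< divides p h`_i >] by exists i0; apply/asboolPn.
  exists (ex_minn exi); case: ex_minnP => i /asboolPn hi min; split=> // j ji.
  by apply: contrapT => /asboolPn /min; rewrite leqNgt ji.
have [i [fi fj]] := ex f pf; have [j [gj gi]] := ex g pg.
have /divides_polyC/(_ (i + j)%N) := pfg.
rewrite coefM (bigD1 (inord i : 'I_(i + j).+1)) //= inordK ?ltnS ?leq_addr//.
rewrite addKn.
have [c ->] : divides p (\sum_(i0 < (i + j).+1 | i0 != inord i) f`_i0 * g`_(i + j - i0)).
  apply: (big_ind (fun x => divides p x)).
  - by exists 0; rewrite mul0r.
  - by move=> _ _ [x ->] [y ->]; exists (x + y); rewrite mulrDl.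
  move=> l; rewrite -val_eqE /= inordK ?ltnS ?leq_addr// neq_ltn => /orP[li|il].
    exact/divides_mulr/fj.
  apply/divides_mull/gi; rewrite ltn_subLR ?ltn_add2r //; first by rewrite -ltnS.
move=> [d e]; have /pM[] // : divides p (f`_i * g`_j).
by exists (d - c); rewrite mulrBl -e addrK.
Qed.

Definition primitive f := forall p : R, prime_elt p -> ~ divides p%:P f.

(** A nonzero constant is a product of primes of the base ring; each of them stays prime in the
    polynomial ring and does not divide the primitive polynomial, so that they can be
    cancelled one after the other. *)
Lemma primitive_cancel f g (c : R) : primitive f -> c != 0 ->
  divides f (c%:P * g) -> divides f g.
Proof.
move=> fP /fR[u [s [uU sP ->]]]; elim: s sP g => [|p s IH] sP g.
  rewrite big_nil mulr1 => -[q e]; exists (u^-1%:P * q).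
  by rewrite -mulrA -e mulrA -polyCM mulVr // polyC1 mul1r.
rewrite big_cons mulrCA polyCM -mulrA => -[q e].
have pP : prime_elt p by apply: sP; rewrite mem_head.
have [p0 _ _] := pP.
have [_ _ pM] := prime_polyC pP.
(* the prime constant p divides q f and not f, hence q *)
have /pM[[q' eq]|/(fP _ pP)//] : divides p%:P (q * f).
  by rewrite -e; exists ((u * \prod_(p <- s) p)%:P * g); rewrite mulrC.
apply: IH; first by move=> r rs; apply: sP; rewrite in_cons rs orbT.
exists q'; have p0' : p%:P != 0 by rewrite polyC_eq0.
by apply: (mulfI p0'); rewrite e eq mulrCA mulrA.
Qed.

Lemma primitive_part f : f != 0 ->
  exists (c : R) g, [/\ c != 0, primitive g & f = c%:P * g].
Proof.
move=> f0; have : lead_coef f != 0 by rewrite lead_coef_eq0.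
move=> /fR[u [s [uU sP e]]].
have [n] := ubnP (size s); elim: n s f u f0 uU sP e => // n IH s f u f0 uU sP e sn.
have [fP|] := pselect (primitive f).
  by exists 1, f; rewrite oner_eq0 mul1r.
move=> /existsNP[p /not_implyP[pP /contrapT[g ef]]].
have g0 : g != 0 by apply: contra_neq f0 => g0; rewrite ef g0 mul0r.
have [p0 pU pM] := pP.
have /(prime_prod pP)[q qs pq] : divides p (\prod_(q <- s) q).
  have /pM[/(divides_unit uU)/idPn|//] : divides p (u * \prod_(q <- s) q).
    by exists (lead_coef g); rewrite -e ef lead_coefM lead_coefC.
  by case.
have [w wU eq] := prime_assoc pP (sP _ qs) pq.
have eg : lead_coef g = (u * w) * \prod_(r <- rem q s) r.
  apply: (mulIf p0); rewrite -[p in LHS]lead_coefC -lead_coefM -ef e.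
  by rewrite (perm_big _ (perm_to_rem qs)) big_cons /= eq -!mulrA; congr (_ * (_ * _)); rewrite mulrC.
have [|||c [h [c0 hP gh]]] := IH _ _ _ g0 _ _ eg.
- by rewrite unitrM uU.
- by move=> r /mem_rem /sP.
- by rewrite size_rem // -ltnS prednK //; case: (s) qs.
by exists (c * p), h; rewrite mulf_neq0// polyCM; split=> //; rewrite ef gh mulrAC.
Qed.

Lemma primitive_divides f g : primitive f -> divides g f -> primitive g.
Proof. by move=> fP gf p pP /divides_trans/(_ gf); exact: fP. Qed.

Lemma primitive_const f : primitive f -> f != 0 -> (size f <= 1)%N -> f \is a GRing.unit.
Proof.
move=> fP f0 /size1_polyC fE.
have : f`_0 != 0 by rewrite -polyC_eq0 -fE.
move=> /fR[u [[|p s] [uU sP e]]].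
  have f00 : f`_0 != 0 by rewrite -polyC_eq0 -fE.
  by rewrite fE poly_unitE size_polyC f00 coefC e big_nil mulr1.
have pP : prime_elt p by apply: sP; rewrite mem_head.
case: (fP _ pP); rewrite fE e big_cons; exists (u * \prod_(q <- s) q)%:P.
by rewrite -polyCM mulrCA mulrC.
Qed.

(** Either the resultant of f and g is a nonzero constant in the ideal of f and g, or they
    have a common factor, whose primitive part must be associated to f. *)
Lemma prime_irreducible f : primitive f -> (1 < size f)%N ->
  (forall g h, f = g * h -> (size g <= 1)%N \/ (size h <= 1)%N) ->
  forall g, divides f g \/ exists (r : R) u v, r != 0 /\ r%:P = u * f + v * g.
Proof.
move=> fP f1 irr g.
have f0 : f != 0 by rewrite -size_poly_gt0 ltnW.
have [g1|g1] := leqP (size g) 1.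
  have [->|g0] := eqVneq g 0; first by left; exists 0; rewrite mul0r.
  right; exists (g`_0), 0, 1; rewrite mul0r add0r mul1r -polyC_eq0.
  by rewrite -size1_polyC.
have [res|res] := boolP (resultant f g == 0); last first.
  have [[u v] _ e] := resultant_in_ideal f1 g1.
  by right; exists (resultant f g), u, v.
left; move: res; rewrite resultant_eq0 => d1.
have /Pdiv.Idomain.dvdpP[[c u] /= c0 cf] := Pdiv.Idomain.dvdp_gcdl f g.
have /Pdiv.Idomain.dvdpP[[c' v] /= c'0 cg] := Pdiv.Idomain.dvdp_gcdr f g.
set d := gcdp f g in d1 cf cg.
have d0 : d != 0 by rewrite -size_poly_gt0 ltnW.
have [b [e [b0 eP de]]] := primitive_part d0.
have ef : divides e f.
  apply: (primitive_cancel eP c0); exists (u * b%:P).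
  by rewrite mul_polyC cf de mulrA.
have [z fz] := ef.
have e1 : (1 < size e)%N by rewrite -(size_Cmul _ b0) -de.
have zU : z \is a GRing.unit.
  apply: primitive_const.
  - by apply: primitive_divides fP _; exists e; rewrite mulrC.
  - by apply: contra_neq f0 => z0; rewrite fz z0 mul0r.
  - by have [//|] := irr _ _ fz; rewrite leqNgt e1.
apply: (primitive_cancel fP c'0); exists (v * b%:P * z^-1).
by rewrite mul_polyC cg de fz -[RHS]mulrA mulKr // mulrA.
Qed.

Lemma prime_positive f : primitive f -> (1 < size f)%N ->
  (forall g h, f = g * h -> (size g <= 1)%N \/ (size h <= 1)%N) -> prime_elt f.
Proof.
move=> fP f1 irr; split.
- by rewrite -size_poly_gt0 ltnW.
- by rewrite poly_unitE gtn_eqF.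
move=> a b [w e]; have [|[r [u [v [r0 er]]]]] := prime_irreducible fP f1 irr a; first by left.
right; apply: (primitive_cancel fP r0); rewrite er mulrDl -!mulrA e.
by exists (u * b + v * w); rewrite mulrDl -!mulrA [f * b]mulrC.
Qed.

Lemma prime_primitive f : prime_elt f -> (1 < size f)%N -> primitive f.
Proof.
move=> [f0 fU fM] f1 p pP [g e].
have /fM[[h eh]|[h eh]] : divides f (g * p%:P) by exists 1; rewrite mul1r.
  have g0 : g != 0 by apply: contra_neq f0 => g0; rewrite e g0 mul0r.
  have : p%:P * h = 1.
    apply: (mulfI g0); rewrite mulr1 {2}eh e; ring.
  have [_ /negP pU _] := prime_polyC pP => ph; apply: pU.
  by apply/unitrP; exists h; rewrite mulrC ph.
have : (size (h * f)%R <= 1)%N by rewrite -eh size_polyC leq_b1.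
have h0 : h != 0.
  by have [+ _ _] := prime_polyC pP; rewrite eh; apply: contra_neq => ->; rewrite mul0r.
rewrite size_mul //; move: f1 h0; rewrite -(size_poly_gt0 h); lia.
Qed.

(** For a prime polynomial f of positive degree, a polynomial that is not a multiple of f can be
    eliminated: this is the induction step of the Nullstellensatz below. *)
Lemma prime_noncst f : prime_elt f -> (1 < size f)%N ->
  forall g, divides f g \/ exists (r : R) u v, r != 0 /\ r%:P = u * f + v * g.
Proof.
move=> fP f1; apply: prime_irreducible => //; first exact: prime_primitive.
have [f0 fU fM] := fP.
have key g h : f = g * h -> divides f g -> (size h <= 1)%N.
  move=> e [w ew].
  have g0 : g != 0 by apply: contra_neq f0 => g0; rewrite e g0 mul0r.
  have hw : h * w = 1 by apply: (mulfI g0); rewrite mulr1 {2}ew e; ring.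
  have : size (h * w)%R == 1 by rewrite hw size_poly1.
  by rewrite size_mul_eq1 => /andP[/eqP->].
move=> g h e; have /fM[] : divides f (g * h) by exists 1; rewrite mul1r.
  by move/(key _ _ e); right.
by rewrite mulrC in e; move/(key _ _ e); left.
Qed.

(** Gauss' lemma. A primitive polynomial is factored by splitting it as long as both factors have
    positive degree. *)
Lemma factorial_poly : factorial_ring {poly R}.
Proof.
have prim : forall f, primitive f -> f != 0 -> exists u s,
    [/\ u \is a GRing.unit, forall p, p \in s -> prime_elt p & f = u * \prod_(p <- s) p].
  move=> f; have [n] := ubnP (size f); elim: n f => // n IH f fn fP f0.
  have [f1|f1] := leqP (size f) 1.
    exists f, [::]; rewrite big_nil mulr1; split=> //; exact: primitive_const.
  have [irr|] := pselect (forall g h, f = g * h -> (size g <= 1)%N \/ (size h <= 1)%N).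
    exists 1, [:: f]; rewrite unitr1 big_seq1 mul1r; split=> // p.
    by rewrite inE => /eqP->; exact: prime_positive.
  move=> /existsNP[g /existsNP[h /not_implyP[e /not_orP[/negP + /negP]]]].
  rewrite -!ltnNge => g1 h1.
  have g0 : g != 0 by rewrite -size_poly_gt0 ltnW.
  have h0 : h != 0 by rewrite -size_poly_gt0 ltnW.
  have sz : size f = (size g + size h).-1 by rewrite e size_mul.
  have [||u [s [uU sP eg]]] := IH g _ _ g0.
  - by move: fn g1 h1; rewrite sz; lia.
  - by apply: primitive_divides fP _; exists h; rewrite mulrC.
  have [||v [t [vU tP eh]]] := IH h _ _ h0.
  - by move: fn g1 h1; rewrite sz; lia.
  - by apply: primitive_divides fP _; exists g.
  exists (u * v), (s ++ t); rewrite unitrM uU vU big_cat /=; split=> //.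
    by move=> p; rewrite mem_cat => /orP[/sP|/tP].
  by rewrite e eg eh; ring.
move=> f f0; have [c [g [c0 gP e]]] := primitive_part f0.
have [|u [s [uU sP eg]]] := prim g gP.
  by apply: contra_neq f0 => g0; rewrite e g0 mulr0.
have [v [t [vU tP ec]]] := fR c0.
exists (v%:P * u), ([seq p%:P | p <- t] ++ s); split.
- by rewrite unitrM uU poly_unitE size_polyC coefC eqxx vU andbT /= (_ : v != 0) //; apply: contraTneq vU => ->; rewrite unitr0.
- by move=> p; rewrite mem_cat => /orP[/mapP[q /tP qP ->]|/sP//]; exact: prime_polyC.
by rewrite big_cat /= big_map e ec eg polyCM rmorph_prod; ring.
Qed.
End Gauss.

Section IteratedPolynomials.
Context (K : closedFieldType).

(** Multivariate polynomials as iterated univariate ones: factoriality is then obtained by induction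
    on the number of variables. *)
Fixpoint ipoly (n : nat) : idomainType :=
  if n is n'.+1 then {poly (ipoly n')} else K.

(** The variable added last is the one of highest index. *)
Fixpoint ieval (n : nat) (v : nat -> K) : {rmorphism ipoly n -> K} :=
  match n return {rmorphism ipoly n -> K} with
  | 0 => idfun
  | n'.+1 => GRing.RMorphism.clone _ _
               (horner_eval (v n') \o map_poly (@ieval n' v)) _
  end.

Lemma ievalS n v (f : ipoly n.+1) : ieval n.+1 v f = (map_poly (ieval n v) f).[v n].
Proof. by []. Qed.

Lemma ieval_ext n (v w : nat -> K) (f : ipoly n) :
  (forall i, (i < n)%N -> v i = w i) -> ieval n v f = ieval n w f.
Proof.
elim: n f => //= n IH f vw; rewrite /horner_eval vw //; congr _.[_].
by apply/eq_map_poly => c; apply: IH => i ni; apply: vw; rewrite ltnS ltnW.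
Qed.

Definition upd n (v : nat -> K) (x : K) : nat -> K := fun i => if i == n then x else v i.

Lemma ieval_upd n (v : nat -> K) x (f : ipoly n.+1) :
  ieval n.+1 (upd n v x) f = (map_poly (ieval n v) f).[x].
Proof.
rewrite ievalS {2}/upd eqxx; congr _.[_]; apply/eq_map_poly => c.
by apply: ieval_ext => i ni; rewrite /upd ltn_eqF.
Qed.

Lemma ieval_neq0 n (f : ipoly n) : f != 0 -> exists v, ieval n v f != 0.
Proof.
elim: n f => [|n IH] f f0; first by exists (fun _ => 0).
have [v fv] : exists v, ieval n v (lead_coef f) != 0 by apply: IH; rewrite lead_coef_eq0.
have /closed_nonrootP[x fx] : map_poly (ieval n v) f != 0.
  by apply: contra_neq fv => /(congr1 (fun p : {poly K} => p`_(size f).-1)); rewrite coef_map coef0.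
by exists (upd n v x); rewrite ieval_upd.
Qed.

Lemma factorial_ipoly n : factorial_ring (ipoly n).
Proof.
elim: n => [|n IH]; last exact: factorial_poly.
move=> a a0; exists a, [::]; rewrite big_nil mulr1 unitfE.
by split.
Qed.

(** If f does not divide h, the elimination of the last variable gives a nonzero polynomial r in the
    other variables that lies in the ideal of f and h. Away from the zeros of r and of the
    leading coefficient of f, the last variable can be chosen on the zero set of f, where h
    vanishes too: this contradicts the choice of the point. *)
Theorem hypersurface_nullstellensatz n (f h : ipoly n) : prime_elt f ->
  (forall v, ieval n v f = 0 -> ieval n v h = 0) -> divides f h.
Proof.
elim: n f h => [|n IH] f h fP fh.
  by case: fP; rewrite unitfE => ->.
have [f1|f1] := leqP (size f) 1.
  have fE := size1_polyC f1; set c := f`_0 in fE.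
  have [f0 fU fM] := fP.
  have cP : prime_elt c.
    split.
    - by apply: contra_neq f0 => c0; rewrite fE c0.
    - apply: contra fU => cU; rewrite fE poly_unitE coefC cU size_polyC.
      by rewrite (_ : c != 0) //; apply: contra_neq f0 => c0; rewrite fE c0.
    move=> a b [d e]; have [|[g eg]|[g eg]] := fM a%:P b%:P.
    - by exists d%:P; rewrite fE -!polyCM e.
    - by left; exists g`_0; rewrite fE in eg; have := congr1 (fun p : {poly _} => p`_0) eg; rewrite coefC coefMC.
    - by right; exists g`_0; rewrite fE in eg; have := congr1 (fun p : {poly _} => p`_0) eg; rewrite coefC coefMC.
  rewrite fE; apply/divides_polyC => i; apply: IH => // v cv.
  have : map_poly (ieval n v) h = 0.
    apply/eqP; apply: contraT => /closed_nonrootP[x]; rewrite rootE -ieval_upd fh ?eqxx //.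
    by rewrite ieval_upd fE map_polyC /= cv hornerC.
  by move/(congr1 (fun p : {poly K} => p`_i)); rewrite coef_map coef0.
have [//|[r [u [w [r0 e]]]]] := prime_noncst (@factorial_ipoly n) fP f1 h.
have [v] : exists v, ieval n v (r * lead_coef f) != 0.
  by apply: ieval_neq0; rewrite mulf_neq0 // lead_coef_eq0; case: fP.
rewrite rmorphM mulf_eq0 => /norP[rv lv].
have /closed_rootP[x fx] : size (map_poly (ieval n v) f) != 1%N.
  by rewrite size_map_poly_id0 // gtn_eqF.
have fv : ieval n.+1 (upd n v x) f = 0 by apply/eqP; rewrite ieval_upd.
have := congr1 (ieval n.+1 (upd n v x)) e.
rewrite rmorphD !rmorphM fv (fh _ fv) !mulr0 addr0 ieval_upd map_polyC hornerC.
by move/eqP; rewrite (negPf rv).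
Qed.

End IteratedPolynomials.

(** * Hypersurfaces of affine space *)

Section Evaluation.
Context {K : closedFieldType} {T : finType}.
Notation poly := (mpoly #|T| K).
Implicit Types (F G : poly) (v : T -> K) (A : set (T -> K)).

Lemma evalpD F G v : evalp (F + G) v = evalp F v + evalp G v.
Proof. exact: mevalD. Qed.

Lemma evalpB F G v : evalp (F - G) v = evalp F v - evalp G v.
Proof. exact: mevalB. Qed.

Lemma evalpM F G v : evalp (F * G) v = evalp F v * evalp G v.
Proof. exact: mevalM. Qed.

Lemma evalp0 v : evalp (0 : poly) v = 0. Proof. exact: meval0. Qed.
Lemma evalp1 v : evalp (1 : poly) v = 1. Proof. exact: meval1. Qed.
Lemma evalpC a v : evalp (mpolyC _ a : poly) v = a. Proof. exact: mevalC. Qed.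

Lemma evalpXn F n v : evalp (F ^+ n) v = evalp F v ^+ n.
Proof. by rewrite /evalp rmorphXn. Qed.

Lemma evalp_sum I (r : seq I) (P : pred I) (f : I -> poly) v :
  evalp (\sum_(i <- r | P i) f i) v = \sum_(i <- r | P i) evalp (f i) v.
Proof. by rewrite /evalp rmorph_sum. Qed.

Lemma evalp_prod I (r : seq I) (P : pred I) (f : I -> poly) v :
  evalp (\prod_(i <- r | P i) f i) v = \prod_(i <- r | P i) evalp (f i) v.
Proof. by rewrite /evalp rmorph_prod. Qed.

Definition pvar (t : T) : poly := mpolyX _ (mnm1 (enum_rank t)).

Lemma evalp_var t v : evalp (pvar t) v = v t.
Proof. by rewrite /evalp /pvar mevalXU enum_rankK. Qed.

Definition evalpE := (evalpD, evalpB, evalpM, evalp0, evalp1, evalpC, evalpXn, evalp_sum, evalp_prod, evalp_var).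

Lemma evalp_monomial F v :
  evalp F v = \sum_(m <- msupp F) mcoeff m F * \prod_t v t ^+ m (enum_rank t).
Proof.
rewrite /evalp mevalE; apply: eq_bigr => m _; congr (_ * _).
rewrite (reindex_onto (@enum_rank T) enum_val) /=; last by move=> i _; rewrite enum_valK.
by apply: eq_big => [t|t _]; rewrite enum_rankK ?eqxx.
Qed.

Lemma mpoly_monomial F :
  F = \sum_(m <- msupp F) mpolyC _ (mcoeff m F) * \prod_t pvar t ^+ m (enum_rank t).
Proof.
rewrite {1}[F]mpolyE; apply: eq_bigr => m _; rewrite mul_mpolyC; congr (_ *: _).
rewrite [in LHS]mpolyXE_id (reindex_onto (@enum_rank T) enum_val) /=; last by move=> i _; rewrite enum_valK.
by apply: eq_big => [t|t _] //; rewrite enum_rankK eqxx.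
Qed.

(** Algebraic induction on polynomials, which spares the manipulation of monomials. *)
Lemma evalp_ind (P : poly -> Prop) :
  (forall a, P (mpolyC _ a)) -> (forall t, P (pvar t)) ->
  (forall F G, P F -> P G -> P (F + G)) -> (forall F G, P F -> P G -> P (F * G)) ->
  forall F, P F.
Proof.
move=> PC PX PD PM F; rewrite [F]mpoly_monomial.
apply: (big_ind P) => //; first by rewrite -mpolyC0.
move=> m _; apply: (PM) => //; apply: (big_ind P) => //; first exact: PC.
move=> t _; elim: (m _) => [|j IH]; first by rewrite expr0; exact: PC.
by rewrite exprS; exact: PM.
Qed.

Definition prime_on A := forall F G, ideal A (F * G) -> ideal A F \/ ideal A G.

Definition vanishing F : set (T -> K) := [set v | evalp F v = 0].

(** Iterated polynomials are evaluated at streams, so that the number of variables may vary in inductions. *)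
Definition of_stream (u : nat -> K) : T -> K := fun t => u (enum_rank t).

Lemma of_stream_surj v : exists u, of_stream u = v.
Proof.
exists (fun i => if insub i is Some j then v (enum_val (j : 'I_#|T|)) else 0).
by apply/funext => t; rewrite /of_stream valK enum_rankK.
Qed.

Lemma ipoly_var n i : (i < n)%N -> exists f : ipoly K n, forall u, ieval n u f = u i.
Proof.
elim: n => // n IH; rewrite ltnS leq_eqVlt => /orP[/eqP->|/IH[f fE]].
  by exists 'X => u; rewrite ievalS map_polyX hornerX.
by exists f%:P => u; rewrite ievalS map_polyC hornerC -(fE u).
Qed.

Lemma ipoly_const n (a : K) : exists f : ipoly K n, forall u, ieval n u f = a.
Proof.
elim: n => [|n [f fE]]; first by exists a.
by exists f%:P => u; rewrite ievalS map_polyC hornerC -(fE u).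
Qed.

Lemma ipoly_of F : exists f : ipoly K #|T|, forall u, ieval _ u f = evalp F (of_stream u).
Proof.
elim/evalp_ind: F => [a|t|F G [f fE] [g gE]|F G [f fE] [g gE]].
- by have [f fE] := ipoly_const #|T| a; exists f => u; rewrite evalpC fE.
- by have [f fE] := ipoly_var (ltn_ord (enum_rank t)); exists f => u; rewrite evalp_var fE.
- by exists (f + g) => u; rewrite rmorphD fE gE evalpD.
- by exists (f * g) => u; rewrite rmorphM fE gE evalpM.
Qed.

Lemma of_ipoly n (f : ipoly K n) : (n <= #|T|)%N -> exists F, forall u, evalp F (of_stream u) = ieval _ u f.
Proof.
elim: n f => [|n IH] f nT; first by exists (mpolyC _ f) => u; rewrite evalpC.
have {}IH i : exists F, forall u, evalp F (of_stream u) = ieval _ u f`_i by apply: IH; exact: ltnW.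
have [F FE] := choice IH.
exists (\sum_(i < size f) F i * pvar (enum_val (Ordinal nT)) ^+ i) => u.
rewrite ievalS (@horner_coef_wide _ (size f)) ?size_poly // evalp_sum.
apply: eq_bigr => i _; rewrite evalpM evalpXn evalp_var FE coef_map.
by rewrite /of_stream enum_valK.
Qed.

(** Some prime factor of an equation of A vanishes on A, because the ideal of A is prime. *)
Lemma prime_on_factor A F : A !=set0 -> prime_on A -> vanishing F <> setT -> ideal A F ->
  exists2 q : ipoly K #|T|, prime_elt q &
    (forall u, A (of_stream u) -> ieval _ u q = 0) /\
    (forall u, ieval _ u q = 0 -> evalp F (of_stream u) = 0).
Proof.
move=> [a Aa] Ap Fn AF; have [f fE] := ipoly_of F.
have f0 : f != 0.
  apply/eqP => f0; apply: Fn; apply/seteqP; split=> // v _.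
  by have [u <-] := of_stream_surj v; rewrite /vanishing /= -fE f0 rmorph0.
have [c [s [cU sP e]]] := factorial_ipoly f0.
have [q qs qA] : exists2 q, q \in s & forall u, A (of_stream u) -> ieval _ u q = 0.
  have : forall u, A (of_stream u) -> ieval _ u (\prod_(p <- s) p) = 0.
    move=> u Au; have := AF _ Au; rewrite -fE e rmorphM => /eqP.
    by rewrite mulf_eq0 => /orP[|/eqP//]; have := rmorph_unit (ieval #|T| u) cU; rewrite unitfE => /negPf->.
  elim: (s) => [|q t IH].
    have [u eu] := of_stream_surj a; have Au : A (of_stream u) by rewrite eu.
    by move=> /(_ _ Au); rewrite big_nil rmorph1 => /eqP; rewrite oner_eq0.
  rewrite big_cons; set p := \prod_(_ <- _) _ => qp.
  have [Q QE] := of_ipoly q (leqnn _); have [P PE] := of_ipoly p (leqnn _).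
  have [|QA|PA] := Ap Q P.
  - move=> v; have [u <-] := of_stream_surj v => Av.
    by rewrite evalpM QE PE -rmorphM; exact: qp.
  - by exists q; rewrite ?mem_head // => u Au; rewrite -QE; exact: QA.
  have [|r rt rA] := IH; first by move=> u Au; rewrite -PE; exact: PA.
  by exists r => //; rewrite in_cons rt orbT.
exists q; first exact: sP.
split=> // u q0; rewrite -fE e rmorphM (big_rem q) //= rmorphM q0; ring.
Qed.

Lemma prime_on_hypersurface A F : A !=set0 -> prime_on A ->
  vanishing F <> setT -> ideal A F ->
  exists G, [/\ A `<=` vanishing G, vanishing G <> setT & prime_on (vanishing G)].
Proof.
move=> A0 Ap F0 AF; have [q qP [qA qF]] := prime_on_factor A0 Ap F0 AF.
have [Q QE] := of_ipoly q (leqnn _); exists Q; split.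
- move=> v; have [u <-] := of_stream_surj v => Av; rewrite /vanishing /= QE; exact: qA.
- move=> QT; apply: F0; apply/seteqP; split=> // v _; have [u <-] := of_stream_surj v.
  apply: qF; rewrite -QE; suff : vanishing Q (of_stream u) by [].
  by rewrite QT.
move=> G H GH; have [g gE] := ipoly_of G; have [h hE] := ipoly_of H.
have [_ _ qM] := qP.
have /qM[[w e]|[w e]] : divides q (g * h).
  apply: hypersurface_nullstellensatz => // u q0; rewrite rmorphM gE hE -evalpM.
  by apply: GH; rewrite /vanishing /= QE.
- by left=> v; have [u <-] := of_stream_surj v; rewrite /vanishing /= QE -gE e rmorphM => ->; rewrite mulr0.
- by right=> v; have [u <-] := of_stream_surj v; rewrite /vanishing /= QE -hE e rmorphM => ->; rewrite mulr0.
Qed.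

(** Of two prime equations, one divides the other as soon as the zero sets are nested; they are
    then associated. So there is no irreducible set strictly between a hypersurface and the space. *)
Lemma hypersurface_maximal F G : vanishing F !=set0 -> prime_on (vanishing F) ->
  prime_on (vanishing G) -> vanishing F <> setT -> vanishing G <> setT ->
  vanishing F `<=` vanishing G -> vanishing G `<=` vanishing F.
Proof.
move=> F0 Fp Gp FT GT FG.
have G0 : vanishing G !=set0 by case: F0 => v /FG; exists v.
have [|p pP [pF Fp']] := prime_on_factor F0 Fp FT; first by move=> v.
have [|q qP [qG Gq]] := prime_on_factor G0 Gp GT; first by move=> v.
have [|w wU e] := prime_assoc pP qP.
  apply: hypersurface_nullstellensatz => // u p0; apply: qG; apply: FG; exact: Fp'.
move=> v; have [u <-] := of_stream_surj v => /qG q0; apply: Fp'.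
move/eqP: q0; rewrite e rmorphM mulf_eq0 => /orP[|/eqP//].
by have := rmorph_unit (ieval #|T| u) wU; rewrite unitfE => /negPf->.
Qed.

End Evaluation.

(** * Multihomogeneous polynomials and the Zariski topology *)

Section Multihomogeneous.
Context {K : closedFieldType} {S T : finType} (c : T -> S).
Notation poly := (mpoly #|T| K).
Implicit Types (F G : poly) (v : T -> K) (A B X : set (T -> K)) (d : S -> nat).

Definition block_deg (s : S) (m : multinom #|T|) : nat :=
  (\sum_(t | c t == s) m (enum_rank t))%N.

Lemma mhomog0 d : mhomog c d (0 : poly).
Proof. by move=> m; rewrite mcoeff_msupp mcoeff0 eqxx. Qed.

Lemma mhomogD d F G : mhomog c d F -> mhomog c d G -> mhomog c d (F + G).
Proof. by move=> Fd Gd m /msuppD_le; rewrite mem_cat => /orP[/Fd|/Gd]. Qed.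

Lemma mhomogN d F : mhomog c d F -> mhomog c d (- F).
Proof. by move=> Fd m; rewrite (perm_mem (msuppN F)); exact: Fd. Qed.

Lemma mhomogB d F G : mhomog c d F -> mhomog c d G -> mhomog c d (F - G).
Proof. by move=> Fd Gd; apply: mhomogD => //; exact: mhomogN. Qed.

Lemma mhomogM d e F G : mhomog c d F -> mhomog c e G ->
  mhomog c (fun s => d s + e s)%N (F * G).
Proof.
move=> Fd Ge m /msuppM_le /allpairsP[[m1 m2] /= [/Fd h1 /Ge h2 ->]] s.
by rewrite -h1 -h2 -big_split; apply: eq_bigr => t _; rewrite mnmDE.
Qed.

Lemma eq_mhomog d e F : mhomog c d F -> d =1 e -> mhomog c e F.
Proof. by move=> Fd de m /Fd h s; rewrite -de. Qed.
Arguments eq_mhomog {d e F} Fd de m _ s.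

Lemma mhomogC (a : K) : mhomog c (fun=> 0)%N (mpolyC #|T| a).
Proof.
move=> m; rewrite msuppC; case: eqP => // _; rewrite inE => /eqP-> s.
by rewrite big1 // => t _; rewrite mnm0E.
Qed.

Arguments mhomogC a m _ s : clear implicits.

Lemma mhomogCM d a F : mhomog c d F -> mhomog c d (mpolyC _ a * F).
Proof. by move=> Fd; apply: eq_mhomog (mhomogM (mhomogC a) Fd) _ => s. Qed.

Lemma mhomog_var t : mhomog c (fun s => c t == s : nat) (pvar t : poly).
Proof.
move=> m; rewrite msuppX inE => /eqP-> s.
rewrite (eq_bigr (fun i => (t == i) : nat)) => [|i _]; last first.
  by rewrite mnm1E (inj_eq enum_rank_inj).
have [ts|ts] := eqVneq (c t) s.
  by rewrite (bigD1 t) ?ts //= eqxx big1 ?addn0 // => i /andP[_ /negPf]; rewrite eq_sym => ->.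
by rewrite big1 // => i ci; case: eqP => // e; move: ts; rewrite e ci.
Qed.

Arguments mhomog_var t m _ s : clear implicits.

Lemma mhomog_exp d F n : mhomog c d F -> mhomog c (fun s => n * d s)%N (F ^+ n).
Proof.
move=> Fd; elim: n => [|n IH].
  by rewrite expr0; apply: eq_mhomog (mhomogC 1) _ => s; rewrite mul0n.
by rewrite exprS; apply: eq_mhomog (mhomogM Fd IH) _ => s; rewrite mulSn.
Qed.

Lemma mhomog_sum I (r : seq I) (P : pred I) (f : I -> poly) d :
  (forall i, P i -> mhomog c d (f i)) -> mhomog c d (\sum_(i <- r | P i) f i).
Proof. by move=> h; apply: big_ind => //; [exact: mhomog0|exact: mhomogD]. Qed.

Lemma mhomog_prod I (r : seq I) (P : pred I) (f : I -> poly) (e : I -> S -> nat) :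
  (forall i, P i -> mhomog c (e i) (f i)) ->
  mhomog c (fun s => \sum_(i <- r | P i) e i s)%N (\prod_(i <- r | P i) f i).
Proof.
move=> h; elim: r => [|i r IH].
  by rewrite big_nil; apply: eq_mhomog (mhomogC 1) _ => s; rewrite big_nil.
rewrite big_cons; case: ifP => Pi.
  by apply: eq_mhomog (mhomogM (h i Pi) IH) _ => s; rewrite big_cons Pi.
by apply: eq_mhomog IH _ => s; rewrite big_cons Pi.
Qed.

Definition scale (l : S -> K) v : T -> K := fun t => l (c t) * v t.

Definition stable A := forall l v, (forall s, l s != 0) -> A v -> A (scale l v).

Lemma evalp_weight F (w v : T -> K) :
  evalp F (fun t => w t * v t) =
  \sum_(m <- msupp F) mcoeff m F * ((\prod_t w t ^+ m (enum_rank t)) *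
                                     \prod_t v t ^+ m (enum_rank t)).
Proof.
rewrite evalp_monomial; apply: eq_bigr => m _; congr (_ * _).
by rewrite -big_split; apply: eq_bigr => t _; rewrite exprMn.
Qed.

(** Every monomial of F is multiplied by the same factor, since it has degree d s in the block s. *)
Lemma evalp_scale d F l v : mhomog c d F ->
  evalp F (scale l v) = (\prod_s l s ^+ d s) * evalp F v.
Proof.
move=> Fd; rewrite evalp_weight evalp_monomial mulr_sumr.
rewrite big_seq [RHS]big_seq; apply: eq_bigr => m mF.
rewrite [RHS]mulrCA; congr (_ * (_ * _)).
rewrite (partition_big c predT) //=; apply: eq_bigr => s _.
rewrite -(Fd m mF s) -prodrXr; apply: eq_bigr => t /eqP <-//.
Qed.

Lemma scale_neq0 d l : (forall s : S, l s != 0) -> \prod_s (l s : K) ^+ d s != 0.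
Proof. by move=> l0; apply/prodf_neq0 => s _; rewrite expf_neq0. Qed.

Definition block_part s j F : poly :=
  \sum_(m <- msupp F | block_deg s m == j) mpolyC _ (mcoeff m F) * mpolyX _ m.

Lemma mcoeff_block_part s j F m :
  mcoeff m (block_part s j F) = if block_deg s m == j then mcoeff m F else 0.
Proof.
rewrite /block_part raddf_sum /=.
under eq_bigr do rewrite mul_mpolyC mcoeffZ mcoeffX.
have [mF|mF] := boolP (m \in msupp F); last first.
  rewrite (memN_msupp_eq0 mF) if_same big_seq_cond big1 // => m' /andP[m'F _].
  by case: eqP => [e|]; rewrite ?mulr0//; rewrite -e m'F in mF.
rewrite -big_filter; case: ifPn => mj.
  rewrite (bigD1_seq m) ?filter_uniq ?msupp_uniq ?mem_filter ?mj //= eqxx mulr1.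
  by rewrite big1 ?addr0 // => m' /negPf->; rewrite mulr0.
rewrite big_filter big1 // => m' m'j; case: eqP => [e|]; rewrite ?mulr0//.
by rewrite -e m'j in mj.
Qed.

Lemma msupp_block_part s j F m :
  m \in msupp (block_part s j F) -> m \in msupp F /\ block_deg s m = j.
Proof.
by rewrite !mcoeff_msupp mcoeff_block_part; case: (block_deg s m =P j) => [<- h|_]; [by split|by rewrite eqxx].
Qed.

Lemma block_part_decomp s F : exists n, F = \sum_(j < n) block_part s j F.
Proof.
exists (\max_(m <- msupp F) block_deg s m).+1; apply/mpolyP => m.
rewrite raddf_sum /=; under eq_bigr do rewrite mcoeff_block_part.
have [mF|mF] := boolP (m \in msupp F); last first.
  by rewrite (memN_msupp_eq0 mF) big1 // => i _; rewrite if_same.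
have lt : (block_deg s m < (\max_(m <- msupp F) block_deg s m).+1)%N.
  by rewrite ltnS; exact: leq_bigmax_seq.
rewrite (bigD1 (Ordinal lt)) //= eqxx big1 ?addr0 // => i.
by rewrite -val_eqE /= eq_sym => /negPf->.
Qed.

(** Rescaling the block s by x turns F into a polynomial in x whose coefficients are the values of
    the parts of F. The ground field being infinite, they all vanish. *)
Lemma ideal_block_part A F s : stable A -> ideal A F -> forall j, ideal A (block_part s j F).
Proof.
move=> As AF j v Av; have [n e] := block_part_decomp s F.
have [jn|nj] := ltnP j n; last first.
  rewrite /block_part big_seq_cond big1 ?evalp0// => m /andP[mF /eqP mj].
  have : mcoeff m F = 0.
    rewrite e raddf_sum /= big1 // => i _; rewrite mcoeff_block_part mj gtn_eqF //.
    exact: leq_trans (ltn_ord i) nj.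
  by move/eqP; rewrite mcoeff_eq0 mF.
pose p := \sum_(i < n) (evalp (block_part s i F) v) *: 'X^i.
have : 'X * p = 0.
  apply/eqP; apply: contraT => /closed_nonrootP[x]; rewrite rootE hornerM hornerX mulf_eq0.
  move=> /norP[x0]; rewrite horner_sum.
  rewrite (_ : \sum_(i < n) _ = evalp F (scale (fun s' => if s' == s then x else 1) v)).
    by rewrite AF ?eqxx //; apply: As => // s'; case: ifP; rewrite ?oner_eq0.
  rewrite {2}e evalp_sum; apply: eq_bigr => i _; rewrite hornerZ hornerXn.
  rewrite evalp_weight evalp_monomial mulr_suml big_seq [RHS]big_seq.
  apply: eq_bigr => m /msupp_block_part[_ <-]; rewrite mulrAC -mulrA; congr (_ * (_ * _)).
  rewrite -prodrXr big_mkcond; apply: eq_bigr => t _; case: ifP => _ //.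
  by rewrite expr1n.
move/eqP; rewrite mulf_eq0 polyX_eq0 /= => /eqP/(congr1 (fun p : {poly K} => p`_j)).
rewrite coef0 coef_sum (bigD1 (Ordinal jn)) //= coefZ coefXn eqxx mulr1 big1 ?addr0 //.
by move=> i ij; rewrite coefZ coefXn eq_sym (_ : (i == j :> nat) = false) ?mulr0 //; apply/negbTE.
Qed.

(** The components do not depend on the stable set A: a polynomial vanishes on a stable set iff its
    multihomogeneous components do. *)
Lemma homog_components F : exists Fs : seq poly,
  [/\ forall G, G \in Fs -> exists d, mhomog c d G,
      F = \sum_(G <- Fs) G &
      forall A, stable A -> ideal A F -> forall G, G \in Fs -> ideal A G].
Proof.
suff [Fs [h1 h2 h3]] : exists Fs : seq poly,
  [/\ forall G, G \in Fs -> forall s, s \in enum S -> exists d : nat, forall m, m \in msupp G -> block_deg s m = d,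
      F = \sum_(G <- Fs) G &
      forall A, stable A -> ideal A F -> forall G, G \in Fs -> ideal A G].
  exists Fs; split=> // G GF.
  have h s := h1 G GF s (mem_enum predT s).
  have [d dE] := choice h; exists d => m mG s; exact: dE.
elim: (enum S) => [|s r [Fs [h1 h2 h3]]].
  by exists [:: F]; split=> [//||A _ AF G]; rewrite ?big_seq1 // inE => /eqP->.
have ex G : exists n, G = \sum_(j < n) block_part s j G by exact: block_part_decomp.
have [N NE] := choice ex.
exists [seq block_part s j G | G <- Fs, j <- iota 0 (N G)]; split.
- move=> H /allpairsPdep[G [j [GF _ ->]]] s'; rewrite inE => /orP[/eqP->|s'r].
    by exists j => m /msupp_block_part[].
  by have [d hd] := h1 G GF s' s'r; exists d => m /msupp_block_part[/hd].
- rewrite {1}h2 big_allpairs_dep /=; apply: eq_bigr => G _.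
  by rewrite {1}(NE G) -(big_mkord predT (fun j => block_part s j G)) /index_iota subn0.
move=> A As AF H /allpairsPdep[G [j [GF _ ->]]].
by apply: ideal_block_part => //; exact: h3 GF.
Qed.

Lemma proj_points_stable : stable (proj_points c (K:=K)).
Proof.
move=> l v l0 vp s; have [t ts vt] := vp s; exists t => //.
by rewrite /scale mulf_neq0.
Qed.

Lemma zclosed_stable A : zclosed c A -> stable A.
Proof.
move=> [Fs FsP ->] l v l0 [vp vF]; split; first exact: proj_points_stable.
move=> F FF; have [d Fd] := FsP F FF.
by rewrite (evalp_scale _ _ Fd) vF ?mulr0.
Qed.

Lemma zclosed_proj A : zclosed c A -> A `<=` proj_points c.
Proof. by move=> [Fs _ ->] v []. Qed.

Lemma zclosed_closure A : zclosed c (zclosure c A).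
Proof. by exists [set F | (exists d, mhomog c d F) /\ ideal A F] => // F []. Qed.

Lemma sub_zclosure A : A `<=` proj_points c -> A `<=` zclosure c A.
Proof. by move=> Ap v Av; split; [exact: Ap|move=> F [_ AF]; exact: AF]. Qed.

Lemma zclosure_min A B : zclosed c B -> A `<=` B -> zclosure c A `<=` B.
Proof.
move=> [Fs FsP ->] AB v [vp vA]; split=> // F FF; apply: vA; split; first exact: FsP.
by move=> w /AB[_]; exact.
Qed.

Lemma zclosure_mono A B : A `<=` B -> zclosure c A `<=` zclosure c B.
Proof. by move=> AB v [vp vA]; split=> // F [Fd FB]; apply: vA; split=> // w /AB /FB. Qed.

Lemma ideal_homog_zclosure A d F : mhomog c d F -> ideal A F -> ideal (zclosure c A) F.
Proof. by move=> Fd AF v [_]; apply; split=> //; exists d. Qed.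

(** The closure is cut out by forms only, but it satisfies all the polynomial identities of a stable set.
    This is how identities on the blow-up are deduced from identities on an open subset. *)
Lemma ideal_zclosure A F : stable A -> ideal A F -> ideal (zclosure c A) F.
Proof.
move=> As AF v Av; have [Fs [h1 e h3]] := homog_components F.
rewrite e evalp_sum big_seq big1 // => G GF; have [d Gd] := h1 G GF.
exact: (ideal_homog_zclosure Gd (h3 _ As AF _ GF)).
Qed.

Lemma not_idealP A F : ~ ideal A F -> exists2 v, A v & evalp F v != 0.
Proof.
by move=> /existsNP[v /not_implyP[Av /eqP Fv]]; exists v.
Qed.

Lemma zclosed_zero A d F : zclosed c A -> mhomog c d F ->
  zclosed c (A `&` [set v | evalp F v = 0]).
Proof.
move=> [Fs FsP ->] Fd; exists (Fs `|` [set F]).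
  by move=> G [/FsP//|->]; exists d.
apply/seteqP; split=> v.
  by move=> [[vp vF] Fv]; split=> // G [/vF//|->].
by move=> [vp vF]; split; [split=> // G GF|]; apply: vF; [left|right].
Qed.

Definition hprime A := forall d e F G, mhomog c d F -> mhomog c e G ->
  ideal A (F * G) -> ideal A F \/ ideal A G.

Lemma irr_closedP A : irr_closed c A <-> [/\ zclosed c A, A !=set0 & hprime A].
Proof.
split=> [[Ac A0 Ai]|[Ac A0 Ap]].
  split=> // d e F G Fd Ge FG.
  have [||//|E|E] := Ai (A `&` [set v | evalp F v = 0]) (A `&` [set v | evalp G v = 0]).
  - exact: zclosed_zero Fd.
  - exact: zclosed_zero Ge.
  - apply/seteqP; split=> v; last by move=> [[]|[]].
    move=> Av; have := FG _ Av; rewrite evalpM => /eqP; rewrite mulf_eq0 => /orP[/eqP|/eqP] h; by [left|right].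
  - by left=> v; rewrite E => -[].
  - by right=> v; rewrite E => -[].
split=> // B C [Fs FsP BE] [Gs GsP CE] E.
have [|AB] := pselect (A `<=` B).
  by move=> AB; left; apply/seteqP; split=> // v Bv; rewrite E; left.
right; apply/seteqP; split=> [v Av|v Cv]; last by rewrite E; right.
rewrite CE; split; first exact: (zclosed_proj Ac Av).
move=> G GG; have [e Ge] := GsP G GG.
move/existsNP: AB => [w /not_implyP[Aw]]; rewrite BE => /not_andP[[]|].
  exact: (zclosed_proj Ac Aw).
move=> /existsNP[F /not_implyP[FF Fw]]; have [d Fd] := FsP F FF.
have [|AF|AG] := Ap d e F G Fd Ge; last exact: AG.
  move=> u Au; rewrite evalpM; move: (Au); rewrite E => -[]; rewrite ?BE ?CE => -[_ h].
    by rewrite (h F FF) mul0r.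
  by rewrite (h G GG) mulr0.
by case: Fw; exact: AF.
Qed.

(** Primality for forms F extends to an arbitrary second factor G, because its components vanish
    on the stable set where F does not. *)
Lemma hprime_general A d F G : stable A -> hprime A -> mhomog c d F ->
  ideal A (F * G) -> ideal A F \/ ideal A G.
Proof.
move=> As Ap Fd FG; have [AF|AF] := pselect (ideal A F); [by left|right].
have [Gs [h1 h2 h3]] := homog_components G.
pose B := [set v | A v /\ evalp F v != 0].
have Bs : stable B.
  move=> l v l0 [Av Fv]; split; first exact: As.
  by rewrite (evalp_scale _ _ Fd) mulf_neq0 // scale_neq0.
have BG : ideal B G.
  by move=> v [Av Fv]; have /eqP := FG _ Av; rewrite evalpM mulf_eq0 (negPf Fv) => /eqP.
move=> v Av; rewrite h2 evalp_sum big_seq big1 // => H HG; have [e He] := h1 H HG.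
have [|//|AH] := Ap d e F H Fd He; last exact: AH.
move=> w Aw; rewrite evalpM; have [->|Fw] := eqVneq (evalp F w) 0; first by rewrite mul0r.
by rewrite (h3 B Bs BG H HG) ?mulr0.
Qed.

Lemma irr_closure A : A `<=` proj_points c -> A !=set0 -> hprime A -> irr_closed c (zclosure c A).
Proof.
move=> Ap [a Aa] Ah; apply/irr_closedP; split.
- exact: zclosed_closure.
- by exists a; exact: sub_zclosure.
move=> d e F G Fd Ge FG.
have [|h|h] := Ah d e F G Fd Ge; first by move=> v Av; exact: FG (sub_zclosure Ap Av).
  by left; exact: ideal_homog_zclosure Fd h.
by right; exact: ideal_homog_zclosure Ge h.
Qed.

End Multihomogeneous.

Arguments mhomog_var {K S T} c t m _ s.
Arguments mhomogC {K S T} c a m _ s.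
Arguments eq_mhomog {K S T c d e F} Fd de m _ s.
Arguments mhomogM {K S T c d e F G} Fd Ge m _ s.
Arguments mhomog_exp {K S T c d F} n Fd m _ s.
Arguments ideal_zclosure {K S T c A F} As AF v _.
Arguments ideal_homog_zclosure {K S T c A d F} Fd AF v _.

(** * Parametrizations and affine charts *)

Section Substitution.
Context {K : closedFieldType} {T1 T2 : finType}.
Implicit Types (f : T1 -> mpoly #|T2| K) (F : mpoly #|T1| K).

Definition psubst f F : mpoly #|T2| K :=
  \sum_(m <- msupp F) mpolyC _ (mcoeff m F) * \prod_t f t ^+ m (enum_rank t).

Lemma evalp_psubst f F v : evalp (psubst f F) v = evalp F (fun t => evalp (f t) v).
Proof.
rewrite /psubst evalp_sum evalp_monomial; apply: eq_bigr => m _.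
rewrite evalpM evalpC evalp_prod; congr (_ * _); apply: eq_bigr => t _.
exact: evalpXn.
Qed.

Lemma mhomog_psubst (S1 S2 : finType) (c1 : T1 -> S1) (c2 : T2 -> S2)
    (e : S1 -> S2 -> nat) f d F :
  (forall t, mhomog c2 (e (c1 t)) (f t)) -> mhomog c1 d F ->
  mhomog c2 (fun s2 => \sum_s1 d s1 * e s1 s2)%N (psubst f F).
Proof.
move=> se Fd; rewrite /psubst big_seq; apply: mhomog_sum => m mF.
apply: mhomogCM; apply: eq_mhomog.
  by apply: mhomog_prod => t _; apply: mhomog_exp; exact: se.
move=> s2; rewrite (partition_big c1 predT) //=; apply: eq_bigr => s1 _.
rewrite -(Fd m mF s1) big_distrl /=; apply: eq_bigr => t /eqP->; lia.
Qed.

End Substitution.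

Lemma poly_ext (K : closedFieldType) (p q : {poly K}) :
  (forall x, p.[x] = q.[x]) -> p = q.
Proof.
move=> pq; apply/eqP; rewrite -subr_eq0; apply: contraT => /closed_nonrootP[x].
by rewrite rootE hornerD hornerN pq subrr eqxx.
Qed.

Lemma poly_ext_neq0 (K : closedFieldType) (p q : {poly K}) :
  (forall x, x != 0 -> p.[x] = q.[x]) -> p = q.
Proof.
move=> pq; apply: (mulfI (negbT (polyX_eq0 K))); apply: poly_ext => x.
rewrite !hornerM hornerX; have [->|x0] := eqVneq x 0; first by rewrite !mul0r.
by rewrite pq.
Qed.

Lemma poly_ext_generic (K : closedFieldType) (p q r : {poly K}) : r != 0 ->
  (forall x, r.[x] != 0 -> p.[x] = q.[x]) -> p = q.
Proof.
move=> r0 pq; apply: (mulfI r0); apply: poly_ext => x; rewrite !hornerM.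
by have [->|rx] := eqVneq r.[x] 0; [rewrite !mul0r|rewrite pq].
Qed.

Section LinePolynomial.
Context {K : closedFieldType} {V : lmodType K}.
Implicit Types f g : V -> K.

(** The functions that are polynomial on each line. They replace polynomial functions on a vector space
    without coordinates: all that matters is that a product of two of them is zero only if one of them is. *)
Definition linepoly f := forall x y, exists p : {poly K}, forall t, f (x + t *: y) = p.[t].

Lemma linepoly_cst a : linepoly (fun=> a).
Proof. by move=> x y; exists a%:P => t; rewrite hornerC. Qed.

Lemma linepolyD f g : linepoly f -> linepoly g -> linepoly (fun x => f x + g x).
Proof.
by move=> fl gl x y; have [p pE] := fl x y; have [q qE] := gl x y; exists (p + q) => t; rewrite hornerD pE qE.
Qed.

Lemma linepolyM f g : linepoly f -> linepoly g -> linepoly (fun x => f x * g x).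
Proof.
by move=> fl gl x y; have [p pE] := fl x y; have [q qE] := gl x y; exists (p * q) => t; rewrite hornerM pE qE.
Qed.

Lemma linepoly_sum I (r : seq I) (P : pred I) (f : I -> V -> K) :
  (forall i, linepoly (f i)) -> linepoly (fun x => \sum_(i <- r | P i) f i x).
Proof.
move=> fl x y; elim: r => [|i r [p pE]].
  by exists 0 => t; rewrite big_nil horner0.
have [q qE] := fl i x y; exists (if P i then q + p else p) => t.
by rewrite big_cons; case: ifP => _; rewrite ?hornerD pE // qE.
Qed.

Lemma linepoly_prod I (r : seq I) (P : pred I) (f : I -> V -> K) :
  (forall i, linepoly (f i)) -> linepoly (fun x => \prod_(i <- r | P i) f i x).
Proof.
move=> fl x y; elim: r => [|i r [p pE]].
  by exists 1 => t; rewrite big_nil hornerC.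
have [q qE] := fl i x y; exists (if P i then q * p else p) => t.
by rewrite big_cons; case: ifP => _; rewrite ?hornerM pE // qE.
Qed.

Lemma linepolyB f g : linepoly f -> linepoly g -> linepoly (fun x => f x - g x).
Proof.
by move=> fl gl x y; have [p pE] := fl x y; have [q qE] := gl x y; exists (p - q) => t; rewrite hornerD hornerN pE qE.
Qed.

Lemma linepoly_affine f : (exists a b : V -> K, forall x y t, f (x + t *: y) = a x + t * b y) -> linepoly f.
Proof.
move=> [a [b h]] x y; exists ((a x)%:P + 'X * (b y)%:P) => t.
by rewrite h hornerD hornerM !hornerC hornerX.
Qed.

Lemma linepoly_evalp (T : finType) (F : mpoly #|T| K) (w : V -> T -> K) :
  (forall t, linepoly (w^~ t)) -> linepoly (fun x => evalp F (w x)).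
Proof.
move=> wl; elim/(@evalp_ind K T): F => [a|t|F G FE GE|F G FE GE] x y.
- by exists a%:P => u; rewrite evalpC hornerC.
- by have [p pE] := wl t x y; exists p => u; rewrite evalp_var.
- have [p pE] := FE x y; have [q qE] := GE x y.
  by exists (p + q) => u; rewrite evalpD pE qE hornerD.
- have [p pE] := FE x y; have [q qE] := GE x y.
  by exists (p * q) => u; rewrite evalpM pE qE hornerM.
Qed.

Lemma linepoly_det n (A : V -> 'M[K]_n) :
  (forall i j, linepoly (fun x => A x i j)) -> linepoly (fun x => \det (A x)).
Proof.
move=> Al; apply: linepoly_sum => s; apply: linepolyM; first exact: linepoly_cst.
by apply: linepoly_prod => i; exact: Al.
Qed.

Lemma linepoly_mul m n p (A : V -> 'M[K]_(m, n)) (B : V -> 'M[K]_(n, p)) :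
  (forall i j, linepoly (fun x => A x i j)) -> (forall i j, linepoly (fun x => B x i j)) ->
  forall i j, linepoly (fun x => (A x *m B x) i j).
Proof.
move=> Al Bl i j.
have -> : (fun x => (A x *m B x) i j) = (fun x => \sum_l A x i l * B x l j).
  by apply/funext => x; rewrite mxE.
by apply: linepoly_sum => l; exact: linepolyM.
Qed.

(** Restriction to the line through a point where f is nonzero and a point where g is nonzero. *)
Lemma linepoly_generic f g : linepoly f -> linepoly g ->
  (exists x, f x != 0) -> (exists y, g y != 0) -> exists z, f z != 0 /\ g z != 0.
Proof.
move=> fl gl [x fx] [y gy]; have [p pE] := fl x (y - x); have [q qE] := gl x (y - x).
have : p * q != 0.
  rewrite mulf_neq0 //.
    by apply: contra_neq fx => p0; rewrite -[x]addr0 -(scale0r (y - x)) pE p0 horner0.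
  apply: contra_neq gy => q0; have e : x + 1 *: (y - x) = y by rewrite scale1r addrC subrK.
  by rewrite -e qE q0 horner0.
move=> /closed_nonrootP[t]; rewrite rootE hornerM -pE -qE mulf_eq0 => /norP[ft gt].
by exists (x + t *: (y - x)).
Qed.

Lemma linepoly_mul_eq0 f g : linepoly f -> linepoly g -> (forall x, f x * g x = 0) ->
  (forall x, f x = 0) \/ (forall x, g x = 0).
Proof.
move=> fl gl fg; have [f0|/existsNP[x /eqP fx]] := pselect (forall x, f x = 0); [by left|right=> y].
apply/eqP; apply: contraT => gy; have [||z [fz gz]] := linepoly_generic fl gl; [by exists x|by exists y|].
by have /eqP := fg z; rewrite mulf_eq0 (negPf fz) (negPf gz).
Qed.

Lemma linepoly_linear m1 m2 (A : V -> 'M[K]_(m1, m2)) :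
  (exists b : V -> 'M[K]_(m1, m2), forall x y t, A (x + t *: y) = A x + t *: b y) ->
  forall i j, linepoly (fun x => A x i j).
Proof.
move=> [b h] i j; apply: linepoly_affine; exists (fun x => A x i j), (fun y => b y i j) => x y t.
by rewrite h !mxE.
Qed.

End LinePolynomial.

(** A set parametrized by a vector space is irreducible. The parametrization may leave the set where q
    vanishes, as happens for matrices that do not have full rank. *)
Lemma hprime_param {K : closedFieldType} {S T : finType} (c : T -> S) {V : lmodType K}
    (par : V -> T -> K) (q : V -> K) (A : set (T -> K)) :
  (forall t, linepoly (par^~ t)) -> linepoly q -> (exists u, q u != 0) ->
  (forall u, q u != 0 -> A (par u)) ->
  (forall v, A v -> exists u l, (forall s, l s != 0) /\ v = scale c l (par u)) -> hprime c A.
Proof.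
move=> parl ql [u0 qu0] qA Apar d e F G Fd Ge FG.
have Fl (H : mpoly #|T| K) : linepoly (fun u => evalp H (par u)) by exact: linepoly_evalp.
have h u : q u * (evalp F (par u) * evalp G (par u)) = 0.
  have [->|/qA Au] := eqVneq (q u) 0; first by rewrite mul0r.
  by rewrite -evalpM FG ?mulr0.
have [q0|{}h] := linepoly_mul_eq0 ql (linepolyM (Fl F) (Fl G)) h; first by rewrite q0 eqxx in qu0.
have [F0|G0] := linepoly_mul_eq0 (Fl F) (Fl G) h; [left|right] => v /Apar[u [l [_ ->]]].
  by rewrite (evalp_scale _ _ Fd) F0 mulr0.
by rewrite (evalp_scale _ _ Ge) G0 mulr0.
Qed.

Section Charts.
Context {K : closedFieldType} {S T T' : finType} (c : T -> S).
Notation poly := (mpoly #|T| K).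
Notation poly' := (mpoly #|T'| K).
Context (X : set (T -> K)) (phi : (T' -> K) -> T -> K) (h : poly).

(** The complement of the hypersurface h = 0 in X, parametrized by an affine space. [chart_coord] says that each
    polynomial function on it is the restriction of a form, without any power of h as a denominator: the
    parametrization selects representatives of the points for which this is possible. *)
Record chart : Prop := Chart {
  chart_poly : forall t, exists F : poly', forall a, phi a t = evalp F a;
  chart_in : forall a, X (phi a);
  chart_homog : exists d, mhomog c d h;
  chart_unit : forall a, evalp h (phi a) != 0;
  chart_surj : forall v, X v -> evalp h v != 0 ->
    exists a l, (forall s, l s != 0) /\ v = scale c l (phi a);
  chart_coord : forall g : poly', exists d F, mhomog c d F /\ forall a, evalp F (phi a) = evalp g a }.

Context (Xirr : irr_closed c X) (ch : chart).

Lemma chart_pull F : exists g : poly', forall a, evalp g a = evalp F (phi a).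
Proof.
have [s sE] := choice (chart_poly ch).
exists (psubst s F) => a; rewrite evalp_psubst; congr evalp; apply/funext => t.
by rewrite sE.
Qed.

Lemma scaleVK (l : S -> K) (v : T -> K) : (forall s, l s != 0) -> scale c (fun s => (l s)^-1) (scale c l v) = v.
Proof. by move=> l0; apply/funext => t; rewrite /scale mulKf. Qed.

Lemma chart_point B v : stable c B -> B `<=` X -> B v -> evalp h v != 0 ->
  exists a l, [/\ (forall s, l s != 0), v = scale c l (phi a) & B (phi a)].
Proof.
move=> Bs BX Bv hv; have [a [l [l0 e]]] := chart_surj ch (BX _ Bv) hv.
exists a, l; split=> //; rewrite -(scaleVK (phi a) l0) -e; apply: Bs => // s.
by rewrite invr_eq0.
Qed.

Lemma chart_vanish B d F : stable c B -> B `<=` X -> mhomog c d F ->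
  (forall a, B (phi a) -> evalp F (phi a) = 0) -> ideal B (h * F).
Proof.
move=> Bs BX Fd F0 v Bv; rewrite evalpM; have [->|hv] := eqVneq (evalp h v) 0.
  by rewrite mul0r.
have [a [l [l0 -> Ba]]] := chart_point Bs BX Bv hv.
by rewrite (evalp_scale _ _ Fd) F0 // !mulr0.
Qed.

Lemma chart_trace B : irr_closed c B -> B `<=` X -> ~ ideal B h ->
  [/\ phi @^-1` B !=set0, prime_on (phi @^-1` B) &
      B = zclosure c (phi @` (phi @^-1` B))].
Proof.
move=> /irr_closedP[Bc B0 Bp] BX hB; have Bs := zclosed_stable Bc.
have [dh hd] := chart_homog ch.
split.
- have [v Bv hv] := not_idealP hB.
  by have [a [l [_ _ Ba]]] := chart_point Bs BX Bv hv; exists a.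
- move=> F G FG.
  have [d [F' [Fd FE]]] := chart_coord ch F; have [e [G' [Ge GE]]] := chart_coord ch G.
  have := chart_vanish Bs BX (mhomogM Fd Ge).
  have H a : B (phi a) -> evalp (F' * G') (phi a) = 0.
    by move=> Ba; rewrite evalpM FE GE -evalpM; exact: FG.
  move=> /(_ H)/(Bp _ _ _ _ hd (mhomogM Fd Ge))[//|/(Bp _ _ _ _ Fd Ge)[h'|h']].
  + by left=> a Ba; rewrite -FE; exact: h'.
  + by right=> a Ba; rewrite -GE; exact: h'.
apply/seteqP; split; last first.
  by apply: zclosure_min => // _ [a Ba <-].
move=> v Bv; split; first exact: (zclosed_proj Bc Bv).
move=> F [[d Fd] F0].
have /(Bp _ _ _ _ hd Fd)[//|] : ideal B (h * F).
  by apply: (chart_vanish Bs BX Fd) => a Ba; apply: F0; exists a.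
exact.
Qed.

Lemma chart_closure_proper g : vanishing g <> setT ->
  zclosure c (phi @` vanishing g) `<` X.
Proof.
have [Xc _ _] := Xirr; move=> gT; split.
  by apply: zclosure_min => // _ [a _ <-]; exact: chart_in ch a.
move=> XP; apply: gT; apply/seteqP; split=> // a _; have [d [F [Fd FE]]] := chart_coord ch g.
rewrite /vanishing /= -FE.
have FP : ideal (zclosure c (phi @` vanishing g)) F.
  by apply: ideal_homog_zclosure Fd _ => _ [b gb <-]; rewrite FE.
apply: FP; apply: XP; exact: chart_in ch a.
Qed.

Lemma chart_closure_irr g : vanishing g !=set0 -> prime_on (vanishing g) ->
  irr_closed c (zclosure c (phi @` vanishing g)).
Proof.
have [Xc _ _] := Xirr; move=> [a0 ga0] gp; apply: irr_closure.
- by move=> _ [a _ <-]; exact: (zclosed_proj Xc (chart_in ch a)).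
- by exists (phi a0), a0.
move=> d e F G _ _ FG; have [F' FE] := chart_pull F; have [G' GE] := chart_pull G.
have [a ga|F0|G0] := gp F' G'.
- by rewrite evalpM FE GE -evalpM; apply: FG; exists a.
- by left=> _ [a ga <-]; rewrite -FE; exact: F0.
- by right=> _ [a ga <-]; rewrite -GE; exact: G0.
Qed.

Lemma chart_not_ideal B : phi @^-1` B !=set0 -> ~ ideal B h.
Proof. by move=> [a Ba] /(_ _ Ba); apply/eqP; exact: chart_unit ch a. Qed.

(** Some form vanishes on B and not on X. Its restriction to the chart is a nonzero equation of
    the trace of B, of which one takes a prime factor. *)
Lemma chart_hypersurface B : irr_closed c B -> B `<` X -> ~ ideal B h ->
  exists g, [/\ phi @^-1` B `<=` vanishing g, vanishing g <> setT & prime_on (vanishing g)].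
Proof.
move=> Bi [BX XB] hB; have [Z0 Zp BE] := chart_trace Bi BX hB.
have [Xc X0 Xp] := (irr_closedP c X).1 Xirr; have [dh hd] := chart_homog ch.
have [[Fs FsP BF] _ _] := Bi.
have [v [Xv Bv]] : exists v, X v /\ ~ B v.
  by move/existsNP: XB => [v /not_implyP[]]; exists v.
move: (Bv); rewrite {1}BF => /not_andP[[]|/existsNP[F /not_implyP[FF Fv]]].
  exact: (zclosed_proj Xc Xv).
have [d Fd] := FsP F FF; have [g gE] := chart_pull F.
apply: (prime_on_hypersurface (F := g)) => //.
  move=> gT; apply: Fv.
  have /(Xp _ _ _ _ hd Fd)[hX|] : ideal X (h * F).
  - apply: (chart_vanish (zclosed_stable Xc) _ Fd) => //.
    by move=> a _; rewrite -gE; have : vanishing g a by rewrite gT.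
  - by case: hB => w /BX /hX.
  exact.
move=> a; rewrite /= BF gE => -[_]; exact.
Qed.

(** Hypersurfaces are maximal among the irreducible proper subsets of affine space, and an irreducible subset
    of X that meets the chart is the closure of its trace. *)
Theorem chart_prime_divisor g : vanishing g !=set0 -> prime_on (vanishing g) ->
  vanishing g <> setT -> prime_divisor c X (zclosure c (phi @` vanishing g)).
Proof.
move=> g0 gp gT; have Pi := chart_closure_irr g0 gp.
have PX := chart_closure_proper gT.
split=> // B Bi PB BX; have [|XB] := pselect (X `<=` B).
  by right; apply/seteqP.
left; have gB : vanishing g `<=` phi @^-1` B.
  move=> a ga; apply: PB; apply: sub_zclosure; last by exists a.
  by have [Xc _ _] := Xirr; move=> _ [b _ <-]; exact: (zclosed_proj Xc (chart_in ch b)).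
have hB : ~ ideal B h.
  by apply: chart_not_ideal; case: g0 => a /gB; exists a.
have [|g' [Bg' g'T g'p]] := chart_hypersurface Bi _ hB; first by split.
have [_ _ BE] := chart_trace Bi BX hB.
apply/seteqP; split=> //; rewrite [X in X `<=` _]BE; apply: zclosure_mono.
move=> _ [a Ba <-]; exists a => //.
exact: (hypersurface_maximal g0 gp g'p gT g'T (subset_trans gB Bg') (Bg' _ Ba)).
Qed.

Theorem prime_divisor_chart P : prime_divisor c X P -> ~ ideal P h ->
  exists g, [/\ vanishing g !=set0, vanishing g <> setT,
    P = zclosure c (phi @` vanishing g) & phi @^-1` P = vanishing g].
Proof.
move=> [Pi PX Pm] hP; have [g [Pg gT gp]] := chart_hypersurface Pi PX hP.
have [Z0 _ PE] := chart_trace Pi (properW PX) hP.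
have g0 : vanishing g !=set0 by case: Z0 => a /Pg; exists a.
have Pi' := chart_closure_irr g0 gp; have [P'X XP'] := chart_closure_proper gT.
have PP' : P `<=` zclosure c (phi @` vanishing g).
  by rewrite {1}PE; apply: zclosure_mono => _ [a Pa <-]; exists a => //; exact: Pg.
have [e|e] := Pm _ Pi' PP' P'X; last by case: XP'; rewrite e.
exists g; split=> //; apply/seteqP; split=> // a ga.
rewrite /= -e; apply: sub_zclosure; last by exists a.
by have [Xc _ _] := Xirr; move=> _ [b _ <-]; exact: (zclosed_proj Xc (chart_in ch b)).
Qed.

Lemma chart_prime_divisor_trace B g : irr_closed c B -> B `<=` X -> ~ ideal B h ->
  phi @^-1` B = vanishing g -> vanishing g <> setT -> prime_divisor c X B.
Proof.
move=> Bi BX hB BE gT; have [g0 gp e] := chart_trace Bi BX hB.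
by rewrite e BE; apply: chart_prime_divisor => //; rewrite -BE.
Qed.

End Charts.

(** It is enough to homogenize the coordinates: sums are formed with the help of forms u and w that are
    equal to 1 on the parametrization and that equalize the degrees. *)
Lemma homogenize (K : closedFieldType) (S T T' : finType) (c : T -> S) (phi : (T' -> K) -> T -> K) :
  (forall t, exists d F u, [/\ mhomog c d F, mhomog c d u,
      forall a, evalp F (phi a) = a t & forall a, evalp u (phi a) = 1]) ->
  forall g : mpoly #|T'| K, exists d F u, [/\ mhomog c d F, mhomog c d u,
      forall a, evalp F (phi a) = evalp g a & forall a, evalp u (phi a) = 1].
Proof.
move=> h; elim/(@evalp_ind K T') => [b|t|F G|F G].
- exists (fun=> 0)%N, (mpolyC _ b), (mpolyC _ 1); split; try exact: mhomogC.
  + by move=> a; rewrite !evalpC.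
  + by move=> a; rewrite evalpC.
- have [d [F [u [Fd ud FE uE]]]] := h t; exists d, F, u; split=> // a.
  by rewrite FE evalp_var.
- move=> [d [F' [u [Fd ud FE uE]]]] [e [G' [w [Ge we GE wE]]]].
  exists (fun s => d s + e s)%N, (F' * w + u * G'), (u * w); split.
  + by apply: mhomogD; exact: mhomogM.
  + exact: mhomogM.
  + by move=> a; rewrite !evalpE FE GE uE wE mulr1 mul1r.
  + by move=> a; rewrite evalpM uE wE mulr1.
- move=> [d [F' [u [Fd ud FE uE]]]] [e [G' [w [Ge we GE wE]]]].
  exists (fun s => d s + e s)%N, (F' * G'), (u * w); split; try exact: mhomogM.
  + by move=> a; rewrite !evalpE FE GE.
  + by move=> a; rewrite evalpM uE wE mulr1.
Qed.

Lemma evalp_det (K : closedFieldType) (T : finType) n (A : 'M[mpoly #|T| K]_n) v :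
  evalp (\det A) v = \det (\matrix_(i, j) evalp (A i j) v).
Proof.
rewrite /evalp -[LHS]/(meval _ _) -det_map_mx; congr (\det _).
by apply/matrixP => i j; rewrite !mxE.
Qed.

Lemma mhomog_det (K : closedFieldType) (S T : finType) (c : T -> S) n (d : 'I_n -> S -> nat)
    (A : 'M[mpoly #|T| K]_n) :
  (forall i j, mhomog c (d i) (A i j)) -> mhomog c (fun s => \sum_i d i s)%N (\det A).
Proof.
move=> Ad; apply: mhomog_sum => s _.
rewrite -signr_odd; have -> : (-1) ^+ odd (perm.odd_perm s) = mpolyC #|T| ((-1) ^+ (perm.odd_perm s)) :> mpoly #|T| K.
  by case: (perm.odd_perm s); rewrite ?expr1 ?expr0 ?mpolyCN.
apply: mhomogCM; exact (mhomog_prod (r := index_enum _) (P := xpredT) (fun i _ => Ad i _)).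
Qed.

Section Arcs.
Context {K : closedFieldType} {T : finType}.

(** The polynomial F(g(x)) in the variable x, for a polynomial arc g. *)
Definition arc_poly (F : mpoly #|T| K) (g : T -> {poly K}) : {poly K} :=
  \sum_(m <- msupp F) (mcoeff m F)%:P * \prod_t g t ^+ m (enum_rank t).

Lemma arc_polyE F g x : (arc_poly F g).[x] = evalp F (fun t => (g t).[x]).
Proof.
rewrite horner_sum evalp_monomial; apply: eq_bigr => m _; rewrite hornerM hornerC horner_prod.
by congr (_ * _); apply: eq_bigr => t _; rewrite horner_exp.
Qed.

Lemma dvdp_XnP (p : {poly K}) m : reflect (forall j, (j < m)%N -> p`_j = 0) ('X^m %| p).
Proof.
apply: (iffP idP) => [/Pdiv.Field.dvdpP[q ->] j jm|h]; first by rewrite coefMXn jm.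
rewrite -(poly_take_drop m p) (_ : take_poly m p = 0) ?add0r ?dvdp_mull //.
by apply/polyP => j; rewrite coef_take_poly coef0; case: ifP => // /h.
Qed.

End Arcs.

(** * Orders of vanishing *)

Section Orders.
Context {K : closedFieldType} {S T : finType} (c : T -> S).
Notation poly := (mpoly #|T| K).
Implicit Types (F G : poly) (X P : set (T -> K)).

Lemma ord_geS X P F m : ord_ge X P F m.+1 -> ord_ge X P F m.
Proof.
move=> [G GP [n [a [b [bP E]]]]]; exists G => //.
exists n, (fun i => a i * b i ord_max), (fun i j => b i (widen_ord (leqnSn m) j)).
split=> // v Xv; rewrite -(E v Xv); congr (evalp (_ - _) v).
by apply: eq_bigr => i _; rewrite big_ord_recr /= mulrA mulrAC.
Qed.

Lemma ord_ge_le X P F m m' : (m' <= m)%N -> ord_ge X P F m -> ord_ge X P F m'.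
Proof.
elim: m => [|m IH]; first by rewrite leqn0 => /eqP->.
by rewrite leq_eqVlt => /orP[/eqP->//|]; rewrite ltnS => /IH {}IH /ord_geS.
Qed.

Lemma ord_ge_local X P F G H u m : ~ ideal P G -> ideal P u ->
  ideal X (G * F - H * u ^+ m) -> ord_ge X P F m.
Proof.
move=> GP uP E; exists G => //; exists 1%N, (fun=> H), (fun _ _ => u); split=> //.
by rewrite big_ord1 prodr_const card_ord.
Qed.

Lemma ord_ge0 X P F : P !=set0 -> ord_ge X P F 0.
Proof.
move=> [v Pv]; apply: (@ord_ge_local X P F 1 F 0) => [/(_ v Pv)/eqP|w _|w _].
- by rewrite evalp1 oner_eq0.
- exact: evalp0.
- by rewrite expr0 mul1r mulr1 subrr evalp0.
Qed.

(** The order is defined by choice among the integers at which [ord_ge] stops; a bound ensures that there is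
    one. *)
Lemma ord_bounded X P F M : P !=set0 -> (forall m, ord_ge X P F m -> (m <= M)%N) ->
  ord_ge X P F (ord X P F) /\ ~ ord_ge X P F (ord X P F).+1.
Proof.
move=> P0 bM; rewrite /ord.
have [m mP] : exists m, ord_ge X P F m /\ ~ ord_ge X P F m.+1.
  apply: contrapT => /forallNP h.
  have : forall m, ord_ge X P F m.
    elim=> [|m IH]; first exact: ord_ge0.
    by apply: contrapT => nm; apply: (h m).
  by move=> /(_ M.+1)/bM; rewrite ltnn.
exact: (@xgetI _ (0%N) [set m | ord_ge X P F m /\ ~ ord_ge X P F m.+1] m mP).
Qed.

Lemma ord_eq X P F M : P !=set0 -> ord_ge X P F M ->
  (forall m, ord_ge X P F m -> (m <= M)%N) -> ord X P F = M.
Proof.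
move=> P0 geM leM; have [h1 h2] := ord_bounded P0 leM.
apply/eqP; rewrite eqn_leq leM //= leqNgt; apply/negP => lt; apply: h2.
exact: ord_ge_le geM.
Qed.

Lemma ord_notin X P d F : irr_closed c P -> P `<=` X -> mhomog c d F ->
  ~ ideal P F -> ord X P F = 0%N.
Proof.
move=> /irr_closedP[Pc P0 Pp] PX Fd FP; apply: ord_eq => //; first exact: ord_ge0.
move=> [//|m] /(ord_ge_le (ltn0Sn m))[G GP [n [a [b [bP E]]]]]; exfalso.
have [|//|//] := hprime_general (G := G) (zclosed_stable Pc) Pp Fd.
move=> v Pv; have := E v (PX _ Pv); rewrite evalpB evalp_sum big1 ?subr0 => [|i _].
  by rewrite mulrC.
by rewrite big_ord1 evalpM bP ?mulr0.
Qed.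

(** If F is in the m-th power of the ideal of P up to a factor G, then its restriction to an arc that
    meets P at time 0, outside of the zeros of G, is divisible by the m-th power of the
    parameter. The arc only has to lie in X generically. *)
Lemma ord_ge_arc X P F m : ord_ge X P F m -> exists2 G, ~ ideal P G &
  forall (g : T -> {poly K}) (p r : {poly K}), r != 0 ->
    (forall x, r.[x] != 0 -> X (fun t => (g t).[x])) -> P (fun t => (g t).[0]) ->
    evalp G (fun t => (g t).[0]) != 0 ->
    (forall x, p.[x] = evalp F (fun t => (g t).[x])) -> 'X^m %| p.
Proof.
move=> [G GP [n [a [b [bP E]]]]]; exists G => // g p r r0 gX gP Gg pE.
pose q H := arc_poly H g.
have e : q G * p = \sum_i q (a i) * \prod_j q (b i j).
  apply: (poly_ext_generic r0) => x x0; rewrite hornerM arc_polyE pE -evalpM.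
  have /eqP := E _ (gX x x0); rewrite evalpB subr_eq0 => /eqP->.
  rewrite evalp_sum horner_sum; apply: eq_bigr => i _; rewrite evalpM hornerM arc_polyE.
  by rewrite evalp_prod horner_prod; congr (_ * _); apply: eq_bigr => j _; rewrite arc_polyE.
have Xb i j : 'X %| q (b i j).
  by rewrite -['X]subr0 -polyC0 dvdp_XsubCl rootE arc_polyE bP.
have : 'X^m %| q G * p.
  rewrite e; apply: (big_ind (fun p : {poly K} => 'X^m %| p)); rewrite ?dvdp0 //.
    by move=> ? ?; exact: dvdp_add.
  move=> i _; apply: dvdp_mull.
  have -> : 'X^m = \prod_(j < m) 'X :> {poly K} by rewrite prodr_const card_ord.
  by apply: (big_ind2 (fun p q : {poly K} => p %| q)) => // *; exact: dvdp_mul.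
by rewrite Gauss_dvdpr // coprimep_expl // coprimep_sym coprimepX rootE arc_polyE.
Qed.

End Orders.

(** * Families of arcs *)

Section PolynomialFamilies.
Context {K : closedFieldType} {V : lmodType K}.
Implicit Types f g : V -> {poly K}.

Definition linefam f := forall j, linepoly (fun u => (f u)`_j).

Lemma linefam_cst p : linefam (fun=> p).
Proof. by move=> j; exact: linepoly_cst. Qed.

Lemma linefamC (a : V -> K) : linepoly a -> linefam (fun u => (a u)%:P).
Proof.
move=> al j; case: (eqVneq j 0%N) => [->|j0].
  by under eq_fun do rewrite coefC eqxx.
by under eq_fun do rewrite coefC (negPf j0); exact: linepoly_cst.
Qed.

Lemma linefamD f g : linefam f -> linefam g -> linefam (fun u => f u + g u).
Proof. by move=> fl gl j; under eq_fun do rewrite coefD; exact: (linepolyD (fl j) (gl j)). Qed.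

Lemma linefamB f g : linefam f -> linefam g -> linefam (fun u => f u - g u).
Proof. by move=> fl gl j; under eq_fun do rewrite coefB; exact: (linepolyB (fl j) (gl j)). Qed.

Lemma linefamM f g : linefam f -> linefam g -> linefam (fun u => f u * g u).
Proof.
move=> fl gl j; under eq_fun do rewrite coefM.
apply: (@linepoly_sum _ _ _ _ _ (fun (i : 'I_j.+1) u => (f u)`_i * (g u)`_(j - i))) => i.
exact: (linepolyM (fl _) (gl _)).
Qed.

Lemma linefam_sum I (r : seq I) (P : pred I) (f : I -> V -> {poly K}) :
  (forall i, linefam (f i)) -> linefam (fun u => \sum_(i <- r | P i) f i u).
Proof. by move=> fl j; under eq_fun do rewrite coef_sum; apply: (@linepoly_sum _ _ _ _ _ (fun i u => (f i u)`_j)) => i; exact: (fl i j). Qed.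

Lemma linefam_prod I (r : seq I) (P : pred I) (f : I -> V -> {poly K}) :
  (forall i, linefam (f i)) -> linefam (fun u => \prod_(i <- r | P i) f i u).
Proof.
move=> fl; elim: r => [|i r IH].
  by under eq_fun do rewrite big_nil; exact: linefam_cst.
under eq_fun do rewrite big_cons.
by case: (P i) => //; exact: (linefamM (fl i) IH).
Qed.

Lemma linefam_exp f n : linefam f -> linefam (fun u => f u ^+ n).
Proof.
move=> fl; elim: n => [|n IH]; first by under eq_fun do rewrite expr0; exact: linefam_cst.
by under eq_fun do rewrite exprS; exact: (linefamM fl IH).
Qed.

Lemma linefam_drop f n : linefam f -> linefam (fun u => drop_poly n (f u)).
Proof. by move=> fl j; under eq_fun do rewrite coef_drop_poly; exact: fl. Qed.

Lemma linefam_det n (A : V -> 'M[{poly K}]_n) :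
  (forall i j, linefam (fun u => A u i j)) -> linefam (fun u => \det (A u)).
Proof.
move=> Al; apply: linefam_sum => s; apply: linefamM; first exact: linefam_cst.
by apply: linefam_prod => i; exact: Al.
Qed.

Lemma linefam_arc_poly (T : finType) (F : mpoly #|T| K) (g : V -> T -> {poly K}) :
  (forall t, linefam (fun u => g u t)) -> linefam (fun u => arc_poly F (g u)).
Proof.
move=> gl; apply: linefam_sum => m; apply: linefamM; first exact: linefam_cst.
by apply: linefam_prod => t; exact: linefam_exp.
Qed.

End PolynomialFamilies.

Section ArcFamilies.
Context {K : closedFieldType} {S T : finType} (c : T -> S) {V : lmodType K}.
Implicit Types (X P : set (T -> K)).

(** The factor G of [ord_ge] is not known, so that the divisibility holds on a general arc of the family only;
    it extends to all of them because the vanishing of the first coefficients is a closed condition.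
    The scaling l adjusts the representative of the point at time 0, at which G is nonzero. *)
Lemma ord_ge_family X P d F m (g : V -> T -> {poly K}) :
  stable c X -> stable c P -> mhomog c d F -> (forall t, linefam (fun u => g u t)) ->
  (forall G, ~ ideal P G -> exists (q : V -> K) u l, [/\ linepoly q, (forall s, l s != 0), q u != 0,
     evalp G (scale c l (fun t => (g u t).[0])) != 0 &
     forall u, q u != 0 -> P (fun t => (g u t).[0]) /\
       exists2 r : {poly K}, r != 0 & forall x, r.[x] != 0 -> X (fun t => (g u t).[x])]) ->
  ord_ge X P F m -> forall u, 'X^m %| arc_poly F (g u).
Proof.
move=> Xs Ps Fd gl H /ord_ge_arc[G GP arc] u.
have [q [u0 [l [ql l0 qu0 Gu0 qP]]]] := H G GP.
have Gl : linepoly (fun u => evalp G (scale c l (fun t => (g u t).[0]))).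
  apply: linepoly_evalp => t; apply: linepolyM; first exact: linepoly_cst.
  by have := gl t 0%N; under eq_fun do rewrite -horner_coef0.
apply/dvdp_XnP => j jm; apply/eqP; apply: contraT => pj.
have [||||z [z1 z2]] := @linepoly_generic _ _ (fun u => (arc_poly F (g u))`_j * q u)
  (fun u => evalp G (scale c l (fun t => (g u t).[0]))).
- by apply: linepolyM => //; exact: linefam_arc_poly.
- exact: Gl.
- have [||||y [y1 y2]] := @linepoly_generic _ _ (fun u => (arc_poly F (g u))`_j) q.
  + exact: linefam_arc_poly.
  + exact: ql.
  + by exists u.
  + by exists u0.
  by exists y; rewrite mulf_neq0.
- by exists u0.
move: z1; rewrite mulf_eq0 => /norP[pz qz]; have [Pz [r r0 rX]] := qP z qz.
have hE x : (fun t => ((l (c t))%:P * g z t).[x]) = scale c l (fun t => (g z t).[x]).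
  by apply/funext => t; rewrite hornerM hornerC.
have /dvdp_XnP/(_ j jm) : 'X^m %| (\prod_s l s ^+ d s)%:P * arc_poly F (g z).
  apply: (arc (fun t => (l (c t))%:P * g z t) _ r r0) => [x rx|||x].
  - by rewrite hE; apply: Xs => //; exact: rX.
  - by rewrite hE; exact: Ps.
  - by rewrite hE.
  - by rewrite hE (evalp_scale _ _ Fd) hornerM hornerC arc_polyE.
by rewrite coefCM => /eqP; rewrite mulf_eq0 (negPf pz) orbF (negPf (scale_neq0 _ l0)).
Qed.

End ArcFamilies.

(** * Closedness of finitely generated cones *)

Section Farkas.
Context {R : realFieldType} {d : nat}.
Implicit Types (v b : 'rV[R]_d) (f : 'cV[R]_d) (s : seq 'rV[R]_d).

Definition pair_rc v f : R := (v *m f) 0 0.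

Lemma pair_rcBZ v w c f : pair_rc (v - c *: w) f = pair_rc v f - c * pair_rc w f.
Proof. by rewrite /pair_rc mulmxBl -scalemxAl !mxE. Qed.

Lemma pair_rcBZr v c f g : pair_rc v (f - c *: g) = pair_rc v f - c * pair_rc v g.
Proof. by rewrite /pair_rc mulmxBr -scalemxAr !mxE. Qed.

Context (N : 'rV[R]_d -> Prop)
  (N0 : N 0) (ND : forall v w, N v -> N w -> N (v + w)) (NZ : forall c v, N v -> N (c *: v)).

(** N is given as a predicate; a matrix of maximal rank among those with rows in N describes it. *)
Lemma subspace_matrix : exists B : 'M[R]_d, forall v, N v <-> (v <= B)%MS.
Proof.
pose Q r := `[< exists2 B : 'M[R]_d, \rank B = r & forall v, (v <= B)%MS -> N v >].
have Q0 : exists r, Q r.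
  by exists 0%N; apply/asboolP; exists 0; [exact: mxrank0|move=> v; rewrite submx0 => /eqP->].
have Qd r : Q r -> (r <= d)%N by move=> /asboolP[B <- _]; exact: rank_leq_row.
case: (ex_maxnP Q0 Qd) => r /asboolP[B rB NB] rmax; exists B => v; split; last exact: NB.
move=> Nv; apply: contraT => vB.
have : Q (\rank (B + v)%MS).
  apply/asboolP; exists (B + v)%MS => // w /sub_addsmxP[[u1 u2] /= ->].
  apply: ND; first by apply: NB; exact: submxMl.
  by rewrite [u2]mx11_scalar mul_scalar_mx; exact: NZ.
move/rmax; rewrite -rB leqNgt => /negP[]; apply: rank_ltmx.
by rewrite /ltmx addsmxSl /= addsmx_sub submx_refl.
Qed.

(** The sum of N and of the cone generated by s. *)
Fixpoint in_cone s b : Prop :=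
  if s is a :: s' then exists2 c, 0 <= c & in_cone s' (b - c *: a) else N b.

(** A cone relation between the projections along a onto the hyperplane f = 0 lifts to the original
    vectors, with a nonnegative coefficient of a since f is negative on a only. *)
Lemma in_cone_project s a f b : pair_rc a f < 0 -> (forall v, v \in s -> 0 <= pair_rc v f) ->
  in_cone [seq v - (pair_rc v f / pair_rc a f) *: a | v <- s] b ->
  exists2 c, 0 <= c & in_cone s (b - c *: a).
Proof.
move=> af; elim: s b => [|v s IH] b sf /=; first by exists 0; rewrite // scale0r subr0.
move=> [c c0 /IH[|c' c'0 h]]; first by move=> w ws; apply: sf; rewrite in_cons ws orbT.
have vf : pair_rc v f / pair_rc a f <= 0.
  by apply: mulr_ge0_le0; [apply: sf; rewrite mem_head|rewrite invr_le0 ltW].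
exists (c' - c * (pair_rc v f / pair_rc a f)).
  by rewrite subr_ge0 (le_trans _ c'0) // mulr_ge0_le0.
exists c => //; move: h; congr (in_cone _ _).
by apply/rowP => i; rewrite !mxE; ring.
Qed.

(** Induction on the generators. If the functional f obtained without a is negative on a, all the vectors
    are projected along a to the hyperplane f = 0, and the functional g found for the
    projections is composed with the projection. *)
Theorem farkas s b : ~ in_cone s b -> exists f,
  [/\ forall v, N v -> pair_rc v f = 0, forall v, v \in s -> 0 <= pair_rc v f & pair_rc b f < 0].
Proof.
have [n] := ubnP (size s); elim: n s b => // n IH [|a s] b /= sn nb.
  have [B BN] := subspace_matrix.
  have : ~~ (b <= B)%MS by apply/negP => /BN.
  rewrite submxE => /rV0Pn[j bj].
  have E c v : pair_rc v (c *: col j (cokermx B)) = c * (v *m cokermx B) 0 j.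
    rewrite /pair_rc -scalemxAr mxE; congr (_ * _); rewrite !mxE.
    by apply: eq_bigr => l _; rewrite mxE.
  exists (- (b *m cokermx B) 0 j *: col j (cokermx B)); split=> // [v /BN|]; rewrite E.
    by rewrite submxE => /eqP->; rewrite [X in _ * X]mxE mulr0.
  by rewrite mulNr oppr_lt0 -expr2 exprn_even_gt0.
have [|f [fN fs fb]] := IH s b sn.
  by move=> h; apply: nb; exists 0; rewrite ?scale0r ?subr0.
have [af|af] := leP 0 (pair_rc a f).
  by exists f; split=> // v; rewrite in_cons => /orP[/eqP->|/fs].
have bf0 : 0 <= pair_rc b f / pair_rc a f by rewrite mulr_le0 ?invr_le0 ?ltW.
have [||g [gN gs gb]] := IH [seq v - (pair_rc v f / pair_rc a f) *: a | v <- s] (b - (pair_rc b f / pair_rc a f) *: a).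
- by rewrite size_map.
- move=> /(in_cone_project af fs)[c c0 h]; apply: nb.
  exists (pair_rc b f / pair_rc a f + c); first exact: addr_ge0.
  by move: h; congr (in_cone _ _); rewrite scalerDl opprD addrA.
have af0 : pair_rc a f != 0 by rewrite lt_eqF.
exists (g - (pair_rc a g / pair_rc a f) *: f).
have E v : pair_rc v (g - (pair_rc a g / pair_rc a f) *: f) = pair_rc (v - (pair_rc v f / pair_rc a f) *: a) g.
  by rewrite pair_rcBZr pair_rcBZ; field.
split=> [v Nv|v|]; rewrite E //.
- by rewrite fN // mul0r scale0r subr0 gN.
- rewrite in_cons => /orP[/eqP->|vs]; first by rewrite divff // scale1r subrr /pair_rc mul0mx mxE.
  by apply: gs; apply/mapP; exists v.
Qed.

Lemma in_coneP (I : eqType) (l : seq I) (h : I -> 'rV[R]_d) b : uniq l -> in_cone [seq h i | i <- l] b ->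
  exists2 c : I -> R, forall i, 0 <= c i & N (b - \sum_(i <- l) c i *: h i).
Proof.
elim: l b => [|i l IH] b /=; first by exists (fun=> 0) => //; rewrite big_nil subr0.
move=> /andP[il ul] [c0 c00 /(IH _ ul)[c cP Nc]].
exists (fun j => if j == i then c0 else c j); first by move=> j; case: ifP.
move: Nc; congr N; rewrite big_cons eqxx opprD addrA; congr (_ - _).
by apply: eq_big_seq => j jl; case: eqVneq => // e; rewrite -e jl in il.
Qed.

End Farkas.

(** The functionals f are those on the quotient by N that are nonnegative on the generators: this is the form
    in which convergence in N^1 gives information on a limit x. *)
Theorem finitely_generated_cone_closed (R : realFieldType) (m : nat) (N : ('I_m -> R) -> Prop) (x : 'I_m -> R) :
  N (fun=> 0) -> (forall a b, N a -> N b -> N (fun j => a j + b j)) ->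
  (forall c a, N a -> N (fun j => c * a j)) ->
  (forall f : 'I_m -> R, (forall j, 0 <= f j) -> (forall a, N a -> \sum_j a j * f j = 0) ->
    0 <= \sum_j x j * f j) ->
  exists2 c : 'I_m -> R, forall j, 0 <= c j & N (fun j => x j - c j).
Proof.
move=> N0 ND NZ H.
pose N' (v : 'rV[R]_m) := N (fun j => v 0 j).
pose b : 'rV[R]_m := \row_j x j.
have N'0 : N' 0 by rewrite /N' (_ : (fun j => _) = fun=> 0) //; apply/funext => j; rewrite mxE.
have N'D v w : N' v -> N' w -> N' (v + w).
  by rewrite /N' => /ND h /h; congr N; apply/funext => j; rewrite mxE.
have N'Z c v : N' v -> N' (c *: v).
  by rewrite /N' => /(NZ c); congr N; apply/funext => j; rewrite mxE.
have pairE v f : pair_rc v f = \sum_j v 0 j * f j 0 by rewrite /pair_rc mxE.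
have [/(in_coneP (enum_uniq 'I_m))[c c0 Nc]|/(farkas N'0 N'D N'Z)[f [fN fs fb]]] :=
  pselect (in_cone N' [seq delta_mx 0 j | j <- enum 'I_m] b).
  exists c => //; move: Nc; rewrite /N'; congr N; apply/funext => j.
  rewrite mxE [(\row_j _) 0 j]mxE mxE summxE (bigD1_seq j) ?mem_enum ?enum_uniq //= !mxE !eqxx mulr1 big1 ?addr0 //.
  by move=> i ij; rewrite !mxE eqxx /= eq_sym (negPf ij) mulr0.
exfalso; have := H (fun j => f j 0) _ _; rewrite leNgt.
rewrite -(_ : pair_rc b f = \sum_j x j * f j 0) ?fb; last first.
  by rewrite pairE; apply: eq_bigr => j _; rewrite mxE.
move=> h; suff : false by []; apply: h => [j|a Na].
  have := fs (delta_mx 0 j) (map_f _ (mem_enum _ _)); rewrite pairE (bigD1 j) //= mxE !eqxx mul1r big1 ?addr0 //.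
  by move=> i ij; rewrite mxE eqxx /= (negPf ij) mul0r.
transitivity (pair_rc (\row_j a j) f).
  by rewrite pairE; apply: eq_bigr => j _; rewrite mxE.
apply: fN; rewrite /N'; move: Na; congr N.
by apply/funext => j; rewrite mxE.
Qed.

(** * Divisors modulo linear and numerical equivalence *)

Section DivisorCalculus.
Context {K : closedFieldType} {S T : finType} (c : T -> S) {R : realType} (X : set (T -> K)).
Notation rdiv := (set (T -> K) -> R).
Implicit Types (D E : rdiv) (psi : set (T -> K) -> R) (a : R).

Definition support D : set (set (T -> K)) := [set P | D P != 0].

Lemma pairing_finite (A : set (set (T -> K))) D psi : support D `<=` A ->
  pairing D psi = \sum_(P \in A) D P * psi P.
Proof.
move=> DA; apply/esym/fsbig_widen => // P [_ PA] /=.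
have [->|D0] := eqVneq (D P) 0; first by rewrite mul0r.
by case: PA; exact: DA.
Qed.

Lemma is_rdivD D E : is_rdiv c X D -> is_rdiv c X E -> is_rdiv c X (fun P => D P + E P).
Proof.
move=> [Df Dp] [Ef Ep]; split.
  apply: (sub_finite_set (B := support D `|` support E)); last by rewrite finite_setU.
  move=> P /=; have [D0|] := eqVneq (D P) 0; last by left.
  by rewrite D0 add0r; right.
move=> P; have [D0|D0] := eqVneq (D P) 0; last by move=> _; exact: Dp.
by rewrite D0 add0r; exact: Ep.
Qed.

Lemma is_rdivZ a D : is_rdiv c X D -> is_rdiv c X (fun P => a * D P).
Proof.
move=> [Df Dp]; split.
  by apply: (sub_finite_set (B := support D)) => // P /=; apply: contra_neq => ->; rewrite mulr0.
by move=> P h; apply: Dp; move: h; apply: contra_neq => ->; rewrite mulr0.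
Qed.

Lemma is_rdiv0 : is_rdiv c X (fun=> 0 : R).
Proof.
split; last by move=> P; rewrite eqxx.
by apply: (sub_finite_set (B := set0)) => // P /=; rewrite eqxx.
Qed.

Lemma is_rdivB D E : is_rdiv c X D -> is_rdiv c X E -> is_rdiv c X (fun P => D P - E P).
Proof.
move=> Dr /(is_rdivZ (-1)) Er; have := is_rdivD Dr Er.
by congr is_rdiv; apply/funext => P; rewrite mulN1r.
Qed.

Lemma is_rdiv_sum n (D : 'I_n -> rdiv) : (forall i, is_rdiv c X (D i)) ->
  is_rdiv c X (fun P => \sum_i D i P).
Proof.
move=> Dr; elim: n D Dr => [|n IH] D Dr.
  by have := is_rdiv0; congr is_rdiv; apply/funext => P; rewrite big_ord0.
have := is_rdivD (IH _ (fun i => Dr (widen_ord (leqnSn n) i))) (Dr ord_max).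
by congr is_rdiv; apply/funext => P; rewrite big_ord_recr.
Qed.

Lemma is_rdiv_prime P : prime_divisor c X P -> is_rdiv c X (prime_div P : rdiv).
Proof.
move=> Pd; have h Q : (prime_div P : rdiv) Q != 0 -> Q = P.
  by rewrite /prime_div; case: asboolP => //; rewrite eqxx.
split; last by move=> Q /h ->.
by apply: (sub_finite_set (B := [set P])) => // Q /h.
Qed.

Lemma pairingD D E psi : is_rdiv c X D -> is_rdiv c X E ->
  pairing (fun P => D P + E P) psi = pairing D psi + pairing E psi.
Proof.
move=> [Df _] [Ef _]; pose A := support D `|` support E.
have Af : finite_set A by rewrite finite_setU.
rewrite (pairing_finite (A := A)); last first.
  move=> P; rewrite /support /=; have [D0|] := eqVneq (D P) 0; last by left.
  by rewrite D0 add0r; right.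
rewrite (pairing_finite (A := A) (D := D)); last by move=> P; left.
rewrite (pairing_finite (A := A) (D := E)); last by move=> P; right.
by rewrite -fsbig_split //; apply: eq_fsbigr => P _; rewrite mulrDl.
Qed.

Lemma pairingZ a D psi : pairing (fun P => a * D P) psi = a * pairing D psi.
Proof.
by rewrite /pairing mulr_fsumr; apply: eq_fsbigr => P _; rewrite mulrA.
Qed.

Lemma pairing0 psi : pairing (fun=> 0 : R) psi = 0.
Proof. by rewrite /pairing fsbig1 // => P _; rewrite mul0r. Qed.

Lemma pairing_ge0 D psi : (forall P, 0 <= D P) -> (forall P, D P != 0 -> 0 <= psi P) -> 0 <= pairing D psi.
Proof.
move=> D0 p0; apply: fsumr_ge0 => P _; have [->|Dn] := eqVneq (D P) 0; first by rewrite mul0r.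
by rewrite mulr_ge0 // p0.
Qed.

Lemma pairing_psi_sum n D (f : 'I_n -> R) (psi : 'I_n -> set (T -> K) -> R) : is_rdiv c X D ->
  pairing D (fun P => \sum_j f j * psi j P) = \sum_j pairing D (psi j) * f j.
Proof.
move=> [Df _]; rewrite (pairing_finite (A := support D)) // fsbig_finite //.
under [RHS]eq_bigr do rewrite (pairing_finite (A := support D)) // fsbig_finite // mulr_suml.
rewrite exchange_big; apply: eq_bigr => P _; rewrite mulr_sumr.
by apply: eq_bigr => j _; ring.
Qed.

Notation leq_div := (@lin_equiv _ _ _ c R X).

Lemma lin_equiv_eq D E : D = E -> leq_div D E.
Proof.
move=> ->; exists 0%N, (fun=> 0), (fun _ _ => 0); split; first by case.
by apply/funext => P; rewrite subrr /lincomb big_ord0.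
Qed.

Lemma lin_equivD D1 E1 D2 E2 : leq_div D1 E1 -> leq_div D2 E2 ->
  leq_div (fun P => D1 P + D2 P) (fun P => E1 P + E2 P).
Proof.
move=> [n1 [a1 [N1 [p1 e1]]]] [n2 [a2 [N2 [p2 e2]]]].
exists (n1 + n2)%N, (fun i : 'I_(n1 + n2) => match fintype.split i with inl j => a1 j | inr j => a2 j end),
  (fun i : 'I_(n1 + n2) => match fintype.split i with inl j => N1 j | inr j => N2 j end); split.
  by move=> i; case: (fintype.split i).
apply/funext => P; rewrite /lincomb big_split_ord /=.
under eq_bigr do rewrite (unsplitK (inl _ : 'I_n1 + 'I_n2)%type).
under [X in _ = _ + X]eq_bigr do rewrite (unsplitK (inr _ : 'I_n1 + 'I_n2)%type).
have := congr1 (fun f => f P) e1; have := congr1 (fun f => f P) e2; rewrite /lincomb => <- <-.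
ring.
Qed.

Lemma lin_equivZ a D E : leq_div D E -> leq_div (fun P => a * D P) (fun P => a * E P).
Proof.
move=> [n [b [N [p e]]]]; exists n, (fun i => a * b i), N; split=> //.
apply/funext => P; rewrite -mulrBr; have -> := congr1 (fun f => f P) e.
by rewrite /lincomb mulr_sumr; apply: eq_bigr => i _; rewrite mulrA.
Qed.

Lemma lin_equiv_div d F G : mhomog c d F -> mhomog c d G -> ~ ideal X F -> ~ ideal X G ->
  leq_div (div_of c X F) (div_of c X G).
Proof.
move=> Fd Gd FX GX; exists 1%N, (fun=> 1), (fun _ P => div_of c X F P - div_of c X G P); split.
  by move=> _; exists F, G, d.
by apply/funext => P; rewrite /lincomb big_ord1 mul1r.
Qed.

(** Two linearly equivalent divisors differ by a divisor that moves to 0, which avoids every curve. *)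
Lemma lin_equiv_num D E : leq_div D E -> num_equiv c X D E.
Proof.
move=> DE C _; exists (fun=> 0); split.
- exact: is_rdiv0.
- have := lin_equivD DE (lin_equivZ (-1) (lin_equiv_eq (erefl E))).
  congr lin_equiv; apply/funext => P; ring.
- by move=> P; rewrite eqxx.
exact: pairing0.
Qed.

Lemma num_trivialD D E : num_trivial c X D -> num_trivial c X E -> num_trivial c X (fun P => D P + E P).
Proof.
move=> Dn En C CX; have [D' [D'r DD' D'C D'0]] := Dn C CX; have [E' [E'r EE' E'C E'0]] := En C CX.
exists (fun P => D' P + E' P); split.
- exact: is_rdivD.
- exact: lin_equivD.
- move=> P; have [D0|] := eqVneq (D' P) 0; last by move=> h _; exact: D'C.
  by rewrite D0 add0r; exact: E'C.
by rewrite pairingD // D'0 E'0 addr0.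
Qed.

Lemma num_trivialZ a D : num_trivial c X D -> num_trivial c X (fun P => a * D P).
Proof.
move=> Dn C CX; have [D' [D'r DD' D'C D'0]] := Dn C CX.
exists (fun P => a * D' P); split.
- exact: is_rdivZ.
- exact: lin_equivZ.
- by move=> P h; apply: D'C; apply: contra_neq h => ->; rewrite mulr0.
by rewrite pairingZ D'0 mulr0.
Qed.

Lemma num_trivial0 : num_trivial c X (fun=> 0 : R).
Proof.
have := lin_equiv_num (lin_equiv_eq (erefl ((fun=> 0) : rdiv))).
by rewrite /num_equiv; congr num_trivial; apply/funext => P; rewrite subrr.
Qed.

Lemma num_equiv_refl D : num_equiv c X D D.
Proof. exact/lin_equiv_num/lin_equiv_eq. Qed.

Lemma num_equiv_trans D E F : num_equiv c X D E -> num_equiv c X E F -> num_equiv c X D F.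
Proof.
move=> DE EF; have := num_trivialD DE EF; rewrite /num_equiv.
by congr num_trivial; apply/funext => P; ring.
Qed.

Lemma num_equiv_lincomb n (a : 'I_n -> R) (D E : 'I_n -> rdiv) : (forall i, num_equiv c X (D i) (E i)) ->
  num_equiv c X (lincomb a D) (lincomb a E).
Proof.
move=> DE; suff : num_trivial c X (fun P => \sum_i a i * (D i P - E i P)).
  rewrite /num_equiv; congr num_trivial; apply/funext => P.
  by rewrite /lincomb -sumrB; apply: eq_bigr => i _; rewrite mulrBr.
elim: n a D E DE => [|n IH] a D E DE.
  by have := num_trivial0; congr num_trivial; apply/funext => P; rewrite big_ord0.
have := num_trivialD (IH (fun i => a (widen_ord (leqnSn n) i)) _ _ (fun i => DE (widen_ord (leqnSn n) i)))
  (num_trivialZ (a ord_max) (DE ord_max)).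
by congr num_trivial; apply/funext => P; rewrite big_ord_recr.
Qed.

Lemma effective_lincomb n (a : 'I_n -> R) (E : 'I_n -> rdiv) : (forall i, 0 <= a i) ->
  (forall i, effective c X (E i)) -> effective c X (lincomb a E).
Proof.
move=> a0 Ee; split; first by apply: is_rdiv_sum => i; apply: is_rdivZ; case: (Ee i).
by move=> P; apply: sumr_ge0 => i _; apply: mulr_ge0 => //; case: (Ee i).
Qed.

Lemma effective_prime P : prime_divisor c X P -> effective c X (prime_div P : rdiv).
Proof.
by move=> Pd; split; [exact: is_rdiv_prime|move=> Q; rewrite /prime_div; case: ifP].
Qed.

Section FiniteCone.
Context (m : nat) (g : 'I_m -> set (T -> K)).
Context (gP : forall j, prime_divisor c X (g j)).
Context (gen : forall P, prime_divisor c X P -> exists2 b : 'I_m -> R, forall j, 0 <= b j &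
   leq_div (prime_div P) (fun Q => \sum_j b j * prime_div (g j) Q)).

(** A chosen expression of each prime divisor in terms of the generators; as a function of the prime divisor
    it is a linear functional on divisors. *)
Definition gcoef (j : 'I_m) (P : set (T -> K)) : R :=
  match pselect (prime_divisor c X P) with
  | left Pd => s2val (cid2 (gen Pd)) j
  | right _ => 0
  end.

Lemma gcoef_ge0 j P : 0 <= gcoef j P.
Proof.
rewrite /gcoef; case: pselect => // Pd; exact: (s2valP (cid2 (gen Pd))).
Qed.

Lemma gcoef_equiv P : prime_divisor c X P ->
  leq_div (prime_div P) (fun Q => \sum_j gcoef j P * prime_div (g j) Q).
Proof.
move=> Pd; have := s2valP' (cid2 (gen Pd)); congr lin_equiv; apply/funext => Q.
by apply: eq_bigr => j _; rewrite /gcoef; case: pselect => // Pd'; rewrite (Prop_irrelevance Pd' Pd).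
Qed.

Lemma rdiv_equiv D : is_rdiv c X D ->
  leq_div D (fun Q => \sum_j pairing D (gcoef j) * prime_div (g j) Q).
Proof.
move=> Dr; have [Df Dp] := Dr.
pose s := fset_set (support D).
have sP P : P \in s -> prime_divisor c X P.
  by rewrite in_fset_set // => /set_mem /Dp.
have e : D = (fun Q => \sum_(P <- s) D P * prime_div P Q).
  apply/funext => Q; have [Qs|Qs] := boolP (Q \in s).
    rewrite (bigD1_seq Q) ?fset_uniq //= [prime_div Q Q](_ : _ = 1) ?mulr1; last first.
      by rewrite /prime_div; case: asboolP.
    by rewrite big1 ?addr0 // => P /eqP PQ; rewrite /prime_div; case: asboolP => [e|]; rewrite ?mulr0 //; case: PQ.
  rewrite big_seq big1 => [|P Ps].
    by move: Qs; rewrite in_fset_set // notin_setE /support /= => /negP/negPn/eqP.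
  by rewrite /prime_div; case: asboolP => [e|]; rewrite ?mulr0 //; rewrite -e (negPf Qs) in Ps.
have e' : (fun Q => \sum_j pairing D (gcoef j) * prime_div (g j) Q) =
    (fun Q => \sum_(P <- s) D P * \sum_j gcoef j P * prime_div (g j) Q).
  apply/funext => Q; under eq_bigr do rewrite (pairing_finite (A := support D)) // fsbig_finite // mulr_suml.
  rewrite exchange_big; apply: eq_bigr => P _; rewrite mulr_sumr.
  by apply: eq_bigr => j _; rewrite mulrA.
have sP' P : P \in enum_fset s -> prime_divisor c X P by exact: sP.
rewrite e' {1}e; elim: (enum_fset s) sP' => [|P l IH] lP.
  by apply: lin_equiv_eq; apply/funext => Q; rewrite !big_nil.
have := lin_equivD (lin_equivZ (D P) (gcoef_equiv (lP P (mem_head _ _))))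
  (IH (fun Q Ql => lP Q (@mem_behead _ (P :: l) Q Ql))).
by congr lin_equiv; apply/funext => Q; rewrite big_cons.
Qed.

(** A functional f that is nonnegative on the generators and zero on the numerically trivial combinations
    of them induces a functional on N^1 that is nonnegative on effective divisors, hence on
    their limits; the closedness of the cone concludes. Conversely a divisor of the cone is the
    limit of a constant sequence of effective divisors. *)
Theorem pseff_finite_cone (G : set rdiv) :
  (forall j, exists2 E, G E & num_equiv c X (prime_div (g j)) E) ->
  (forall E, G E -> exists2 E', effective c X E' & num_equiv c X E E') ->
  pseff c X = cone c X G.
Proof.
move=> gG Geff; apply/seteqP; split=> D; last first.
  move=> [Dr [n [a [E [a0 EG DE]]]]]; split=> //.
  pose E' i := s2val (cid2 (Geff _ (EG i))).
  have E'e i : effective c X (E' i) by exact: (s2valP (cid2 (Geff _ (EG i)))).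
  have EE' i : num_equiv c X (E i) (E' i) by exact: (s2valP' (cid2 (Geff _ (EG i)))).
  have Le := effective_lincomb a0 E'e.
  exists (fun=> lincomb a E') => [_ //|psi psi0].
  suff -> : pairing D psi = pairing (lincomb a E') psi by exact: cvg_cst.
  have := psi0 (fun P => D P - lincomb a E' P) (is_rdivB Dr Le.1) (num_equiv_trans DE (num_equiv_lincomb a EE')).
  have -> : (fun P => D P - lincomb a E' P) = (fun P => D P + (-1) * lincomb a E' P).
    by apply/funext => P; rewrite mulN1r.
  rewrite pairingD ?pairingZ //; last exact/is_rdivZ/Le.1.
  by rewrite mulN1r => /eqP; rewrite subr_eq0 => /eqP.
move=> [Dr [u ue uD]]; split=> //.
pose N (b : 'I_m -> R) := num_trivial c X (fun Q => \sum_j b j * (prime_div (g j) : rdiv) Q).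
have [||||b b0 Nb] := @finitely_generated_cone_closed R m N (fun j => pairing D (gcoef j)).
- by rewrite /N; have := num_trivial0; congr num_trivial; apply/funext => Q; rewrite big1 // => j _; rewrite mul0r.
- move=> a b Na Nb; have := num_trivialD Na Nb; congr num_trivial; apply/funext => Q.
  by rewrite -big_split; apply: eq_bigr => j _; rewrite mulrDl.
- move=> a b Nb; have := num_trivialZ a Nb; congr num_trivial; apply/funext => Q.
  by rewrite mulr_sumr; apply: eq_bigr => j _; rewrite mulrA.
- move=> f f0 fN; rewrite -(pairing_psi_sum f gcoef Dr).
  set psi := (fun P => _); have h : pairing (u n) psi @[n --> \oo] --> pairing D psi.
    apply: uD => E Er En; rewrite (pairing_psi_sum f gcoef Er); apply: fN.
    have := num_trivialD En (num_trivialZ (-1) (lin_equiv_num (rdiv_equiv Er))).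
    by congr num_trivial; apply/funext => Q; ring.
  apply: (cvgr_to_ge h); apply: nearW => n; have [_ un0] := ue n.
  apply: pairing_ge0 => // P _; apply: sumr_ge0 => j _; apply: mulr_ge0 => //; exact: gcoef_ge0.
pose E j := s2val (cid2 (gG j)).
have EG j : G (E j) by exact: (s2valP (cid2 (gG j))).
have gE j : num_equiv c X (prime_div (g j)) (E j) by exact: (s2valP' (cid2 (gG j))).
exists m, b, E; split=> //.
apply: num_equiv_trans (num_equiv_lincomb b gE).
have := num_trivialD (lin_equiv_num (rdiv_equiv Dr)) Nb; congr num_trivial; apply/funext => Q.
under [X in _ + X = _]eq_bigr do rewrite mulrBl.
by rewrite sumrB /lincomb; ring.
Qed.

End FiniteCone.
End DivisorCalculus.

(** * The Cauchy-Binet formula *)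

Section CauchyBinet.
Context {K : closedFieldType} {k n : nat}.
Notation J := (plucker_index k n).
Implicit Types (A W : 'M[K]_(k, n)) (B N : 'M[K]_(n, k)).

Lemma plucker_index_homo (I : J) (i j : 'I_k) : (i < j)%N -> (val I i < val I j)%N.
Proof. by have /forallP/(_ i)/forallP/(_ j)/implyP := valP I. Qed.

Lemma plucker_index_inj (I : J) : injective (val I).
Proof.
move=> i j e; case: (ltngtP i j) => [ij|ij|ij]; last exact: val_inj.
  by have := plucker_index_homo I ij; rewrite e ltnn.
by have := plucker_index_homo I ij; rewrite e ltnn.
Qed.

(** An injective map is an increasing map preceded by a permutation. *)
Definition index_perm (u : J * 'S_k) : {ffun 'I_k -> 'I_n} := [ffun i => val u.1 (u.2 i)].

Lemma sorted_index (I : J) : sorted ltn [seq (val I i : nat) | i <- enum 'I_k].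
Proof.
rewrite sorted_map; apply: (@sub_sorted _ (relpre (fun i : 'I_k => i : nat) ltn)).
  by move=> i j; exact: plucker_index_homo.
by rewrite -sorted_map val_enum_ord; exact: iota_ltn_sorted.
Qed.

Lemma index_perm_inj : injective index_perm.
Proof.
move=> [I s] [I' s'] /ffunP e.
have {}e i : val I (s i) = val I' (s' i) by have := e i; rewrite !ffunE.
have eI i : val I i = val I' i.
  have /eq_in_map/(_ i) : [seq (val I i : nat) | i <- enum 'I_k] = [seq (val I' i : nat) | i <- enum 'I_k].
    apply: (irr_sorted_eq ltn_trans ltnn); try exact: sorted_index.
    move=> x; apply/mapP/mapP => -[j _ ->].
      by exists (s' (s^-1 j)%g); rewrite ?mem_enum // -e permKV.
    by exists (s (s'^-1 j)%g); rewrite ?mem_enum // e permKV.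
  by rewrite mem_enum => /(_ isT) /val_inj.
have EI : I = I' by apply/val_inj/ffunP.
rewrite EI in e *; congr (_, _); apply/permP => i.
exact: (@plucker_index_inj I' _ _ (e i)).
Qed.

Lemma index_perm_onto (f : {ffun 'I_k -> 'I_n}) : injective f -> exists u, index_perm u = f.
Proof.
move=> fi; pose r := relpre (fun i : 'I_n => i : nat) leq.
have sz : size (sort r (codom f)) == k by rewrite size_sort size_codom card_ord.
pose t := Tuple sz.
have /tuple_permP[s es] : perm_eq (codom f) t by rewrite perm_sym /= perm_sort.
have tE i : f i = tnth t (s i).
  have /(congr1 (fun l => nth (f i) l i)) := es.
  by rewrite codomE (nth_map i) ?size_enum_ord // nth_ord_enum -tnth_nth tnth_mktuple.
have tS : sorted ltn [seq nat_of_ord x | x : 'I_n <- t].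
  rewrite sorted_map.
  have : sorted (relpre (fun i : 'I_n => i : nat) ltn) t = uniq t && sorted r t.
    by rewrite -!sorted_map ltn_sorted_uniq_leq map_inj_uniq //; exact: val_inj.
  move=> ->; rewrite /= sort_uniq sort_sorted; last by move=> i j; exact: leq_total.
  by rewrite andbT; apply/injectiveP.
pose g : {ffun 'I_k -> 'I_n} := [ffun i => tnth t i].
have IP : [forall i : 'I_k, forall j : 'I_k, (i < j)%N ==>
            (g i < g j)%N].
  apply/forallP => i; apply/forallP => j; apply/implyP => ij; rewrite !ffunE.
  have szt : size [seq nat_of_ord x | x : 'I_n <- t] = k by rewrite size_map size_tuple.
  have := @sorted_ltn_nth _ ltn ltn_trans 0%N _ tS i j.
  rewrite !inE szt !ltn_ord => /(_ isT isT ij).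
  by rewrite !(nth_map (tnth t i)) ?size_tuple // -!tnth_nth.
by exists (@exist _ (fun f : {ffun 'I_k -> 'I_n} => [forall i : 'I_k, forall j : 'I_k, (i < j)%N ==> (f i < f j)%N]) g IP : J, s); apply/ffunP => i; rewrite !ffunE /= ?ffunE tE.
Qed.

(** After expansion, the maps that are not injective give determinants with two equal rows, and the others are
    grouped by image. *)
Lemma cauchy_binet A B : \det (A *m B) =
  \sum_(I : J) \det (colsub (val I) A) * \det (rowsub (val I) B).
Proof.
pose F (f : {ffun 'I_k -> 'I_n}) := (\prod_i A i (f i)) * \det (rowsub f B).
transitivity (\sum_f F f).
  rewrite /determinant (eq_bigr (fun s : 'S_k => \sum_(f : {ffun 'I_k -> 'I_n})
      (-1) ^+ s * \prod_i (A i (f i) * B (f i) (s i)))).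
    rewrite exchange_big; apply: eq_bigr => f _; rewrite /F /determinant mulr_sumr.
    apply: eq_bigr => s _; rewrite big_split /= mulrCA; congr (_ * (_ * _)).
    by apply: eq_bigr => i _; rewrite mxE.
  move=> s _; rewrite -mulr_sumr; congr (_ * _).
  rewrite -(bigA_distr_bigA (fun i j => A i j * B j (s i))) /=.
  by apply: eq_bigr => i _; rewrite mxE.
rewrite (bigID (fun f : {ffun 'I_k -> 'I_n} => injectiveb f)) /= [X in _ + X]big1 ?addr0; last first.
  move=> f /injectivePn[i [j ij e]]; rewrite /F (determinant_alternate ij) ?mulr0 //.
  by move=> l; rewrite !mxE e.
transitivity (\sum_(f in [set index_perm u | u in [set: J * 'S_k]]%SET) F f).
  apply: eq_bigl => f; apply/injectiveP/imsetP => [/index_perm_onto[u <-]|[[I s] _ ->] i j].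
    by exists u.
  by rewrite !ffunE => /plucker_index_inj /perm_inj.
rewrite big_imset; last by move=> u v _ _; exact: index_perm_inj.
rewrite (eq_bigl predT) => [|u]; last by rewrite inE.
rewrite -(pair_bigA _ (fun I s => F (index_perm (I, s)))) /=; apply: eq_bigr => I _.
rewrite {2}/determinant mulr_suml; apply: eq_bigr => s _.
rewrite /F; have -> : rowsub (index_perm (I, s)) B = row_perm s (rowsub (val I) B).
  by apply/matrixP => i j; rewrite !mxE ffunE.
rewrite row_permE det_mulmx det_perm mulrCA mulrA; congr (_ * _ * _).
by apply: eq_bigr => i _; rewrite mxE ffunE.
Qed.

End CauchyBinet.

(** * Plücker coordinates *)

Section Plucker.
Context {K : closedFieldType} {k n : nat}.
Notation J := (plucker_index k n).
Notation Gr := (@grassmannian K k n).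
Implicit Types (W : 'M[K]_(k, n)) (N : 'M[K]_(n, k)) (x : J -> K).

(** The hyperplane section of the subspaces W with det (W N) = 0, by the Cauchy-Binet formula. *)
Definition lform N x : K := \sum_(I : J) x I * \det (rowsub (val I) N).

Lemma lform_plucker N W : lform N (plucker W) = \det (W *m N).
Proof. by rewrite cauchy_binet. Qed.

Lemma lformZ N a x : lform N (fun I => a * x I) = a * lform N x.
Proof. by rewrite /lform mulr_sumr; apply: eq_bigr => I _; rewrite mulrA. Qed.

Lemma lformB N x y : lform N (fun I => x I - y I) = lform N x - lform N y.
Proof. by rewrite /lform -sumrB; apply: eq_bigr => I _; rewrite mulrBl. Qed.

Lemma plucker_mul (B : 'M[K]_k) W : plucker (B *m W) = (fun I => \det B * plucker W I).
Proof.
apply/funext => I; rewrite /plucker -det_mulmx; congr (\det _).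
by apply/matrixP => i j; rewrite !mxE; apply: eq_bigr => l _; rewrite mxE.
Qed.

Lemma plucker_row_free W (I : J) : plucker W I != 0 -> row_free W.
Proof.
rewrite -unitfE -[_ \is a _]/(colsub (val I) W \in unitmx) => Wu.
apply/row_freeP; exists (colsub (val I) 1%:M *m invmx (colsub (val I) W)).
rewrite mulmxA (_ : W *m _ = colsub (val I) W) ?mulmxV //.
apply/matrixP => i j; rewrite !mxE (bigD1 (val I j)) //= !mxE eqxx mulr1 big1 ?addr0 //.
by move=> l /negPf lj; rewrite !mxE lj mulr0.
Qed.

Lemma row_free_plucker W : row_free W -> exists I, plucker W I != 0.
Proof.
move=> /row_freeP[N WN]; apply: contrapT => /forallNP h.
have := lform_plucker N W; rewrite WN det1 /lform big1.
  by move/eqP; rewrite eq_sym oner_eq0.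
by move=> I _; have /negP/negPn/eqP-> := h I; rewrite mul0r.
Qed.

Lemma grass_scale x a : (0 < k)%N -> a != 0 -> Gr x -> Gr (fun I => a * x I).
Proof.
move=> k0 a0 [W Wf ->].
pose D := diag_mx (\row_(i < k) if i == Ordinal k0 then a else 1).
have dD : \det D = a.
  rewrite det_diag (bigD1 (Ordinal k0)) //= mxE eqxx big1 ?mulr1 // => i /negPf i0.
  by rewrite mxE i0.
exists (D *m W); last by rewrite plucker_mul dD.
have [I WI] := row_free_plucker Wf; apply: (@plucker_row_free _ I).
by rewrite plucker_mul dD mulf_neq0.
Qed.

Definition repl_col N i j : 'M[K]_(n, k) := \matrix_(a, b) if b == i then (a == j)%:R else N a b.

(** On the Plücker coordinates of W this is adj (W N) W: a frame of the row space of W that depends linearly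
    on the Plücker coordinates. *)
Definition recon N x : 'M[K]_(k, n) := \matrix_(i, j) lform (repl_col N i j) x.

Lemma recon_plucker N W : recon N (plucker W) = \adj (W *m N) *m W.
Proof.
apply/matrixP => i j; rewrite mxE lform_plucker (expand_det_col _ i) mxE.
apply: eq_bigr => l _; rewrite mulrC [X in _ = X * _]mxE; congr (_ * _).
  rewrite /cofactor; congr (_ * \det _); apply/matrixP => a b; rewrite !mxE.
  by apply: eq_bigr => u _; rewrite !mxE eq_sym (negPf (neq_lift _ _)).
rewrite mxE (bigD1 j) //= !mxE !eqxx mulr1 big1 ?addr0 // => u /negPf uj.
by rewrite !mxE eqxx uj mulr0.
Qed.

Lemma plucker_recon N x I : Gr x ->
  lform N x * plucker (recon N x) I = lform N x ^+ k * x I.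
Proof.
move=> [W _ ->]; rewrite recon_plucker plucker_mul lform_plucker mulrA; congr (_ * _).
by rewrite -det_mulmx mul_mx_adj det_scalar.
Qed.

Lemma lform_delta (I J0 : J) : \det (rowsub (val J0) (colsub (val I) (1%:M : 'M[K]_n))) = (J0 == I)%:R.
Proof.
have [->|JI] := eqVneq J0 I.
  rewrite -[RHS](det1 K k); congr (\det _); apply/matrixP => a b.
  by rewrite !mxE (inj_eq (@plucker_index_inj _ _ I)).
have [b hb] : exists b, forall a, val J0 a != val I b.
  apply: contrapT => /forallNP h.
  have ex b : exists a, val J0 a = val I b.
    by have /existsNP[a /negP/negPn/eqP e] := h b; exists a.
  have [s sE] := choice ex.
  have si : injective s.
    by move=> b b' e; apply: (@plucker_index_inj _ _ I); rewrite -!sE e.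
  have : index_perm (I, 1%g) = index_perm (J0, perm si).
    by apply/ffunP => b; rewrite !ffunE /= perm1 permE sE.
  by move/index_perm_inj => -[e]; rewrite e eqxx in JI.
rewrite (expand_det_col _ b) big1 // => a _; rewrite !mxE (negPf (hb a)) mul0r //.
Qed.

Lemma lform_coord (I : J) x : lform (colsub (val I) 1%:M) x = x I.
Proof.
rewrite /lform (bigD1 I) //= lform_delta eqxx mulr1 big1 ?addr0 // => J0 /negPf J0I.
by rewrite lform_delta J0I mulr0.
Qed.

Section Forms.
Context {T : finType} (io : J -> T).

Definition lpoly N : mpoly #|T| K := \sum_(I : J) mpolyC _ (\det (rowsub (val I) N)) * pvar (io I).

Lemma evalp_lpoly N v : evalp (lpoly N) v = lform N (fun I => v (io I)).
Proof. by rewrite evalp_sum; apply: eq_bigr => I _; rewrite !evalpE mulrC. Qed.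

Lemma mhomog_lpoly (S : finType) (c : T -> S) s0 N : (forall I, c (io I) = s0) ->
  mhomog c (fun s => (s0 == s) : nat) (lpoly N).
Proof.
move=> h; apply: mhomog_sum => I _; apply: mhomogCM; rewrite -(h I); exact: mhomog_var.
Qed.
End Forms.
Arguments mhomog_lpoly {T} io {S c s0} N _ m _ s.

Lemma linepoly_plucker (I : J) : linepoly (fun W => plucker W I).
Proof.
apply: linepoly_det => i j; apply: linepoly_affine.
by exists (fun W => W i (val I j)), (fun W => W i (val I j)) => W W' t; rewrite !mxE.
Qed.

Notation gf := (@grass_factor k n).

Lemma mhomog_lpoly1 N : mhomog gf (fun=> 1%N) (lpoly id N : mpoly #|J| K).
Proof. by apply: (eq_mhomog (mhomog_lpoly id (c := gf) (s0 := tt) N _)) => // -[]. Qed.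

Lemma grass_proj : Gr `<=` proj_points gf.
Proof.
move=> x [W Wf ->] s; have [I WI] := row_free_plucker Wf.
by exists I => //; case: s.
Qed.

(** The identities of [plucker_recon] hold on the closure of the Grassmannian. At a point x of it where some
    coordinate is nonzero, one chooses N such that the form is this coordinate, and they say that x
    is proportional to the Plücker vector of the reconstructed frame. *)
Lemma zclosed_grass : (0 < k)%N -> zclosed gf Gr.
Proof.
move=> k0; suff e : zclosure gf Gr = Gr.
  by rewrite -e; exact: zclosed_closure.
apply/seteqP; split; last exact/sub_zclosure/grass_proj.
move=> x [xp x0]; have [I _ xI] := xp tt.
pose N : 'M[K]_(n, k) := colsub (val I) 1%:M; pose L := lform N x.
have L0 : L != 0 by rewrite /L lform_coord.
have e J0 : L * plucker (recon N x) J0 = L ^+ k * x J0.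
  pose F : mpoly #|J| K := lpoly id N *
    \det (\matrix_(i, j) lpoly id (repl_col N i (val J0 j))) - lpoly id N ^+ k * pvar J0.
  have FE z : evalp F z = lform N z * plucker (recon N z) J0 - lform N z ^+ k * z J0.
    rewrite evalpB !evalpM evalpXn evalp_var evalp_det !evalp_lpoly; congr (_ * \det _ - _).
    by apply/matrixP => i j; rewrite !mxE evalp_lpoly.
  apply/eqP; rewrite -subr_eq0 -FE; apply/eqP; apply: x0; split; last first.
    by move=> z zG; rewrite FE plucker_recon // subrr.
  exists (fun=> k.+1); apply: mhomogB.
    apply: eq_mhomog.
      apply: (mhomogM (@mhomog_lpoly1 N)); apply: (@mhomog_det _ _ _ _ _ (fun=> fun=> 1%N)) => i j.
      by rewrite mxE; exact: mhomog_lpoly1.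
    by case; rewrite sum_nat_const card_ord muln1 add1n.
  apply: eq_mhomog (mhomogM (mhomog_exp k (@mhomog_lpoly1 N)) (mhomog_var gf J0)) _ => -[].
  by rewrite /= muln1 addn1.
have -> : x = (fun J0 => (L / L ^+ k) * plucker (recon N x) J0).
  by apply/funext => J0; rewrite mulrAC e mulrAC divff ?mul1r // expf_neq0.
apply: grass_scale => //; first by rewrite mulf_neq0 // invr_eq0 expf_neq0.
exists (recon N x) => //; apply: (@plucker_row_free _ I).
have := e I; apply: contra_eq_neq => ->; rewrite mulr0 eq_sym mulf_neq0 // ?expf_neq0 //.
Qed.

Lemma irr_grass W0 : (0 < k)%N -> row_free W0 -> irr_closed gf Gr.
Proof.
move=> k0 W0f; apply/irr_closedP; split; first exact: zclosed_grass.
  by exists (plucker W0), W0.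
have [I WI] := row_free_plucker W0f.
apply: (hprime_param (par := @plucker K k n) (q := fun W => plucker W I)) => [J0||||_ [W _ ->]].
- exact: linepoly_plucker.
- exact: linepoly_plucker.
- by exists W0.
- by move=> W WI'; exists W => //; exact: plucker_row_free WI'.
exists W, (fun=> 1); split=> [_|]; first exact: oner_neq0.
by apply/funext => J0; rewrite /scale mul1r.
Qed.

Lemma linepoly_pluckerW (V : lmodType K) (W : V -> 'M[K]_(k, n)) (I : J) :
  (forall i j, linepoly (fun u => W u i j)) -> linepoly (fun u => plucker (W u) I).
Proof.
by move=> h; apply: linepoly_det => i j; have := h i (val I j); congr linepoly; apply/funext => u; rewrite mxE.
Qed.

End Plucker.
Arguments mhomog_lpoly {K k n T} io {S c s0} N _ m _ s.

(** * The Grassmannian and two complementary subspaces *)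

Definition other (i : 'I_2) : 'I_2 := rev_ord i.

Lemma otherK i : other (other i) = i. Proof. exact: rev_ordK. Qed.

Lemma neq_other i j : i != j -> j = other i.
Proof. by case: i j => [[|[|//]] ?] [[|[|//]] ?] // _; exact: val_inj. Qed.

(** The remainder of order 1 in the expansion at the origin. *)
Lemma hadamard (K : closedFieldType) (TT : finType) (F : mpoly #|TT| K) :
  exists H : TT -> mpoly #|TT| K, forall a, evalp F a = evalp F (fun=> 0) + \sum_t a t * evalp (H t) a.
Proof.
elim/(@evalp_ind K TT): F => [b|t|F G [H HE] [L LE]|F G [H HE] [L LE]].
- exists (fun=> 0) => a; rewrite !evalpC big1 ?addr0 // => t _.
  by rewrite /= ?evalp0 mulr0.
- exists (fun t' => mpolyC _ (t' == t)%:R) => a; rewrite !evalp_var add0r (bigD1 t) //= evalpC eqxx mulr1.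
  by rewrite big1 ?addr0 // => t' /negPf t't; rewrite evalpC t't mulr0.
- exists (fun t => H t + L t) => a; rewrite !evalpD HE LE addrACA -big_split; congr (_ + _).
  by apply: eq_bigr => t _; rewrite evalpD mulrDr.
exists (fun t => H t * G + mpolyC _ (evalp F (fun=> 0)) * L t) => a.
rewrite !evalpM {1}HE mulrDl {1}LE mulrDr -addrA; congr (_ + _).
rewrite mulr_sumr mulr_suml addrC -big_split; apply: eq_bigr => t _.
by rewrite evalpD !evalpM evalpC /=; ring.
Qed.

(** Here p + t / y + s is the expansion of a point of the affine chart: p is the center, t / y the term of order 1
    and s the remainder, so that this measures how far the normal direction is from its tangent part. *)
Fact tangent_field1 (F : fieldType) (y a p t s : F) m : y != 0 ->
  y * (y ^+ m.+1 * (a * (y * (p + y^-1 * t + s) - y * p) - a * t) - a * y ^+ m.+2 * s) = 0.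
Proof. by move=> y0; rewrite !exprS; field. Qed.

Fact tangent_field2 (F : fieldType) (y a u v z e : F) : y != 0 ->
  (a * u) * v * (z * e) = a * (y * y * z) * ((y^-1 * u) * (y^-1 * v) * e).
Proof. by move=> y0; field. Qed.

(** The computation of the class of a prime divisor: y is a strict transform, d0 and d1 are the Schubert
    divisors, x0 and x1 the exceptional ones. *)
Fact equation_class (F : fieldType) (c k e a m0 m1 y d0 d1 x0 x1 : F) : c != 0 -> k != 0 ->
  y - (0 * x0 + (k * e - (m0 + m1)) / c * x1 + (k * e - (k * a + m0)) / (k * c) * d0 + m0 / (k * c) * d1) =
  c^-1 * ((c * y + a * d0 + m0 * x0 + m1 * x1) - (e * d0 + k * e * x1)) +
  m0 / (k * c) * ((d0 + k * x1) - (d1 + k * x0)).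
Proof. by move=> c0 k0; field; rewrite c0 k0. Qed.

Lemma ind2 (P : 'I_2 -> Prop) : P ord0 -> P ord_max -> forall i, P i.
Proof. by move=> P0 P1 [[|[|//]] h]; [move: P0|move: P1]; congr P; exact: val_inj. Qed.

Lemma other0 : other ord0 = ord_max. Proof. exact: val_inj. Qed.
Lemma other1 : other ord_max = ord0. Proof. exact: val_inj. Qed.

Section TwoCenters.
Context {K : closedFieldType} {k n : nat} (M : 'I_2 -> 'M[K]_(k, n)) (U : 'I_2 -> 'M[K]_(n, k)).
Notation J := (plucker_index k n).
Notation Gr := (@grassmannian K k n).
Notation gf := (@grass_factor k n).
Notation P2 := ('I_k * 'I_k)%type.
Notation T := (@blowup_index k n 2).
Notation bf := (@blowup_factor k n 2).

(** The rows of M i span the i-th subspace; the two subspaces are complementary, and the U i form the dual basis. *)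
Definition dual_frames := [/\ forall i, M i *m U i = 1%:M, forall i, M i *m U (other i) = 0 &
  forall i, U i *m M i + U (other i) *m M (other i) = 1%:M].

Context (MU : dual_frames) (hk : (1 < k)%N).

Let k0 : (0 < k)%N. Proof. exact: ltnW. Qed.

Lemma id_mx_neq0 : 1%:M != 0 :> 'M[K]_k.
Proof. by apply/eqP => /matrixP/(_ (Ordinal k0) (Ordinal k0)) /eqP; rewrite !mxE eqxx oner_eq0. Qed.

Definition frame_mx (a : P2 -> K) : 'M[K]_k := \matrix_(r, s) a (r, s).
(** The graph of A, from the i-th subspace to the other one. *)
Definition graph_mx i (A : 'M[K]_k) : 'M[K]_(k, n) := M i + A *m M (other i).
Definition graph_pt i A : J -> K := plucker (graph_mx i A).
Definition center i : J -> K := plucker (M i).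

Notation X := (blowup center).
Notation strict := (strict_transform center).
Notation exc := (exceptional center).

Lemma MUi i : M i *m U i = 1%:M. Proof. by case: MU. Qed.
Lemma MUo i : M i *m U (other i) = 0. Proof. by case: MU. Qed.
Lemma MUo' i : M (other i) *m U i = 0. Proof. by rewrite -{2}[i]otherK MUo. Qed.
Lemma UM i : U i *m M i + U (other i) *m M (other i) = 1%:M. Proof. by case: MU. Qed.

Lemma decomp i (W : 'M[K]_(k, n)) : W = (W *m U i) *m M i + (W *m U (other i)) *m M (other i).
Proof. by rewrite -!mulmxA -mulmxDr UM mulmx1. Qed.

Lemma mulU i (B C : 'M[K]_k) : (B *m M i + C *m M (other i)) *m U i = B.
Proof. by rewrite mulmxDl -!mulmxA MUi MUo' mulmx1 mulmx0 addr0. Qed.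

Lemma mulU' i (B C : 'M[K]_k) : (B *m M i + C *m M (other i)) *m U (other i) = C.
Proof. by rewrite mulmxDl -!mulmxA MUi MUo mulmx1 mulmx0 add0r. Qed.

Lemma graph_mxU i A : graph_mx i A *m U i = 1%:M.
Proof. by rewrite /graph_mx -{1}[M i]mul1mx mulU. Qed.

Lemma graph_mxU' i A : graph_mx i A *m U (other i) = A.
Proof. by rewrite /graph_mx -{1}[M i]mul1mx mulU'. Qed.

Lemma row_free_graph_mx i A : row_free (graph_mx i A).
Proof. by apply/row_freeP; exists (U i); exact: graph_mxU. Qed.

Lemma graph_mx0 i : graph_mx i 0 = M i.
Proof. by rewrite /graph_mx mul0mx addr0. Qed.

Lemma graph_pt0 i : graph_pt i 0 = center i.
Proof. by rewrite /graph_pt graph_mx0. Qed.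

Lemma row_freeM i : row_free (M i).
Proof. by rewrite -graph_mx0 row_free_graph_mx. Qed.

Lemma graph_pt_in i A : Gr (graph_pt i A).
Proof. by exists (graph_mx i A) => //; exact: row_free_graph_mx. Qed.

Lemma center_in i : Gr (center i).
Proof. by exists (M i) => //; exact: row_freeM. Qed.

Lemma lform_graph_pt i A : lform (U i) (graph_pt i A) = 1.
Proof. by rewrite lform_plucker graph_mxU det1. Qed.

Lemma lform_graph_pt' i A : lform (U (other i)) (graph_pt i A) = \det A.
Proof. by rewrite lform_plucker graph_mxU'. Qed.

Lemma lform_center i : lform (U i) (center i) = 1.
Proof. by rewrite -graph_pt0 lform_graph_pt. Qed.

Lemma lform_other_center i : lform (U i) (center (other i)) = 0.
Proof. by rewrite lform_plucker MUo' -(scale0r 1%:M) detZ expr0n gtn_eqF // mul0r. Qed.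

(** The coordinates A of the affine chart at the i-th center, multiplied by the form that does not vanish on the
    chart: they are linear forms in x. *)
Definition Ycoord i (x : J -> K) : 'M[K]_k := recon (U i) x *m U (other i).

Lemma YcoordE i x r s : Ycoord i x r s = \sum_j lform (repl_col (U i) r j) x * U (other i) j s.
Proof. by rewrite mxE; apply: eq_bigr => j _; rewrite mxE. Qed.

Lemma YcoordZ i a x : Ycoord i (fun I => a * x I) = a *: Ycoord i x.
Proof.
apply/matrixP => r s; rewrite [RHS]mxE !YcoordE mulr_sumr; apply: eq_bigr => j _.
by rewrite lformZ mulrA.
Qed.

Lemma YcoordB i x y : Ycoord i (fun I => x I - y I) = Ycoord i x - Ycoord i y.
Proof.
apply/matrixP => r s; rewrite [RHS]mxE [X in _ + X]mxE !YcoordE -sumrB; apply: eq_bigr => j _.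
by rewrite lformB mulrBl.
Qed.

Lemma Ycoord_graph_pt i A : Ycoord i (graph_pt i A) = A.
Proof. by rewrite /Ycoord recon_plucker graph_mxU adj1 mul1mx graph_mxU'. Qed.

Lemma Ycoord_center i : Ycoord i (center i) = 0.
Proof. by rewrite -graph_pt0 Ycoord_graph_pt. Qed.

Lemma graph_pt_recover i x : Gr x -> lform (U i) x != 0 ->
  x = (fun I => lform (U i) x * graph_pt i ((lform (U i) x)^-1 *: Ycoord i x) I).
Proof.
move=> [W Wf ->]; rewrite lform_plucker => d0.
have Bu : W *m U i \in unitmx by rewrite unitmxE unitfE.
have e : W = (W *m U i) *m graph_mx i ((\det (W *m U i))^-1 *: Ycoord i (plucker W)).
  rewrite /graph_mx mulmxDr /Ycoord recon_plucker {1}(decomp i W); congr (_ + _).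
  by rewrite mulmxA -scalemxAr !mulmxA mul_mx_adj mul_scalar_mx -[_ *: W *m _]scalemxAl scalerA mulVf // scale1r.
by rewrite {1}e plucker_mul.
Qed.

Lemma center_recover i x : Gr x -> lform (U i) x != 0 -> Ycoord i x = 0 ->
  x = (fun I => lform (U i) x * center i I).
Proof. by move=> xG xU Y0; rewrite {1}(graph_pt_recover xG xU) Y0 scaler0 graph_pt0. Qed.

Lemma same_pointP (x : J -> K) i : Gr x -> same_point x (center i) ->
  exists2 a, a != 0 & x = (fun I => a * center i I).
Proof.
move=> [W Wf ->] xp; have [I pI] := row_free_plucker (row_freeM i).
exists (plucker W I / center i I); last first.
  apply/funext => I'; have /eqP := xp (I, I'); rewrite /wedge /= subr_eq0 => /eqP e.
  by rewrite mulrAC e mulfK.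
have [I' xI'] := row_free_plucker Wf; rewrite mulf_neq0 ?invr_eq0 //.
apply: contra_neq xI' => xI0; have /eqP := xp (I', I); rewrite /wedge /= xI0 mul0r subr0.
by rewrite mulf_eq0 => /orP[/eqP //|]; rewrite (negPf pI).
Qed.

Lemma same_pointZ (x : J -> K) a i : x = (fun I => a * center i I) -> same_point x (center i).
Proof. by move=> -> IJ; rewrite /wedge; ring. Qed.

Lemma same_point_graph_pt i A : same_point (graph_pt i A) (center i) -> A = 0.
Proof.
move=> /(same_pointP (graph_pt_in i A))[a _ e].
by rewrite -(Ycoord_graph_pt i A) e YcoordZ Ycoord_center scaler0.
Qed.

Lemma not_same_graph_pt i A : ~ same_point (graph_pt i A) (center (other i)).
Proof.
move=> /(same_pointP (graph_pt_in i A))[a _ e].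
by have /eqP := lform_graph_pt i A; rewrite e lformZ lform_other_center mulr0 eq_sym oner_eq0.
Qed.

Lemma not_same_both (x : J -> K) i : Gr x -> same_point x (center i) -> ~ same_point x (center (other i)).
Proof.
move=> xG /(same_pointP xG)[a a0 e] /(same_pointP xG)[b _ e'].
have := lformZ (U i) a (center i); rewrite -e e' lformZ lform_center lform_other_center mulr0 mulr1 => /eqP.
by rewrite eq_sym (negPf a0).
Qed.

Section Forms.
Context {T : finType} (io : J -> T).

Definition Ypoly i (t : P2) : mpoly #|T| K :=
  \sum_j mpolyC _ (U (other i) j t.2) * lpoly io (repl_col (U i) t.1 j).

Lemma evalp_Ypoly i t v : evalp (Ypoly i t) v = Ycoord i (fun I => v (io I)) t.1 t.2.
Proof.
rewrite evalp_sum YcoordE; apply: eq_bigr => j _.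
by rewrite evalpM evalpC evalp_lpoly mulrC.
Qed.

Lemma mhomog_Ypoly (S : finType) (c : T -> S) s0 i t : (forall I, c (io I) = s0) ->
  mhomog c (fun s => (s0 == s) : nat) (Ypoly i t).
Proof. by move=> h; apply: mhomog_sum => j _; apply: mhomogCM; exact: mhomog_lpoly. Qed.
End Forms.
Arguments mhomog_Ypoly {T} io {S c s0} i t _ m _ s.

Lemma graph_chart_poly i I : exists F : mpoly #|{: P2}| K, forall a, graph_pt i (frame_mx a) I = evalp F a.
Proof.
exists (\det (\matrix_(r, s) (mpolyC _ (M i r (val I s)) +
           \sum_l pvar (r, l) * mpolyC _ (M (other i) l (val I s))))) => a.
rewrite evalp_det; congr (\det _); apply/matrixP => r s; rewrite !mxE !evalpE.
by congr (_ + _); apply: eq_bigr => l _; rewrite !evalpE mxE.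
Qed.

Lemma frame_mx_surj (A : 'M[K]_k) : exists a, frame_mx a = A.
Proof. by exists (fun t => A t.1 t.2); apply/matrixP => r s; rewrite mxE. Qed.

(** The complement of a Schubert divisor is the affine space of the k x k matrices A. *)
Lemma graph_chart i : chart gf Gr (fun a => graph_pt i (frame_mx a)) (lpoly id (U i)).
Proof.
split.
- exact: graph_chart_poly.
- by move=> a; exact: graph_pt_in.
- by exists (fun=> 1%N); exact: mhomog_lpoly1.
- by move=> a; rewrite evalp_lpoly lform_graph_pt oner_eq0.
- move=> x xG; rewrite evalp_lpoly => x0.
  have [a ea] := frame_mx_surj ((lform (U i) x)^-1 *: Ycoord i x).
  exists a, (fun=> lform (U i) x); split=> // ; rewrite ea; exact: graph_pt_recover.
move=> g; have [|d [F [u [Fd _ FE _]]]] := homogenize (c := gf) (phi := fun a => graph_pt i (frame_mx a)) _ g.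
  move=> t; exists (fun=> 1%N), (Ypoly id i t), (lpoly id (U i)); split.
  - by apply: (eq_mhomog (mhomog_Ypoly id (c := gf) (s0 := tt) i t _)) => // -[].
  - exact: mhomog_lpoly1.
  - by move=> a; rewrite evalp_Ypoly Ycoord_graph_pt mxE; case: t.
  - by move=> a; rewrite evalp_lpoly lform_graph_pt.
by exists d, F.
Qed.

Lemma Gr_irr : irr_closed gf Gr.
Proof. exact: irr_grass k0 (row_freeM ord0). Qed.

(** The subspaces that meet the subspace of index [other i]. *)
Definition schubert_div i : set (J -> K) := [set x | Gr x /\ lform (U i) x = 0].

(** Every singular matrix is a product C corank1 D: this parametrizes the Schubert divisors by a vector space. *)
Definition corank1 : 'M[K]_k := pid_mx k.-1.

Lemma rank_corank1 : \rank corank1 = k.-1.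
Proof. by rewrite rank_pid_mx // leq_pred. Qed.

Lemma det_corank1 : \det corank1 = 0.
Proof.
apply/eqP; apply: contraT; rewrite -unitfE -unitmxE -row_free_unit /row_free rank_corank1.
by move=> /eqP e; move: k0; rewrite -ltn_predL e ltnn.
Qed.

Lemma corank1_neq0 : corank1 != 0.
Proof. by rewrite -mxrank_eq0 rank_corank1; move: hk; case: (k) => [|[]]. Qed.

Lemma singular_factor (B : 'M[K]_k) : \det B = 0 -> exists C D, B = C *m corank1 *m D.
Proof.
move=> B0; have rB : (\rank B <= k.-1)%N.
  rewrite -ltnS prednK // ltn_neqAle rank_leq_row andbT; apply/negP => rB.
  have : row_free B by [].
  by rewrite row_free_unit unitmxE unitfE B0 eqxx.
exists (col_ebase B *m pid_mx (\rank B)), (row_ebase B).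
rewrite -!mulmxA [X in _ *m X]mulmxA mul_pid_mx -{1}(mulmx_ebase B) mulmxA.
by rewrite [minn _ k.-1]minnC (minn_idPr rB) (minn_idPr (rank_leq_row B)).
Qed.

Definition schubert_div_frame i (u : 'M[K]_k * 'M[K]_k * 'M[K]_k) : 'M[K]_(k, n) :=
  (u.1.1 *m corank1 *m u.1.2) *m M i + u.2 *m M (other i).

Lemma schubert_div_frameP i W : \det (W *m U i) = 0 -> exists u, W = schubert_div_frame i u.
Proof.
move=> /singular_factor[C [D e]]; exists (C, D, W *m U (other i)).
by rewrite /schubert_div_frame /= -e; exact: decomp.
Qed.

Lemma det_schubert_div_frame i u : \det (schubert_div_frame i u *m U i) = 0.
Proof. by rewrite mulU !det_mulmx det_corank1 mulr0 mul0r. Qed.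

Lemma linepoly_schubert_div_frame i a b : linepoly (fun u => schubert_div_frame i u a b).
Proof.
have h r s : linepoly (fun u : 'M[K]_k * 'M[K]_k * 'M[K]_k => (u.1.1 *m corank1 *m u.1.2) r s).
  apply: linepoly_mul; last by apply: linepoly_linear; exists (fun u => u.1.2).
  apply: linepoly_mul; first by apply: linepoly_linear; exists (fun u => u.1.1).
  by move=> ? ?; exact: linepoly_cst.
have -> : (fun u => schubert_div_frame i u a b) = (fun u => ((u.1.1 *m corank1 *m u.1.2) *m M i) a b + (u.2 *m M (other i)) a b).
  by apply/funext => u; rewrite mxE.
apply: linepolyD; apply: linepoly_mul => // ? ?; try exact: linepoly_cst.
by apply: linepoly_linear; exists (fun u => u.2).
Qed.

Lemma zclosed_schubert_div i : zclosed gf (schubert_div i).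
Proof.
have := zclosed_zero (zclosed_grass k0) (@mhomog_lpoly1 _ _ _ (U i)); congr zclosed.
by apply/seteqP; split=> x [xG]; rewrite /= evalp_lpoly.
Qed.

Lemma other_center_in_schubert_div i : schubert_div i (center (other i)).
Proof. by split; [exact: center_in|exact: lform_other_center]. Qed.

Lemma schubert_div_irr i : irr_closed gf (schubert_div i).
Proof.
apply/irr_closedP; split; first exact: zclosed_schubert_div.
  by exists (center (other i)); exact: other_center_in_schubert_div.
have [I pI] := row_free_plucker (row_freeM (other i)).
have lp J0 : linepoly (fun u => plucker (schubert_div_frame i u) J0).
  by apply: linepoly_pluckerW; exact: linepoly_schubert_div_frame.
apply: (hprime_param (par := fun u => plucker (schubert_div_frame i u)) (q := fun u => plucker (schubert_div_frame i u) I)) => //.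
- by exists (0, 0, 1%:M); rewrite /schubert_div_frame /= mul1mx !mul0mx add0r.
- move=> u pu; split; last by rewrite lform_plucker det_schubert_div_frame.
  by exists (schubert_div_frame i u) => //; exact: plucker_row_free pu.
move=> _ [[W _ ->]]; rewrite lform_plucker => /schubert_div_frameP[u ->].
exists u, (fun=> 1); split=> [_|]; first exact: oner_neq0.
by apply/funext => J0; rewrite /scale mul1r.
Qed.

(** Irreducible by its parametrization, and given by det A = 0 in the chart at the other center. *)
Lemma schubert_div_prime i : prime_divisor gf Gr (schubert_div i).
Proof.
have [g gE] := chart_pull (graph_chart (other i)) (lpoly id (U i)).
have {}gE a : evalp g a = \det (frame_mx a).
  by rewrite gE evalp_lpoly -{1}[i]otherK lform_graph_pt'.
apply: (chart_prime_divisor_trace Gr_irr (graph_chart (other i)) (g := g) (schubert_div_irr i)).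
- by move=> x [].
- move=> /(_ _ (other_center_in_schubert_div i)); rewrite evalp_lpoly lform_center; apply/eqP; exact: oner_neq0.
- apply/seteqP; split=> a; rewrite /vanishing /= gE.
    by move=> [_]; rewrite -{1}[i]otherK lform_graph_pt'.
  by move=> a0; split; [exact: graph_pt_in|rewrite -{1}[i]otherK lform_graph_pt'].
- have [a ea] := frame_mx_surj 1%:M.
  move=> /seteqP[_ /(_ a I)]; rewrite /vanishing /= gE ea det1; apply/eqP; exact: oner_neq0.
Qed.

(** * The blow-up and strict transforms *)

Definition regular (x : J -> K) := forall i, ~ same_point x (center i).

Lemma regular_graph_pt i A : A != 0 -> regular (graph_pt i A).
Proof.
move=> A0 j; have [->|] := eqVneq j i; first by move=> /same_point_graph_pt/eqP; rewrite (negPf A0).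
by rewrite eq_sym => /neq_other->; exact: not_same_graph_pt.
Qed.

Lemma regular_graph_pt1 : regular (graph_pt ord0 1%:M).
Proof. exact/regular_graph_pt/id_mx_neq0. Qed.

Lemma regular_wedge x IJ0 IJ1 : wedge x (center ord0) IJ0 != 0 -> wedge x (center ord_max) IJ1 != 0 -> regular x.
Proof. by move=> w0 w1; apply: ind2 => h; [move: w0|move: w1]; rewrite h eqxx. Qed.

Definition open_blowup : set (T -> K) := [set v | [/\ Gr (blow_down v), regular (blow_down v) &
  forall i, exists2 a : K, a != 0 & forall IJ, normal_dir v i IJ = a * wedge (blow_down v) (center i) IJ]].

(** The point of the blow-up above a point that is not a center. *)
Definition lift_pt (x : J -> K) : T -> K := fun t =>
  match t with inl I0 => x I0 | inr (i, IJ) => wedge x (center i) IJ end.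

Lemma not_same_wedge (x y : J -> K) : ~ same_point x y -> exists IJ, wedge x y IJ != 0.
Proof.
move=> h; have /existsNP[IJ /eqP w0] : ~ forall IJ, wedge x y IJ = 0 by [].
by exists IJ.
Qed.

Lemma wedgeZ a (x y : J -> K) IJ : wedge (fun I => a * x I) y IJ = a * wedge x y IJ.
Proof. by rewrite /wedge; ring. Qed.

Lemma same_point_scale a (x y : J -> K) : a != 0 -> same_point (fun I => a * x I) y -> same_point x y.
Proof. by move=> a0 h IJ; have /eqP := h IJ; rewrite wedgeZ mulf_eq0 (negPf a0) => /eqP. Qed.

Lemma regularZ a x : a != 0 -> regular x -> regular (fun I => a * x I).
Proof. by move=> a0 xr i /(same_point_scale a0); exact: xr. Qed.

Lemma blow_down_scale (l : option 'I_2 -> K) (v : T -> K) :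
  blow_down (scale bf l v) = (fun I => l None * blow_down v I).
Proof. by []. Qed.

Lemma normal_dir_scale (l : option 'I_2 -> K) (v : T -> K) i IJ :
  normal_dir (scale bf l v) i IJ = l (Some i) * normal_dir v i IJ.
Proof. by []. Qed.

Lemma open_proj : open_blowup `<=` proj_points bf.
Proof.
move=> v [vG vr vn] [i|].
  have [IJ w0] := not_same_wedge (vr i); have [a a0 e] := vn i.
  exists (inr (i, IJ)) => //; rewrite -[v _]/(normal_dir v i IJ) e mulf_neq0 //.
have [I _ vI] := grass_proj vG tt.
by exists (inl I).
Qed.

Lemma open_stable : stable bf open_blowup.
Proof.
move=> l v l0 [vG vr vn]; split.
- by rewrite blow_down_scale; exact: grass_scale.
- by rewrite blow_down_scale; exact: regularZ.
move=> i; have [a a0 e] := vn i; exists (l (Some i) * a / l None).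
  by rewrite !mulf_neq0 // invr_eq0.
move=> IJ; rewrite normal_dir_scale e blow_down_scale wedgeZ.
by rewrite -!mulrA mulKf.
Qed.

Lemma lift_pt_open x : Gr x -> regular x -> open_blowup (lift_pt x).
Proof. by move=> xG xr; split=> // i; exists 1; [exact: oner_neq0|move=> IJ; rewrite mul1r]. Qed.

Lemma open_lift_pt v : open_blowup v -> exists l, [/\ (forall s, l s != 0), l None = 1 &
  v = scale bf l (lift_pt (blow_down v))].
Proof.
move=> [vG vr vn].
pose a i := s2val (cid2 (vn i)).
have a0 i : a i != 0 by exact: (s2valP (cid2 (vn i))).
have aE i IJ : normal_dir v i IJ = a i * wedge (blow_down v) (center i) IJ by exact: (s2valP' (cid2 (vn i))).
exists (fun s => if s is Some i then a i else 1); split=> //.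
  by case=> //; exact: oner_neq0.
apply/funext => -[I|[i IJ]]; rewrite /scale /=; first by rewrite mul1r.
exact: aE.
Qed.

Lemma open_sub : open_blowup `<=` X.
Proof. exact: sub_zclosure open_proj. Qed.

Lemma X_closed : zclosed bf X. Proof. exact: zclosed_closure. Qed.

Definition polyfun (TT : finType) (f : (TT -> K) -> K) := exists F : mpoly #|TT| K, forall v, evalp F v = f v.

Lemma X_identity f : @polyfun T f -> (forall v, open_blowup v -> f v = 0) -> forall v, X v -> f v = 0.
Proof.
move=> [F FE] f0 v Xv; rewrite -FE.
by apply: (ideal_zclosure (c := bf) open_stable) Xv => w ow; rewrite FE f0.
Qed.

Definition wpoly (TT : finType) (io : J -> TT) i (IJ : J * J) : mpoly #|TT| K :=
  mpolyC _ (center i IJ.2) * pvar (io IJ.1) - mpolyC _ (center i IJ.1) * pvar (io IJ.2).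

Lemma evalp_wpoly (TT : finType) (io : J -> TT) i IJ v :
  evalp (wpoly io i IJ) v = wedge (fun I => v (io I)) (center i) IJ.
Proof.
by rewrite evalpB !evalpM !evalpC !evalp_var /wedge mulrC [X in _ - X]mulrC.
Qed.

Lemma mhomog_wpoly (S TT : finType) (c : TT -> S) (io : J -> TT) s0 i IJ : (forall I, c (io I) = s0) ->
  mhomog c (fun s => (s0 == s) : nat) (wpoly io i IJ).
Proof.
by move=> h; apply: mhomogB; apply: mhomogCM; [rewrite -(h IJ.1)|rewrite -(h IJ.2)]; exact: mhomog_var.
Qed.

Lemma blow_down_in v : X v -> Gr (blow_down v).
Proof.
have [Fs FsP GE] := zclosed_grass k0 : zclosed gf Gr.
move=> Xv; rewrite GE; split.
  by move=> []; have [t + vt] := zclosed_proj X_closed Xv None; case: t vt => // I vI _; exists I.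
move=> F FF; apply: (X_identity (f := fun v => evalp F (blow_down v))) Xv.
  exists (psubst (fun I => pvar (inl I : T)) F) => w; rewrite evalp_psubst.
  by congr evalp; apply/funext => I; rewrite evalp_var.
by move=> w [+ _ _]; rewrite GE => -[_]; exact.
Qed.

Lemma X_wedge v i IJ IJ' : X v ->
  normal_dir v i IJ * wedge (blow_down v) (center i) IJ' = normal_dir v i IJ' * wedge (blow_down v) (center i) IJ.
Proof.
move=> Xv; apply/eqP; rewrite -subr_eq0; apply/eqP.
apply: (X_identity (f := fun v => normal_dir v i IJ * wedge (blow_down v) (center i) IJ' - normal_dir v i IJ' * wedge (blow_down v) (center i) IJ)) Xv.
  exists (pvar (inr (i, IJ) : T) * wpoly inl i IJ' - pvar (inr (i, IJ') : T) * wpoly inl i IJ) => w.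
  by rewrite evalpB !evalpM !evalp_var !evalp_wpoly.
by move=> w [_ _ /(_ i)[a _ h]]; rewrite !h; ring.
Qed.

Lemma normal_dir_wedge v i : X v -> ~ same_point (blow_down v) (center i) ->
  exists2 a : K, a != 0 & forall IJ, normal_dir v i IJ = a * wedge (blow_down v) (center i) IJ.
Proof.
move=> Xv /not_same_wedge[IJ w0].
have e IJ' : normal_dir v i IJ' = (normal_dir v i IJ / wedge (blow_down v) (center i) IJ) * wedge (blow_down v) (center i) IJ'.
  by rewrite mulrAC -(X_wedge i IJ' IJ Xv) mulfK.
exists (normal_dir v i IJ / wedge (blow_down v) (center i) IJ) => //.
have [t + vt] := zclosed_proj X_closed Xv (Some i).
case: t vt => // -[j IJ'] vt /= [ji]; move: vt; rewrite ji -[v _]/(normal_dir v i IJ') e.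
by apply: contra_neq => ->; rewrite mul0r.
Qed.

Lemma X_regular v : X v -> regular (blow_down v) -> open_blowup v.
Proof. by move=> Xv vr; split=> // [|i]; [exact: blow_down_in|exact: normal_dir_wedge]. Qed.

Definition pull_lift_pt (F : mpoly #|T| K) : mpoly #|J| K :=
  psubst (fun t => match t with inl I0 => pvar I0 | inr (i, IJ) => wpoly id i IJ end) F.

Lemma evalp_pull_lift_pt F x : evalp (pull_lift_pt F) x = evalp F (lift_pt x).
Proof.
rewrite evalp_psubst; congr evalp; apply/funext => -[I|[i IJ]] /=; first exact: evalp_var.
exact: evalp_wpoly.
Qed.

Lemma mhomog_pull_lift_pt d F : mhomog bf d F -> mhomog gf (fun=> \sum_s d s)%N (pull_lift_pt F).
Proof.
move=> Fd; apply: eq_mhomog.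
  apply: (mhomog_psubst (e := fun _ _ => 1%N)) Fd => -[I|[i IJ]].
    by apply: (eq_mhomog (mhomog_var gf I)) => -[].
  by apply: (eq_mhomog (@mhomog_wpoly _ _ gf id tt i IJ _)) => // -[].
by move=> s; apply: eq_bigr => s' _; rewrite muln1.
Qed.

Definition pull_down (F : mpoly #|J| K) : mpoly #|T| K := psubst (fun I => pvar (inl I : T)) F.

Lemma evalp_pull_down F v : evalp (pull_down F) v = evalp F (blow_down v).
Proof. by rewrite evalp_psubst; congr evalp; apply/funext => I; rewrite evalp_var. Qed.

Lemma mhomog_pull_down d F : mhomog gf d F ->
  mhomog bf (fun s => if s is None then d tt else 0)%N (pull_down F).
Proof.
move=> Fd; apply: eq_mhomog.
  apply: (mhomog_psubst (c2 := bf) (e := fun _ s => (None == s) : nat)) Fd => I.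
  exact: (mhomog_var bf (inl I : T)).
by move=> s; rewrite (big_pred1 tt) => [|[]//]; case: s => [i|] /=; rewrite ?muln0 ?muln1.
Qed.

(** The next two lemmas are used on the Grassmannian and on the blow-up: [io] selects the Plücker coordinates. *)
Section Centers.
Context (SS TT : finType) (c : TT -> SS) (io : J -> TT) (s0 : SS) (cio : forall I, c (io I) = s0).
Implicit Types (B : set (TT -> K)) (F : mpoly #|TT| K).
Let sub (v : TT -> K) : J -> K := fun I => v (io I).

(** The centers are cut out by the forms [wpoly], and the ideal of B is prime. *)
Lemma irr_regular B d F v0 : irr_closed c B -> B v0 -> regular (sub v0) -> mhomog c d F ->
  (forall v, B v -> regular (sub v) -> evalp F v = 0) -> ideal B F.
Proof.
move=> /irr_closedP[_ _ Bp] Bv0 v0r Fd F0.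
have [IJ0 w0] := not_same_wedge (v0r ord0); have [IJ1 w1] := not_same_wedge (v0r ord_max).
have hw i IJ := @mhomog_wpoly _ _ c io s0 i IJ cio.
have /(Bp _ _ _ _ (hw _ _) (mhomogM (hw _ _) Fd))[h|] : ideal B (wpoly io ord0 IJ0 * (wpoly io ord_max IJ1 * F)).
- move=> x Bx; rewrite !evalpM !evalp_wpoly.
  have [->|x0'] := eqVneq (wedge (sub x) (center ord0) IJ0) 0; first by rewrite mul0r.
  have [->|x1'] := eqVneq (wedge (sub x) (center ord_max) IJ1) 0; first by rewrite mul0r mulr0.
  by rewrite F0 ?mulr0 //; exact: regular_wedge x0' x1'.
- by move: w0; rewrite -(evalp_wpoly io) h ?eqxx.
move=> /(Bp _ _ _ _ (hw _ _) Fd)[h|//].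
by move: w1; rewrite -(evalp_wpoly io) h ?eqxx.
Qed.

Lemma irr_over_centers B : irr_closed c B -> (forall v, B v -> ~ regular (sub v)) ->
  exists i, forall v, B v -> same_point (sub v) (center i).
Proof.
move=> /irr_closedP[_ _ Bp] Br; have hw i IJ := @mhomog_wpoly _ _ c io s0 i IJ cio.
have [B0|] := pselect (forall v, B v -> same_point (sub v) (center ord0)); first by exists ord0.
move=> /existsNP[v /not_implyP[Bv /not_same_wedge[IJ w0]]]; exists ord_max => z Bz IJ'.
have /(Bp _ _ _ _ (hw _ _) (hw _ _))[h0|h1] : ideal B (wpoly io ord0 IJ * wpoly io ord_max IJ').
- move=> x Bx; rewrite evalpM !evalp_wpoly; apply/eqP; apply: contraT; rewrite mulf_eq0 => /norP[x0 x1].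
  by case: (Br x Bx); exact: regular_wedge x0 x1.
- by move: w0; rewrite -(evalp_wpoly io) h0 ?eqxx.
by rewrite -(evalp_wpoly io) h1.
Qed.
End Centers.
Arguments irr_regular {SS TT c} io {s0} cio {B d F v0}.
Arguments irr_over_centers {SS TT c} io {s0} cio {B}.

Let gf_id I : gf (id I) = tt. Proof. by []. Qed.
Let bf_inl (I : J) : bf (inl I) = None. Proof. by []. Qed.

Definition strict_base (Y : set (J -> K)) : set (T -> K) :=
  [set v | [/\ X v, Y (blow_down v) & regular (blow_down v)]].

Lemma strict_base_proj Y : strict_base Y `<=` proj_points bf.
Proof. by move=> v [Xv _ _]; exact: (zclosed_proj X_closed Xv). Qed.

Lemma strict_sub Y : strict Y `<=` X.
Proof. by apply: (zclosure_min X_closed) => v []. Qed.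

Lemma lift_pt_base Y x : Y `<=` Gr -> Y x -> regular x -> strict_base Y (lift_pt x).
Proof. by move=> YG Yx xr; split=> //; apply/open_sub/lift_pt_open => //; exact: YG. Qed.

Lemma strict_lift_pt Y x : Y `<=` Gr -> Y x -> regular x -> strict Y (lift_pt x).
Proof. by move=> YG Yx xr; apply: (sub_zclosure (@strict_base_proj Y)); exact: lift_pt_base. Qed.

Lemma strict_base_lift_pt Y v : strict_base Y v -> exists l, (forall s, l s != 0) /\ v = scale bf l (lift_pt (blow_down v)).
Proof.
by move=> [Xv _ vr]; have [l [l0 _ e]] := open_lift_pt (X_regular Xv vr); exists l.
Qed.

Lemma strict_base_stable Y : zclosed gf Y -> stable bf (strict_base Y).
Proof.
move=> Yc l v l0 [Xv Yv vr]; split.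
- exact: (zclosed_stable X_closed).
- rewrite blow_down_scale; exact: (zclosed_stable Yc (l := fun=> l None)).
- by rewrite blow_down_scale; exact: regularZ.
Qed.

Lemma strict_down Y v : zclosed gf Y -> strict Y v -> Y (blow_down v).
Proof.
move=> [Fs FsP YE] Yv; rewrite YE; split.
  have [t + vt] := zclosed_proj X_closed (strict_sub Yv) None.
  by case: t vt => // I vI _ [] ; exists I.
move=> F FF; have [d Fd] := FsP F FF; rewrite -evalp_pull_down.
apply: (ideal_homog_zclosure (mhomog_pull_down Fd)) Yv => w [_ + _].
by rewrite YE => -[_ h]; rewrite evalp_pull_down h.
Qed.

(** The pullback by [lift_pt] turns forms on the blow-up into forms on the Grassmannian. *)
Lemma strict_irr Y x0 : irr_closed gf Y -> Y `<=` Gr -> Y x0 -> regular x0 -> irr_closed bf (strict Y).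
Proof.
move=> Yi YG Yx0 x0r; have [_ _ Yp] := (irr_closedP gf Y).1 Yi; apply: irr_closure.
- exact: strict_base_proj.
- by exists (lift_pt x0); exact: lift_pt_base.
move=> d e F G Fd Ge FG.
have /(Yp _ _ _ _ (mhomog_pull_lift_pt Fd) (mhomog_pull_lift_pt Ge)) : ideal Y (pull_lift_pt F * pull_lift_pt G).
  apply: (irr_regular id gf_id Yi Yx0 x0r (mhomogM (mhomog_pull_lift_pt Fd) (mhomog_pull_lift_pt Ge))) => x Yx xr.
  by rewrite evalpM !evalp_pull_lift_pt -evalpM; apply: FG; exact: lift_pt_base.
case=> h; [left|right] => v vb; have [_ Yv _] := vb; have [l [l0 ->]] := strict_base_lift_pt vb.
  by rewrite (evalp_scale _ _ Fd) -evalp_pull_lift_pt h // mulr0.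
by rewrite (evalp_scale _ _ Ge) -evalp_pull_lift_pt h // mulr0.
Qed.

Lemma strict_Gr : strict Gr = X.
Proof.
apply/seteqP; split; first exact: strict_sub.
apply: zclosure_mono => v ov; have [vG vr _] := ov; split=> //; exact: open_sub.
Qed.

Lemma X_irr : irr_closed bf X.
Proof.
rewrite -strict_Gr; apply: strict_irr regular_graph_pt1 => //; first exact: Gr_irr.
exact: graph_pt_in.
Qed.

(** Y is the closure of the image of the part of B over the complement of the centers. *)
Lemma irr_is_strict B v0 : irr_closed bf B -> B `<=` X -> B v0 -> regular (blow_down v0) ->
  exists Y, [/\ irr_closed gf Y, Y `<=` Gr, Y (blow_down v0) & B = strict Y].
Proof.
move=> Bi BX Bv0 v0r; have [Bc _ Bp] := (irr_closedP bf B).1 Bi.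
pose A := [set blow_down v | v in [set v | B v /\ regular (blow_down v)]].
have AG : A `<=` Gr by move=> _ [v [Bv _] <-]; apply: blow_down_in; exact: BX.
have Ap : A `<=` proj_points gf by move=> x /AG /grass_proj.
have Yi : irr_closed gf (zclosure gf A).
  apply: irr_closure => //; first by exists (blow_down v0), v0.
  move=> d e F G Fd Ge FG.
  have /(Bp _ _ _ _ (mhomog_pull_down Fd) (mhomog_pull_down Ge)) : ideal B (pull_down F * pull_down G).
    apply: (irr_regular inl bf_inl Bi Bv0 v0r (mhomogM (mhomog_pull_down Fd) (mhomog_pull_down Ge))) => v Bv vr.
    by rewrite evalpM !evalp_pull_down -evalpM; apply: FG; exists v.
  by case=> h; [left|right] => _ [v [Bv _] <-]; rewrite -evalp_pull_down h.
have YG : zclosure gf A `<=` Gr by exact: (zclosure_min (zclosed_grass k0)).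
exists (zclosure gf A); split=> //; first by apply: (sub_zclosure Ap); exists v0.
have Yc := zclosed_closure gf A.
apply/seteqP; split=> v.
  move=> Bv; split; first exact: (zclosed_proj Bc Bv).
  move=> F [[d Fd] F0]; apply: (irr_regular inl bf_inl Bi Bv0 v0r Fd) Bv => w Bw wr; apply: F0.
  by split=> //; [exact: BX|apply: (sub_zclosure Ap); exists w].
move: v; apply: (zclosure_min Bc) => v vb; have [Xv Yv vr] := vb.
have [Fs FsP BE] := Bc; rewrite BE; split; first exact: (zclosed_proj X_closed Xv).
move=> F FF; have [d Fd] := FsP F FF; have [l [l0 ->]] := strict_base_lift_pt vb.
rewrite (evalp_scale _ _ Fd) -evalp_pull_lift_pt.
suff h : ideal (zclosure gf A) (pull_lift_pt F) by rewrite h ?mulr0.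
apply: (ideal_homog_zclosure (mhomog_pull_lift_pt Fd)) => _ [w [Bw wr] <-].
rewrite evalp_pull_lift_pt; have [l' [l'0 _ e]] := open_lift_pt (X_regular (BX _ Bw) wr).
have /eqP : evalp F w = 0 by have := Bw; rewrite {1}BE => -[_]; exact.
rewrite {1}e (evalp_scale _ _ Fd).
by rewrite mulf_eq0 (negPf (scale_neq0 _ l'0)) => /eqP.
Qed.

Lemma strict_mono Y Y' : Y `<=` Y' -> strict Y `<=` strict Y'.
Proof. by move=> YY; apply: zclosure_mono => v [Xv Yv vr]; split=> //; exact: YY. Qed.

Lemma irr_sub_regular Y Y' x0 : irr_closed gf Y -> Y x0 -> regular x0 -> zclosed gf Y' ->
  (forall x, Y x -> regular x -> Y' x) -> Y `<=` Y'.
Proof.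
move=> Yi Yx0 x0r [Fs FsP Y'E] h x Yx; have [Yc _ _] := Yi; rewrite Y'E; split.
  exact: (zclosed_proj Yc Yx).
move=> F FF; have [d Fd] := FsP F FF.
by apply: (irr_regular id gf_id Yi Yx0 x0r Fd) Yx => y Yy yr; have := h y Yy yr; rewrite Y'E => -[_]; exact.
Qed.

Lemma strict_sub_inv Y Y' x0 : irr_closed gf Y -> Y `<=` Gr -> Y x0 -> regular x0 -> zclosed gf Y' ->
  strict Y `<=` strict Y' -> Y `<=` Y'.
Proof.
move=> Yi YG Yx0 x0r Y'c h; apply: (irr_sub_regular Yi Yx0 x0r Y'c) => x Yx xr.
apply: (strict_down Y'c (v := lift_pt x)); apply: h; exact: strict_lift_pt.
Qed.

Lemma strict_prime_divisor Y x0 : prime_divisor gf Gr Y -> Y x0 -> regular x0 ->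
  prime_divisor bf X (strict Y).
Proof.
move=> [Yi [YG GY] Ymax] Yx0 x0r; split.
- exact: strict_irr Yi YG Yx0 x0r.
- split; first exact: strict_sub.
  rewrite -strict_Gr => h; apply: GY.
  have [Yc _ _] := Yi.
  apply: (strict_sub_inv (x0 := graph_pt ord0 1%:M)) h => //.
  + exact: Gr_irr.
  + exact: graph_pt_in.
  + exact: regular_graph_pt1.
move=> B Bi YB BX.
have Bx0 : B (lift_pt x0) by apply: YB; exact: strict_lift_pt.
have [Y' [Y'i Y'G Y'x0 BE]] := irr_is_strict Bi BX Bx0 x0r.
have [Y'c _ _] := Y'i.
have YY' : Y `<=` Y'.
  by apply: (strict_sub_inv Yi YG Yx0 x0r Y'c); rewrite -BE.
have [e|e] := Ymax _ Y'i YY' Y'G; rewrite BE e; [by left|right].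
exact: strict_Gr.
Qed.

Lemma prime_divisor_strict P v0 : prime_divisor bf X P -> P v0 -> regular (blow_down v0) ->
  exists Y, [/\ prime_divisor gf Gr Y, Y (blow_down v0) & P = strict Y].
Proof.
move=> [Pi [PX XP] Pmax] Pv0 v0r.
have [Y [Yi YG Yv0 PE]] := irr_is_strict Pi PX Pv0 v0r; exists Y; split=> //.
have [Yc _ _] := Yi.
split=> //.
  by split=> // GY; apply: XP; rewrite PE -strict_Gr; exact: strict_mono.
move=> Y' Y'i YY' Y'G; have [Y'c _ _] := Y'i.
have Y'x0 := YY' _ Yv0.
have [|||e|e] := Pmax (strict Y').
- exact: strict_irr Y'i Y'G Y'x0 v0r.
- by rewrite PE; exact: strict_mono.
- exact: strict_sub.
- left; apply/seteqP; split=> //; apply: (strict_sub_inv Y'i Y'G Y'x0 v0r Yc).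
  by rewrite e PE.
right; apply/seteqP; split=> //.
apply: (strict_sub_inv (x0 := graph_pt ord0 1%:M)) => //; last by rewrite e strict_Gr.
- exact: Gr_irr.
- exact: graph_pt_in.
- exact: regular_graph_pt1.
Qed.

(** * The exceptional divisors *)

Definition graph_coord i I : mpoly #|{: P2}| K := projT1 (cid (graph_chart_poly i I)).

Lemma graph_coordE i I a : graph_pt i (frame_mx a) I = evalp (graph_coord i I) a.
Proof. exact: (projT2 (cid (graph_chart_poly i I))). Qed.

Definition hquot (F : mpoly #|{: P2}| K) : P2 -> mpoly #|{: P2}| K := projT1 (cid (hadamard F)).

Lemma hquotE F a : evalp F a = evalp F (fun=> 0) + \sum_t a t * evalp (hquot F t) a.
Proof. exact: (projT2 (cid (hadamard F))). Qed.

Definition hquot1 i I t := hquot (graph_coord i I) t.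
Definition hquot2 i I t t' := hquot (hquot1 i I t) t'.

(** The quotient (graph_pt i (s A) - center i) / s, which is polynomial in s and A. *)
Definition secant i (A : 'M[K]_k) (s : K) : J -> K := fun I =>
  \sum_(t : P2) A t.1 t.2 * evalp (hquot1 i I t) (fun t' => s * A t'.1 t'.2).

(** The tangent vector at the center in the direction A. *)
Definition tangent i A : J -> K := secant i A 0.

Lemma frame_mxK (A : 'M[K]_k) : frame_mx (fun t => A t.1 t.2) = A.
Proof. by apply/matrixP => r s; rewrite mxE. Qed.

Lemma frame_mx0 : frame_mx (fun=> 0) = 0 :> 'M[K]_k.
Proof. by apply/matrixP => r s; rewrite !mxE. Qed.

Lemma evalp_graph_coord0 i I : evalp (graph_coord i I) (fun=> 0) = center i I.
Proof. by rewrite -graph_coordE frame_mx0 graph_pt0. Qed.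

Lemma graph_pt_secant i A s I : graph_pt i (s *: A) I = center i I + s * secant i A s I.
Proof.
have -> : s *: A = frame_mx (fun t => s * A t.1 t.2) by apply/matrixP => r c; rewrite !mxE.
rewrite graph_coordE hquotE evalp_graph_coord0 mulr_sumr; congr (_ + _); apply: eq_bigr => t _.
by rewrite mulrA.
Qed.

Lemma graph_pt_tangent i A I : graph_pt i A I = center i I + tangent i A I +
  \sum_(t : P2) \sum_(t' : P2) A t.1 t.2 * A t'.1 t'.2 * evalp (hquot2 i I t t') (fun t => A t.1 t.2).
Proof.
rewrite -{1}[A]frame_mxK graph_coordE hquotE evalp_graph_coord0 -addrA; congr (_ + _).
rewrite /tangent /secant -big_split; apply: eq_bigr => t _ /=.
rewrite hquotE mulrDr mulr_sumr; congr (_ * _ + _).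
  by congr evalp; apply/funext => t'; rewrite mul0r.
by apply: eq_bigr => t' _; rewrite mulrA.
Qed.

Lemma tangentE i A I : tangent i A I = \sum_(t : P2) A t.1 t.2 * evalp (hquot1 i I t) (fun=> 0).
Proof.
by apply: eq_bigr => t _; congr (_ * evalp _ _); apply/funext => t'; rewrite mul0r.
Qed.

Lemma tangentZ i c A : tangent i (c *: A) = (fun I => c * tangent i A I).
Proof.
by apply/funext => I; rewrite !tangentE mulr_sumr; apply: eq_bigr => t _; rewrite mxE mulrA.
Qed.

Lemma tangentD i A B : tangent i (A + B) = (fun I => tangent i A I + tangent i B I).
Proof.
by apply/funext => I; rewrite !tangentE -big_split; apply: eq_bigr => t _; rewrite mxE mulrDl.
Qed.

Lemma poly_secant i A I : exists q : {poly K}, forall s, q.[s] = secant i A s I.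
Proof.
have ex t : exists q : {poly K}, forall s, q.[s] = evalp (hquot1 i I t) (fun t' => s * A t'.1 t'.2).
  exists (arc_poly (hquot1 i I t) (fun t' => A t'.1 t'.2 *: 'X)) => s; rewrite arc_polyE; congr evalp; apply/funext => t'.
  by rewrite hornerZ hornerX mulrC.
have [q qE] := choice ex.
exists (\sum_t A t.1 t.2 *: q t) => s; rewrite horner_sum; apply: eq_bigr => t _.
by rewrite hornerZ qE.
Qed.

Lemma Ycoord_secant i A s : Ycoord i (secant i A s) = A.
Proof.
have [q qE] := choice (poly_secant i A).
have e u : u != 0 -> Ycoord i (secant i A u) = A.
  move=> u0; have -> : secant i A u = (fun I => u^-1 * (graph_pt i (u *: A) I - center i I)).
    by apply/funext => I; rewrite graph_pt_secant addrC addKr mulKf.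
  by rewrite YcoordZ YcoordB Ycoord_graph_pt Ycoord_center subr0 scalerA mulVf // scale1r.
apply/matrixP => r c.
pose p : {poly K} := \sum_j (\sum_(I : J) q I * (\det (rowsub (val I) (repl_col (U i) r j)))%:P) * (U (other i) j c)%:P.
have pE u : p.[u] = Ycoord i (secant i A u) r c.
  rewrite YcoordE horner_sum; apply: eq_bigr => j _; rewrite hornerM hornerC; congr (_ * _).
  by rewrite horner_sum; apply: eq_bigr => I _; rewrite hornerM hornerC qE.
rewrite -pE; suff -> : p = (A r c)%:P by rewrite hornerC.
by apply: poly_ext_neq0 => u u0; rewrite pE e // hornerC.
Qed.

Lemma Ycoord_tangent i A : Ycoord i (tangent i A) = A. Proof. exact: Ycoord_secant. Qed.

(** The point of the exceptional divisor in the direction A. The scalars a and b are those of the representatives of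
    the point of the Grassmannian and of the other normal direction. *)
Definition exc_point i (a b : K) (A : 'M[K]_k) : T -> K := fun t =>
  match t with
  | inl I0 => a * center i I0
  | inr (j, IJ) => if j == i then wedge (tangent i A) (center i) IJ else b * wedge (center i) (center j) IJ
  end.

Lemma wedge_Ycoord i (x : J -> K) : (forall IJ, wedge x (center i) IJ = 0) -> Ycoord i x = 0.
Proof.
move=> xp; have [I pI] := row_free_plucker (row_freeM i).
have -> : x = (fun I' => (x I / center i I) * center i I').
  apply/funext => I'; have /eqP := xp (I, I'); rewrite /wedge /= subr_eq0 => /eqP e.
  by rewrite mulrAC e mulfK.
by rewrite YcoordZ Ycoord_center scaler0.
Qed.

Lemma wedge_secant_neq0 i A s : A != 0 -> exists IJ, wedge (secant i A s) (center i) IJ != 0.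
Proof.
move=> A0; apply: not_same_wedge => h; move/eqP: A0; apply.
by rewrite -(Ycoord_secant i A s) wedge_Ycoord.
Qed.

Lemma wedge_centers i : exists IJ, wedge (center i) (center (other i)) IJ != 0.
Proof.
apply: not_same_wedge; rewrite -(graph_pt0 i); exact: not_same_graph_pt.
Qed.

(** The arc s |-> graph of s A, lifted to the blow-up; it meets the exceptional divisor at s = 0. *)
Definition exc_arc i (A : 'M[K]_k) (s : K) : T -> K := fun t =>
  match t with
  | inl I0 => graph_pt i (s *: A) I0
  | inr (j, IJ) => if j == i then wedge (secant i A s) (center i) IJ else wedge (graph_pt i (s *: A)) (center j) IJ
  end.

Lemma wedge_graph_pt_secant i A s IJ : wedge (graph_pt i (s *: A)) (center i) IJ = s * wedge (secant i A s) (center i) IJ.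
Proof. by rewrite /wedge !graph_pt_secant; ring. Qed.

Lemma exc_arc_open i A s : A != 0 -> s != 0 -> open_blowup (exc_arc i A s).
Proof.
move=> A0 s0; split.
- exact: graph_pt_in.
- by apply: regular_graph_pt; rewrite scaler_eq0 negb_or s0.
move=> j; have [->|ji] := eqVneq j i.
  exists s^-1; rewrite ?invr_eq0 // => IJ.
  by rewrite /normal_dir /= eqxx [wedge (blow_down _) _ _]wedge_graph_pt_secant mulKf.
by exists 1; [exact: oner_neq0|move=> IJ; rewrite mul1r /normal_dir /= (negPf ji)].
Qed.

Lemma center_neq0 i : exists I, center i I != 0.
Proof. exact: row_free_plucker (row_freeM i). Qed.

Lemma exc_arc0_proj i A : A != 0 -> proj_points bf (exc_arc i A 0).
Proof.
move=> A0 [j|]; last first.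
  have [I pI] := center_neq0 i; exists (inl I) => //=.
  by rewrite scale0r graph_pt0.
have [->|ji] := eqVneq j i.
  have [IJ w0] := wedge_secant_neq0 i 0 A0.
  by exists (inr (i, IJ)) => //=; rewrite eqxx.
have [IJ w0] := wedge_centers i; exists (inr (j, IJ)) => //=.
by rewrite (negPf ji) scale0r graph_pt0; move: ji; rewrite eq_sym => /neq_other->.
Qed.

Lemma poly_exc_arc i A : exists g : T -> {poly K}, forall s t, (g t).[s] = exc_arc i A s t.
Proof.
have [q qE] := choice (poly_secant i A).
pose x I : {poly K} := (center i I)%:P + 'X * q I.
have xE I u : (x I).[u] = graph_pt i (u *: A) I by rewrite hornerD hornerM hornerX hornerC qE graph_pt_secant.
exists (fun t => match t with
  | inl I0 => x I0
  | inr (j, IJ) => if j == i then q IJ.1 * (center i IJ.2)%:P - q IJ.2 * (center i IJ.1)%:P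
                   else x IJ.1 * (center j IJ.2)%:P - x IJ.2 * (center j IJ.1)%:P end).
move=> s [I0|[j IJ]] /=; first exact: xE.
by case: ifP => _; rewrite hornerD hornerN !hornerM !hornerC ?qE ?xE.
Qed.

(** The blow-up is closed, so that an arc lies in it as soon as it does generically, provided that its limit
    defines a point. *)
Lemma arc_limit (g : T -> {poly K}) (r : {poly K}) : r != 0 ->
  (forall s, r.[s] != 0 -> open_blowup (fun t => (g t).[s])) ->
  proj_points bf (fun t => (g t).[0]) -> X (fun t => (g t).[0]).
Proof.
move=> r0 rX gp; split=> // F [_ F0]; rewrite -arc_polyE.
suff -> : arc_poly F g = 0 by rewrite horner0.
by apply: (poly_ext_generic r0) => s rs; rewrite arc_polyE horner0; apply: F0; exact: rX.
Qed.

Lemma exc_arc0_in i A : A != 0 -> X (exc_arc i A 0).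
Proof.
move=> A0; have [g gE] := poly_exc_arc i A.
have gs s : (fun t => (g t).[s]) = exc_arc i A s by apply/funext => t; exact: gE.
rewrite -gs; apply: (@arc_limit g 'X); rewrite ?polyX_eq0 // ?gs; last exact: exc_arc0_proj.
by move=> s; rewrite hornerX gs; exact: exc_arc_open.
Qed.

Definition exc_scale i (a c b : K) : option 'I_2 -> K := fun s =>
  if s is Some j then if j == i then c else b else a.

Lemma exc_scale_neq0 i a c b : a != 0 -> c != 0 -> b != 0 -> forall s, exc_scale i a c b s != 0.
Proof. by move=> a0 c0 b0 [j|] //=; case: ifP. Qed.

Lemma exc_point_scale i a c b A : exc_point i a b (c *: A) = scale bf (exc_scale i a c b) (exc_arc i A 0).
Proof.
apply/funext => -[I0|[j IJ]]; rewrite /scale /=.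
  by rewrite scale0r graph_pt0.
case: ifP => // _; first by rewrite tangentZ wedgeZ.
by rewrite scale0r graph_pt0.
Qed.

Lemma exc_point_in i a b A : a != 0 -> b != 0 -> A != 0 -> exceptional center i (exc_point i a b A).
Proof.
move=> a0 b0 A0; rewrite -[A]scale1r exc_point_scale; split.
  apply: (zclosed_stable X_closed); last exact: exc_arc0_in.
  by apply: exc_scale_neq0 => //; exact: oner_neq0.
by move=> IJ; rewrite blow_down_scale /= /blow_down /= scale0r graph_pt0 /wedge; ring.
Qed.

(** A vector whose wedge with the center is the normal direction, normalized by the vanishing of the form
    that is 1 at the center. *)
Definition zcoord i (v : T -> K) : J -> K := fun I => lform (U i) (fun I' => normal_dir v i (I, I')).

Lemma zcoord_wedge i (v : T -> K) (x : J -> K) : (forall IJ, normal_dir v i IJ = wedge x (center i) IJ) ->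
  zcoord i v = (fun I => x I - lform (U i) x * center i I).
Proof.
move=> h; apply/funext => I; rewrite /zcoord.
have -> : (fun I' => normal_dir v i (I, I')) = (fun I' => x I * center i I' - center i I * x I').
  by apply/funext => I'; rewrite h /wedge /= [x I' * _]mulrC.
by rewrite lformB !lformZ lform_center mulr1 [center i I * _]mulrC.
Qed.

Lemma Ycoord_zcoord i (v : T -> K) (x : J -> K) : (forall IJ, normal_dir v i IJ = wedge x (center i) IJ) ->
  Ycoord i (zcoord i v) = Ycoord i x.
Proof. by move=> h; rewrite (zcoord_wedge h) YcoordB YcoordZ Ycoord_center scaler0 subr0. Qed.

Lemma Ycoord_zcoord_exc_point i a b A : Ycoord i (zcoord i (exc_point i a b A)) = A.
Proof.
rewrite (Ycoord_zcoord (x := tangent i A)) ?Ycoord_tangent // => IJ.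
by rewrite /normal_dir /= eqxx.
Qed.

Definition Zpoly i I : mpoly #|T| K := lpoly (fun I' => inr (i, (I, I')) : T) (U i).

Lemma evalp_Zpoly i I v : evalp (Zpoly i I) v = zcoord i v I.
Proof. exact: evalp_lpoly. Qed.

Definition YZpoly i (t : P2) : mpoly #|T| K :=
  \sum_j mpolyC _ (U (other i) j t.2) *
    \sum_(I : J) mpolyC _ (\det (rowsub (val I) (repl_col (U i) t.1 j))) * Zpoly i I.

Lemma evalp_YZpoly i t v : evalp (YZpoly i t) v = Ycoord i (zcoord i v) t.1 t.2.
Proof.
rewrite evalp_sum YcoordE; apply: eq_bigr => j _; rewrite evalpM evalpC mulrC; congr (_ * _).
by rewrite evalp_sum; apply: eq_bigr => I _; rewrite evalpM evalpC evalp_Zpoly mulrC.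
Qed.

Lemma mhomog_YZpoly i t : mhomog bf (fun s => (Some i == s) : nat) (YZpoly i t).
Proof.
apply: mhomog_sum => j _; apply: mhomogCM; apply: mhomog_sum => I _; apply: mhomogCM.
exact: mhomog_lpoly.
Qed.

(** Away from the centers, the normal direction is the affine coordinate A up to a scalar. *)
Lemma open_zcoord v i : open_blowup v -> exists a : K, [/\ a != 0,
   (forall IJ, normal_dir v i IJ = wedge (fun I => a * blow_down v I) (center i) IJ),
   zcoord i v = (fun I => a * (blow_down v I - lform (U i) (blow_down v) * center i I)) &
   Ycoord i (zcoord i v) = a *: Ycoord i (blow_down v)].
Proof.
move=> [_ _ /(_ i)[a a0 h]]; exists a.
have h' IJ : normal_dir v i IJ = wedge (fun I => a * blow_down v I) (center i) IJ by rewrite h wedgeZ.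
split=> //; last by rewrite (Ycoord_zcoord h') YcoordZ.
by rewrite (zcoord_wedge h'); apply/funext => I; rewrite lformZ; ring.
Qed.

Lemma X_normal_dir v i IJ : X v -> normal_dir v i IJ = wedge (zcoord i v) (center i) IJ.
Proof.
move=> Xv; apply/eqP; rewrite -subr_eq0; apply/eqP.
apply: (X_identity (f := fun v => normal_dir v i IJ - wedge (zcoord i v) (center i) IJ)) Xv.
  exists (pvar (inr (i, IJ) : T) - (Zpoly i IJ.1 * mpolyC _ (center i IJ.2) - Zpoly i IJ.2 * mpolyC _ (center i IJ.1))) => w.
  by rewrite !evalpB !evalpM !evalpC evalp_var !evalp_Zpoly.
move=> w /(open_zcoord i)[a [_ h -> _]]; rewrite h /wedge; ring.
Qed.

(** The affine coordinates and the coordinates of the normal direction are proportional matrices. *)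
Lemma X_Ycoord v i t t' : X v -> Ycoord i (blow_down v) t.1 t.2 * Ycoord i (zcoord i v) t'.1 t'.2 =
  Ycoord i (blow_down v) t'.1 t'.2 * Ycoord i (zcoord i v) t.1 t.2.
Proof.
move=> Xv; apply/eqP; rewrite -subr_eq0; apply/eqP.
apply: (X_identity (f := fun v => Ycoord i (blow_down v) t.1 t.2 * Ycoord i (zcoord i v) t'.1 t'.2 -
  Ycoord i (blow_down v) t'.1 t'.2 * Ycoord i (zcoord i v) t.1 t.2)) Xv.
  exists (Ypoly inl i t * YZpoly i t' - Ypoly inl i t' * YZpoly i t) => w.
  by rewrite evalpB !evalpM !evalp_Ypoly !evalp_YZpoly.
by move=> w /(open_zcoord i)[a [_ _ _ ->]]; rewrite !mxE; ring.
Qed.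

(** This is [chart_coord] at a point that is not normalized: the homogeneity factor is made explicit. *)
Lemma dehomogenize i (g : mpoly #|{: P2}| K) : exists m (F : mpoly #|J| K), forall x, Gr x ->
  lform (U i) x != 0 ->
  evalp F x = lform (U i) x ^+ m * evalp g (fun t => (lform (U i) x)^-1 * Ycoord i x t.1 t.2).
Proof.
have [d [F [Fd FE]]] := chart_coord (graph_chart i) g.
exists (d tt), F => x xG y0.
rewrite -FE {1}(graph_pt_recover xG y0).
have -> : (fun I => lform (U i) x * graph_pt i ((lform (U i) x)^-1 *: Ycoord i x) I) =
  scale gf (fun=> lform (U i) x) (graph_pt i (frame_mx (fun t => (lform (U i) x)^-1 * Ycoord i x t.1 t.2))).
  apply/funext => I; rewrite /scale; congr (_ * graph_pt i _ _).
  by apply/matrixP => r s; rewrite !mxE.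
by rewrite (evalp_scale _ _ Fd) (big_pred1 tt) // => -[].
Qed.

(** Above a center the normal direction is a tangent vector of the Grassmannian. Away from the centers the
    normal direction and the tangent vector differ by the terms of order 2 of the chart, which can be written,
    after multiplication by a power of the form that is 1 at the center, with a factor that vanishes at the
    center. This identity extends to the closure. *)
Lemma X_tangent v i I : X v -> same_point (blow_down v) (center i) ->
  zcoord i v I = tangent i (Ycoord i (zcoord i v)) I.
Proof.
move=> Xv vp.
pose h t t' := hquot2 i I t t'.
have [m] := choice (fun tt => dehomogenize i (h tt.1 tt.2)).
move=> /choice[F0 F0E]; pose F t t' := F0 (t, t').
have FE t t' x : Gr x -> lform (U i) x != 0 ->
  evalp (F t t') x = lform (U i) x ^+ m (t, t') * evalp (h t t') (fun t => (lform (U i) x)^-1 * Ycoord i x t.1 t.2).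
  exact: F0E (t, t') x.
(* a common exponent for all the homogenized terms of order 2 *)
pose N := (\sum_t \sum_t' m (t, t'))%N.
have mN t t' : (m (t, t') <= N)%N.
  by rewrite /N (bigD1 t) //= (bigD1 t') //= -addnA leq_addr.
pose f (v : T -> K) := lform (U i) (blow_down v) *
  (lform (U i) (blow_down v) ^+ N.+1 * (zcoord i v I - tangent i (Ycoord i (zcoord i v)) I) -
   \sum_t \sum_t' Ycoord i (zcoord i v) t.1 t.2 * Ycoord i (blow_down v) t'.1 t'.2 *
      (lform (U i) (blow_down v) ^+ (N - m (t, t')) * evalp (F t t') (blow_down v))).
have f0 : f v = 0.
  apply: (X_identity (f := f)) Xv => [|w ow].
    exists (lpoly inl (U i) * (lpoly inl (U i) ^+ N.+1 * (Zpoly i I -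
       \sum_t YZpoly i t * mpolyC _ (evalp (hquot1 i I t) (fun=> 0))) -
       \sum_t \sum_t' YZpoly i t * Ypoly inl i t' * (lpoly inl (U i) ^+ (N - m (t, t')) * pull_down (F t t')))) => w.
    rewrite evalpM evalpB evalpM evalpXn evalpB evalp_Zpoly !evalp_lpoly /f tangentE.
    congr (_ * (_ * (_ - _) - _)).
      by rewrite evalp_sum; apply: eq_bigr => t _; rewrite evalpM evalpC evalp_YZpoly.
    rewrite evalp_sum; apply: eq_bigr => t _; rewrite evalp_sum; apply: eq_bigr => t' _.
    by rewrite !evalpM evalpXn evalp_YZpoly evalp_Ypoly evalp_lpoly evalp_pull_down.
  rewrite /f; set x := blow_down w; set y := lform (U i) x.
  have [->|y0] := eqVneq y 0; first by rewrite mul0r.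
  have [wG _ _] := ow; have [a [_ _ zE YE]] := open_zcoord i ow.
  rewrite YE zE -/x -/y tangentZ.
  have xE : x I = y * graph_pt i (y^-1 *: Ycoord i x) I by rewrite /y /x {1}(graph_pt_recover wG y0).
  rewrite {1}xE graph_pt_tangent tangentZ; set S := \sum_t \sum_t' _; set S' := \sum_t \sum_t' _.
  suff -> : S' = a * y ^+ N.+2 * S by exact: tangent_field1.
  rewrite /S /S' mulr_sumr; apply: eq_bigr => t _; rewrite mulr_sumr; apply: eq_bigr => t' _.
  rewrite FE // -/y !mxE [y ^+ (N - _) * _]mulrA.
  have -> : y ^+ N.+2 = y * y * (y ^+ (N - m (t, t')) * y ^+ m (t, t')) by rewrite -exprD subnK // !exprS mulrA.
  have -> : (fun t0 : P2 => (y^-1 *: Ycoord i x) t0.1 t0.2) = (fun t => y^-1 * Ycoord i x t.1 t.2).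
    by apply/funext => t0; rewrite mxE.
  exact: tangent_field2.
have [c c0 e] := same_pointP (blow_down_in Xv) vp.
have Y0 : Ycoord i (blow_down v) = 0 by rewrite e YcoordZ Ycoord_center scaler0.
have yc : lform (U i) (blow_down v) = c by rewrite e lformZ lform_center mulr1.
move: f0; rewrite /f yc Y0 big1 ?subr0 => [/eqP|t _]; last first.
  by rewrite big1 // => t' _; rewrite [(0 : 'M[K]_k) _ _]mxE mulr0 mul0r.
by rewrite !mulf_eq0 expf_eq0 (negPf c0) andbF /= subr_eq0 => /eqP.
Qed.

Lemma exceptional_point i v : exceptional center i v -> exists a b A,
  [/\ a != 0, b != 0, A != 0 & v = exc_point i a b A].
Proof.
move=> [Xv vp]; have vG := blow_down_in Xv.
have [a a0 e] := same_pointP vG vp.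
have vo : ~ same_point (blow_down v) (center (other i)) by exact: (not_same_both vG vp).
have [b b0 eb] := normal_dir_wedge Xv vo.
have en IJ : normal_dir v i IJ = wedge (tangent i (Ycoord i (zcoord i v))) (center i) IJ.
  by rewrite X_normal_dir // /wedge !(X_tangent _ Xv vp).
exists a, (b * a), (Ycoord i (zcoord i v)); split=> //.
- by rewrite mulf_neq0.
- have [t + vt] := zclosed_proj X_closed Xv (Some i).
  case: t vt => // -[j IJ] vt /= [ji]; apply: contra_neq vt => Y0.
  rewrite ji -[LHS]/(normal_dir v i IJ) en Y0 -(scale0r 0) tangentZ wedgeZ mul0r //.
apply/funext => -[I|[j IJ]] /=; first by rewrite -[LHS]/(blow_down v I) e.
case: eqVneq => [->|]; first exact: en.
rewrite eq_sym => /neq_other->; rewrite -[LHS]/(normal_dir v (other i) IJ) eb e wedgeZ.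
by rewrite mulrA.
Qed.

Lemma zclosed_zeros (S TT : finType) (c : TT -> S) (A : set (TT -> K)) (Gs : set (mpoly #|TT| K)) :
  zclosed c A -> (forall G, Gs G -> exists d, mhomog c d G) ->
  zclosed c (A `&` [set v | forall G, Gs G -> evalp G v = 0]).
Proof.
move=> [Fs FsP ->] Gd; exists (Fs `|` Gs); first by move=> G [/FsP|/Gd].
apply/seteqP; split=> v.
  by move=> [[vp vF] Fv]; split=> // G [/vF|/Fv].
by move=> [vp vF]; split; [split=> // G GF|move=> G GG]; apply: vF; [left|right].
Qed.

Lemma exceptional_closed i : zclosed bf (exceptional center i).
Proof.
have := zclosed_zeros (Gs := [set wpoly (inl : J -> T) i IJ | IJ in setT]) X_closed.
rewrite (_ : exceptional center i = X `&` [set v | forall G, [set wpoly (inl : J -> T) i IJ | IJ in setT] G -> evalp G v = 0]).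
  apply=> _ [IJ _ <-]; exists (fun s => (None == s) : nat); exact: mhomog_wpoly.
apply/seteqP; split=> v [Xv vp]; split=> //.
  by move=> _ [IJ _ <-]; rewrite evalp_wpoly; exact: vp.
by move=> IJ; have := vp _ (ex_intro2 _ _ IJ Logic.I erefl); rewrite evalp_wpoly.
Qed.

Lemma linepoly_exc_point i (V : lmodType K) (a b : K) (A : V -> 'M[K]_k) t :
  (forall r s, linepoly (fun u => A u r s)) -> linepoly (fun u => exc_point i a b (A u) t).
Proof.
move=> Al; have tl I : linepoly (fun u => tangent i (A u) I).
  have -> : (fun u => tangent i (A u) I) = (fun u => \sum_(t : P2) A u t.1 t.2 * evalp (hquot1 i I t) (fun=> 0)).
    by apply/funext => u; rewrite tangentE.
  by apply: linepoly_sum => t0; apply: linepolyM; [exact: Al|exact: linepoly_cst].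
case: t => [I|[j IJ]] /=; first exact: linepoly_cst.
case: (j == i); last exact: linepoly_cst.
by rewrite /wedge; apply: linepolyB; apply: linepolyM; [exact: tl|exact: linepoly_cst|exact: tl|exact: linepoly_cst].
Qed.

Lemma linepoly_entry (r s : 'I_k) : linepoly (fun A : 'M[K]_k => A r s).
Proof. by apply: linepoly_linear; exists id. Qed.

Lemma exc_point_rescale i a b A : a != 0 -> b != 0 -> A != 0 ->
  exists l, (forall s, l s != 0) /\ exc_point i a b A = scale bf l (exc_point i 1 1 A).
Proof.
move=> a0 b0 A0; exists (exc_scale i a 1 b); split.
  by apply: exc_scale_neq0 => //; exact: oner_neq0.
apply/funext => -[I|[j IJ]]; rewrite /scale /= ?mul1r //.
by case: ifP => _; rewrite ?mul1r.
Qed.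

Lemma exceptional_irr i : irr_closed bf (exc i).
Proof.
have o := oner_neq0 K.
apply/irr_closedP; split; first exact: exceptional_closed.
  by exists (exc_point i 1 1 1%:M); apply: exc_point_in => //; exact: id_mx_neq0.
apply: (hprime_param (par := exc_point i 1 1) (q := fun A => A (Ordinal k0) (Ordinal k0))).
- by move=> t; apply: linepoly_exc_point; exact: linepoly_entry.
- exact: linepoly_entry.
- by exists 1%:M; rewrite mxE eqxx.
- by move=> A A0; apply: exc_point_in => //; apply: contra_neq A0 => ->; rewrite mxE.
move=> v /exceptional_point[a [b [A [a0 b0 A0 ->]]]].
by exists A; exact: exc_point_rescale.
Qed.

Lemma exceptional_linear i : linear_in_exceptional center i (exceptional center i).
Proof.
split=> // v w a b /exceptional_point[a1 [b1 [A1 [a10 b10 A10 ->]]]] /exceptional_point[a2 [b2 [A2 [a20 b20 A20 ->]]]] [IJ0 n0].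
have e IJ : normal_dir (exc_point i 1 1 (a *: A1 + b *: A2)) i IJ =
  a * normal_dir (exc_point i a1 b1 A1) i IJ + b * normal_dir (exc_point i a2 b2 A2) i IJ.
  by rewrite /normal_dir /= eqxx tangentD !tangentZ /wedge; ring.
exists (exc_point i 1 1 (a *: A1 + b *: A2)) => //.
apply: exc_point_in; rewrite ?oner_neq0 //.
apply: contra_neq n0 => A0; rewrite -e A0 /normal_dir /= eqxx -(scale0r 0) tangentZ wedgeZ mul0r //.
Qed.

Let t0 : P2 := (Ordinal k0, Ordinal k0).

(** The direction is normalized by its entry of index t0. *)
Definition exc_dir (a : P2 -> K) : 'M[K]_k := frame_mx (fun t => if t == t0 then 1 else a t).

(** Of the parameters, that of index t0 is the equation of the exceptional divisor and the others are the
    entries of the direction. *)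
Definition exc_par i (a : P2 -> K) : T -> K := exc_arc i (exc_dir a) (a t0).

Lemma exc_dir_t0 a : exc_dir a t0.1 t0.2 = 1. Proof. by rewrite mxE eqxx. Qed.

Lemma exc_dir_neq0 a : exc_dir a != 0.
Proof. by apply/eqP => /matrixP/(_ t0.1 t0.2)/eqP; rewrite exc_dir_t0 mxE oner_eq0. Qed.

Definition exc_chart_unit i : mpoly #|T| K := lpoly inl (U i) * YZpoly i t0.

Lemma blow_down_exc_par i a : blow_down (exc_par i a) = graph_pt i (a t0 *: exc_dir a). Proof. by []. Qed.

Lemma Ycoord_zcoord_exc_par i a : Ycoord i (zcoord i (exc_par i a)) = exc_dir a.
Proof.
rewrite (Ycoord_zcoord (x := secant i (exc_dir a) (a t0))) ?Ycoord_secant // => IJ.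
by rewrite /normal_dir /= eqxx.
Qed.

Lemma polyfun_secant i I : exists F : mpoly #|{: P2}| K, forall a, secant i (exc_dir a) (a t0) I = evalp F a.
Proof.
pose dir t : mpoly #|{: P2}| K := if t == t0 then 1 else pvar t.
have dirE t a : evalp (dir t) a = exc_dir a t.1 t.2.
  by rewrite /dir mxE; case: t => r s /=; case: ifP => _; rewrite ?evalp1 ?evalp_var.
exists (\sum_t dir t * psubst (fun t' => pvar t0 * dir t') (hquot1 i I t)) => a.
rewrite evalp_sum; apply: eq_bigr => t _; rewrite evalpM dirE evalp_psubst; congr (_ * evalp _ _).
by apply/funext => t'; rewrite evalpM evalp_var dirE.
Qed.

Lemma polyfun_graph_pt i I : exists F : mpoly #|{: P2}| K, forall a, graph_pt i (a t0 *: exc_dir a) I = evalp F a.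
Proof.
have [F FE] := polyfun_secant i I; exists (mpolyC _ (center i I) + pvar t0 * F) => a.
by rewrite graph_pt_secant FE evalpD evalpC evalpM evalp_var.
Qed.

Lemma polyfun_wedge (x : (P2 -> K) -> J -> K) i IJ :
  (forall I, exists F : mpoly #|{: P2}| K, forall a, x a I = evalp F a) ->
  exists F : mpoly #|{: P2}| K, forall a, wedge (x a) (center i) IJ = evalp F a.
Proof.
move=> h; have [F FE] := h IJ.1; have [G GE] := h IJ.2.
exists (F * mpolyC _ (center i IJ.2) - G * mpolyC _ (center i IJ.1)) => a.
by rewrite evalpB !evalpM !evalpC /wedge FE GE.
Qed.

Lemma exc_arc_in i A s : A != 0 -> X (exc_arc i A s).
Proof.
move=> A0; have [->|s0] := eqVneq s 0; first exact: exc_arc0_in.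
by apply: open_sub; exact: exc_arc_open.
Qed.

(** A chart of the blow-up that meets the exceptional divisor. The surjectivity is checked separately on the
    exceptional divisor, where the points are the directions, and away from it, where the parameters
    are recovered from the affine coordinates. *)
Lemma exc_chart i : chart bf X (exc_par i) (exc_chart_unit i).
Proof.
have hL : mhomog bf (fun s => (None == s) : nat) (lpoly inl (U i) : mpoly #|T| K) by exact: mhomog_lpoly.
have hZ t : mhomog bf (fun s => (Some i == s) : nat) (YZpoly i t) by exact: mhomog_YZpoly.
have LE a : evalp (lpoly inl (U i)) (exc_par i a) = 1 by rewrite evalp_lpoly [LHS]lform_graph_pt.
have ZE a t : evalp (YZpoly i t) (exc_par i a) = exc_dir a t.1 t.2 by rewrite evalp_YZpoly Ycoord_zcoord_exc_par.
split.
- move=> [I|[j IJ]] /=; first exact: polyfun_graph_pt.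
  by case: (j == i); apply: polyfun_wedge => I; [exact: polyfun_secant|exact: polyfun_graph_pt].
- by move=> a; apply: exc_arc_in; exact: exc_dir_neq0.
- by exists (fun s => (None == s) + (Some i == s))%N; exact: mhomogM.
- by move=> a; rewrite evalpM LE ZE exc_dir_t0 mulr1 oner_neq0.
- move=> v Xv; rewrite evalpM evalp_lpoly evalp_YZpoly mulf_eq0 => /norP[y0 z0].
  have vG := blow_down_in Xv.
  set x := blow_down v in vG y0; rewrite -[fun I => _]/x in y0.
  have [Y0|Y0] := eqVneq (Ycoord i x t0.1 t0.2) 0.
    have Yx : Ycoord i x = 0.
      apply/matrixP => r s; rewrite [RHS]mxE.
      have /eqP := X_Ycoord i t0 (r, s) Xv; rewrite Y0 mul0r eq_sym mulf_eq0 (negPf z0) orbF.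
      by move/eqP.
    have xp : same_point x (center i) by apply: same_pointZ (center_recover vG y0 Yx).
    have [a [b [A [a0 b0 A0 e]]]] := exceptional_point (conj Xv xp : exceptional center i v).
    move: z0; rewrite e Ycoord_zcoord_exc_point => At0.
    exists (fun t => if t == t0 then 0 else A t.1 t.2 / A t0.1 t0.2), (exc_scale i a (A t0.1 t0.2) b).
    split; first exact: exc_scale_neq0.
    rewrite /exc_par eqxx -exc_point_scale; congr exc_point; apply/matrixP => r s; rewrite !mxE.
    case: eqVneq => [[-> ->]|]; first by rewrite mulr1.
    by rewrite mulrCA divff ?mulr1.
  have xr : regular x.
    have h : Ycoord i x != 0 by apply: contra_neq Y0 => ->; rewrite mxE.
    move=> j; have [->|] := eqVneq j i.
      by move=> /(same_pointP vG)[c _ e]; move/eqP: h; rewrite e YcoordZ Ycoord_center scaler0.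
    rewrite eq_sym => /neq_other-> /(same_pointP vG)[c _ e].
    by move/eqP: y0; rewrite e lformZ lform_other_center mulr0.
  have [l [l0 lN e]] := open_lift_pt (X_regular Xv xr); rewrite -/x in e.
  set y := lform (U i) x in y0.
  pose a t := if t == t0 then Ycoord i x t0.1 t0.2 / y else Ycoord i x t.1 t.2 / Ycoord i x t0.1 t0.2.
  have at0 : a t0 = Ycoord i x t0.1 t0.2 / y by rewrite /a eqxx.
  have aA : a t0 *: exc_dir a = y^-1 *: Ycoord i x.
    apply/matrixP => r s; rewrite [LHS]mxE [exc_dir a _ _]mxE [RHS]mxE at0.
    case: eqVneq => [[-> ->]|/negPf rs]; first by rewrite mulr1 mulrC.
    by rewrite /a rs; field; rewrite ?y0 ?Y0.
  have xE : x = (fun I => y * graph_pt i (a t0 *: exc_dir a) I) by rewrite aA; exact: graph_pt_recover.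
  exists a, (fun s => if s is Some j then if j == i then l (Some i) * y * a t0 else l (Some j) * y else y).
  split.
    have a0 : a t0 != 0 by rewrite at0 mulf_neq0 ?invr_eq0.
    case=> [j|] //; case: ifP => _; last by apply: mulf_neq0.
    by apply: mulf_neq0 => //; apply: mulf_neq0.
  rewrite e; apply/funext => -[I|[j IJ]]; rewrite /scale /=.
    by rewrite lN mul1r {1}xE.
  rewrite xE wedgeZ; case: eqVneq => [->|_]; last by rewrite mulrA.
  by rewrite wedge_graph_pt_secant; ring.
move=> g; have [|d [F [u [Fd _ FE _]]]] := homogenize (c := bf) (phi := exc_par i) _ g; last by exists d, F.
move=> t; have [->|tt0] := eqVneq t t0.
  exists (fun s => (None == s) : nat), (Ypoly inl i t0), (lpoly inl (U i)); split=> //.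
  - exact: mhomog_Ypoly.
  - move=> a; rewrite evalp_Ypoly [Ycoord _ _]Ycoord_graph_pt mxE exc_dir_t0 mulr1 //.
exists (fun s => (Some i == s) : nat), (YZpoly i t), (YZpoly i t0); split=> //.
- by move=> a; rewrite ZE mxE; case: (t) tt0 => r s /negPf->.
- by move=> a; rewrite ZE exc_dir_t0.
Qed.

Lemma exceptional_prime i : prime_divisor bf X (exceptional center i).
Proof.
have h a : exceptional center i (exc_par i a) <-> a t0 = 0.
  split.
    move=> [_]; rewrite blow_down_exc_par => /same_point_graph_pt/eqP.
    by rewrite scaler_eq0 (negPf (exc_dir_neq0 a)) orbF => /eqP.
  move=> a0; split; first by apply: exc_arc_in; exact: exc_dir_neq0.
  by rewrite blow_down_exc_par a0 scale0r graph_pt0 => IJ; rewrite /wedge; ring.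
apply: (chart_prime_divisor_trace X_irr (exc_chart i) (g := pvar t0) (exceptional_irr i)).
- by move=> v [].
- apply: (chart_not_ideal (exc_chart i)); exists (fun=> 0); exact/h.
- by apply/seteqP; split=> a; rewrite /vanishing /= evalp_var => /h.
- move=> /seteqP[_ /(_ (fun=> 1) Logic.I)]; rewrite /vanishing /= evalp_var; apply/eqP; exact: oner_neq0.
Qed.

(** * Pencils and orders of vanishing *)

Implicit Types (W : 'M[K]_(k, n)) (F : mpoly #|J| K).

(** The Plücker coordinates of W0 + s W1, as polynomials in s. *)
Definition pencil W0 W1 (I : J) : {poly K} :=
  \det (\matrix_(i, j) ((W0 i (val I j))%:P + 'X * (W1 i (val I j))%:P)).

Lemma pencilE W0 W1 I s : (pencil W0 W1 I).[s] = plucker (W0 + s *: W1) I.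
Proof.
rewrite -[LHS]/(horner_eval s _) -det_map_mx; congr (\det _).
by apply/matrixP => i j; rewrite !mxE /= /horner_eval hornerD hornerM hornerX !hornerC.
Qed.

Definition pencil_wedge W0 W1 j (IJ : J * J) : {poly K} :=
  pencil W0 W1 IJ.1 * (center j IJ.2)%:P - pencil W0 W1 IJ.2 * (center j IJ.1)%:P.

Lemma pencil_wedgeE W0 W1 j IJ s : (pencil_wedge W0 W1 j IJ).[s] = wedge (plucker (W0 + s *: W1)) (center j) IJ.
Proof. by rewrite /pencil_wedge hornerD hornerN !hornerM !hornerC !pencilE. Qed.

Definition pencil_lift W0 W1 : T -> {poly K} := fun t =>
  match t with inl I0 => pencil W0 W1 I0 | inr (j, IJ) => pencil_wedge W0 W1 j IJ end.

(** When the frame W0 spans the i-th center, the corresponding normal direction vanishes at s = 0 and has to be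
    divided by s. *)
Definition center_pencil_lift i W0 W1 : T -> {poly K} := fun t =>
  match t with
  | inl I0 => pencil W0 W1 I0
  | inr (j, IJ) => if j == i then drop_poly 1 (pencil_wedge W0 W1 j IJ) else pencil_wedge W0 W1 j IJ
  end.

(** The restriction of a form to a pencil; it has degree at most k times the degree of the form. *)
Definition pencil_form F W0 W1 : {poly K} := arc_poly F (pencil W0 W1).

Lemma pencil_formE F W0 W1 s : (pencil_form F W0 W1).[s] = evalp F (plucker (W0 + s *: W1)).
Proof. by rewrite arc_polyE; congr evalp; apply/funext => I; rewrite pencilE. Qed.

Lemma arc_poly_pencil_lift F W0 W1 : arc_poly (pull_down F) (pencil_lift W0 W1) = pencil_form F W0 W1.
Proof.
apply: poly_ext => s; rewrite arc_polyE evalp_pull_down pencil_formE; congr evalp.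
by apply/funext => I; rewrite -pencilE.
Qed.

Lemma arc_poly_center_pencil_lift i F W0 W1 : arc_poly (pull_down F) (center_pencil_lift i W0 W1) = pencil_form F W0 W1.
Proof.
apply: poly_ext => s; rewrite arc_polyE evalp_pull_down pencil_formE; congr evalp.
by apply/funext => I; rewrite -pencilE.
Qed.

Section LinearFamilies.
Context {V : lmodType K} (W0 W1 : V -> 'M[K]_(k, n)).
Context (l0 : forall i j, linepoly (fun u => W0 u i j)) (l1 : forall i j, linepoly (fun u => W1 u i j)).

Lemma linefam_pencil I : linefam (fun u => pencil (W0 u) (W1 u) I).
Proof.
apply: linefam_det => i j; under eq_fun do rewrite mxE.
exact: (linefamD (linefamC (l0 i (val I j))) (linefamM (linefam_cst 'X) (linefamC (l1 i (val I j))))).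
Qed.

Lemma linefam_pencil_wedge j IJ : linefam (fun u => pencil_wedge (W0 u) (W1 u) j IJ).
Proof.
exact: (linefamB (linefamM (linefam_pencil IJ.1) (linefam_cst (center j IJ.2)%:P))
  (linefamM (linefam_pencil IJ.2) (linefam_cst (center j IJ.1)%:P))).
Qed.

Lemma linefam_pencil_lift t : linefam (fun u => pencil_lift (W0 u) (W1 u) t).
Proof. by case: t => [I|[j IJ]] /=; [exact: linefam_pencil|exact: linefam_pencil_wedge]. Qed.

Lemma linefam_center_pencil_lift i t : linefam (fun u => center_pencil_lift i (W0 u) (W1 u) t).
Proof.
case: t => [I|[j IJ]] /=; first exact: linefam_pencil.
by case: (j == i); [apply: linefam_drop|]; exact: linefam_pencil_wedge.
Qed.
End LinearFamilies.

Lemma wedge_plucker_in W j IJ : wedge (plucker W) (center j) IJ != 0 -> Gr (plucker W).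
Proof.
move=> w0; suff [I xI] : exists I, plucker W I != 0 by exists W => //; exact: plucker_row_free xI.
apply: contrapT => /forallNP h; move/eqP: w0; apply.
have h0 I : plucker W I = 0 by have /negP/negPn/eqP := h I.
by rewrite /wedge !h0; ring.
Qed.

Lemma pencil_lift_at W0 W1 s : (fun t => (pencil_lift W0 W1 t).[s]) = lift_pt (plucker (W0 + s *: W1)).
Proof. by apply/funext => -[I|[j IJ]] /=; [exact: pencilE|exact: pencil_wedgeE]. Qed.

Lemma pencil_lift_open W0 W1 s IJ0 IJ1 :
  (pencil_wedge W0 W1 ord0 IJ0 * pencil_wedge W0 W1 ord_max IJ1).[s] != 0 -> X (fun t => (pencil_lift W0 W1 t).[s]).
Proof.
rewrite hornerM mulf_eq0 !pencil_wedgeE => /norP[w0 w1]; rewrite pencil_lift_at; apply/open_sub/lift_pt_open.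
  exact: wedge_plucker_in w0.
exact: regular_wedge w0 w1.
Qed.

Lemma pencil_wedge_center i (B : 'M[K]_k) W1 IJ : pencil_wedge (B *m M i) W1 i IJ = drop_poly 1 (pencil_wedge (B *m M i) W1 i IJ) * 'X.
Proof.
rewrite -{1}(poly_take_drop 1 (pencil_wedge _ _ _ _)) expr1 [take_poly _ _](_ : _ = 0) ?add0r //.
apply/polyP => j; rewrite coef_take_poly coef0 ltnS leqn0; case: eqP => // ->.
rewrite -horner_coef0 pencil_wedgeE scale0r addr0 plucker_mul wedgeZ -[plucker (M i)]/(center i).
by rewrite /wedge; ring.
Qed.

Lemma center_pencil_lift_open i B W1 IJ0 IJ1 s :
  (pencil_wedge (B *m M i) W1 i IJ0 * pencil_wedge (B *m M i) W1 (other i) IJ1).[s] != 0 ->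
  open_blowup (fun t => (center_pencil_lift i (B *m M i) W1 t).[s]).
Proof.
rewrite hornerM mulf_eq0 => /norP[w0 w1]; have s0 : s != 0.
  by apply: contra_neq w0 => ->; rewrite pencil_wedge_center hornerM hornerX mulr0.
rewrite !pencil_wedgeE in w0 w1.
have bE : blow_down (fun t => (center_pencil_lift i (B *m M i) W1 t).[s]) = plucker (B *m M i + s *: W1).
  by apply/funext => I; exact: pencilE.
split; rewrite bE.
- exact: wedge_plucker_in w0.
- move=> j h; have [ji|ji] := eqVneq j i; first by rewrite ji in h; move: w0; rewrite (h IJ0) eqxx.
  by move: ji w1; rewrite eq_sym => /neq_other <-; rewrite (h IJ1) eqxx.
move=> j; have [->|/negPf ji] := eqVneq j i.
  exists s^-1; first by rewrite invr_eq0.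
  move=> IJ; rewrite -pencil_wedgeE pencil_wedge_center hornerM hornerX /normal_dir /= eqxx.
  by rewrite mulrCA mulVf ?mulr1.
by exists 1; [exact: oner_neq0|move=> IJ; rewrite mul1r -pencil_wedgeE /normal_dir /= ji].
Qed.

Lemma poly_neq0_at (p : {poly K}) x : p.[x] != 0 -> p != 0.
Proof. by apply: contra_neq => ->; rewrite horner0. Qed.

(** The lifts of the pencils starting at the center fill the exceptional divisor, so that [ord_ge_family]
    applies; the frame of the center is only required to be nonsingular for a general member. *)
Lemma ord_ge_exceptional i d F m : mhomog gf d F -> ord_ge X (exceptional center i) (pull_down F) m ->
  forall B W1, 'X^m %| pencil_form F (B *m M i) W1.
Proof.
move=> Fd Fm B W1; rewrite -(arc_poly_center_pencil_lift i).
have [IJ1 w1] := wedge_centers i.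
pose V := ('M[K]_k * 'M[K]_(k, n))%type.
pose W0 (u : V) := u.1 *m M i.
have lW0 a b : linepoly (fun u : V => W0 u a b).
  apply: linepoly_mul; first by apply: linepoly_linear; exists (fun u => u.1).
  by move=> ? ?; exact: linepoly_cst.
have lW1 a b : linepoly (fun u : V => u.2 a b) by apply: linepoly_linear; exists (fun u => u.2).
apply: (ord_ge_family (V := V) (g := fun u => center_pencil_lift i (W0 u) u.2) _ _ (mhomog_pull_down Fd) _ _ Fm (B, W1)).
- exact: zclosed_stable X_closed.
- exact: zclosed_stable (exceptional_closed i).
- by move=> t; exact: linefam_center_pencil_lift.
move=> G GE; have [v /exceptional_point[a [b [A [a0 b0 A0 ->]]]] Gv] := not_idealP GE.
have [IJ0 w0] := wedge_secant_neq0 i 0 A0.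
pose u0 : V := (1%:M, A *m M (other i)).
have gE s : (fun t => (center_pencil_lift i (W0 u0) u0.2 t).[s]) = exc_arc i A s.
  have xE I : (pencil (W0 u0) u0.2 I).[s] = graph_pt i (s *: A) I.
    by rewrite pencilE /W0 /u0 /= mul1mx scalemxAl.
  apply/funext => -[I|[j IJ]] /=; first exact: xE.
  case: eqVneq => [->|ji].
    have [p pE] := choice (poly_secant i A).
    suff -> : drop_poly 1 (pencil_wedge (W0 u0) u0.2 i IJ) = p IJ.1 * (center i IJ.2)%:P - p IJ.2 * (center i IJ.1)%:P.
      by rewrite hornerD hornerN !hornerM !hornerC !pE.
    apply: (mulIf (negbT (polyX_eq0 K))); rewrite -pencil_wedge_center; apply: poly_ext => x.
    rewrite pencil_wedgeE [in RHS]hornerM hornerX hornerD hornerN !hornerM !hornerC !pE.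
    rewrite /W0 /u0 /= mul1mx scalemxAl [wedge _ _ _]wedge_graph_pt_secant /wedge mulrC //.
  by rewrite /pencil_wedge hornerD hornerN !hornerM !hornerC !xE.
pose q (u : V) := \det u.1 * (center_pencil_lift i (W0 u) u.2 (inr (i, IJ0)))`_0.
exists q, u0, (exc_scale i a 1 b); split.
- apply: linepolyM; last by have := linefam_center_pencil_lift lW0 lW1 i (inr (i, IJ0)) 0%N.
  by apply: linepoly_det => r s; apply: linepoly_linear; exists (fun u => u.1).
- by apply: exc_scale_neq0 => //; exact: oner_neq0.
- rewrite /q det1 mul1r -horner_coef0 -[_.[0]]/((fun t => (center_pencil_lift i (W0 u0) u0.2 t).[0]) _) gE.
  by rewrite /= eqxx.
- by rewrite gE -exc_point_scale scale1r.
move=> u; rewrite mulf_eq0 => /norP[du wu].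
have wu' : drop_poly 1 (pencil_wedge (W0 u) u.2 i IJ0) != 0.
  by move: wu; rewrite /= eqxx; apply: contra_neq => ->; rewrite coef0.
have r0 : pencil_wedge (W0 u) u.2 i IJ0 * pencil_wedge (W0 u) u.2 (other i) IJ1 != 0.
  rewrite mulf_neq0 //; first by rewrite pencil_wedge_center mulf_neq0 // polyX_eq0.
  apply: (@poly_neq0_at _ 0); rewrite pencil_wedgeE scale0r addr0 plucker_mul wedgeZ mulf_neq0 //.
have rX s : (pencil_wedge (W0 u) u.2 i IJ0 * pencil_wedge (W0 u) u.2 (other i) IJ1).[s] != 0 ->
  open_blowup (fun t => (center_pencil_lift i (W0 u) u.2 t).[s]) by exact: center_pencil_lift_open.
have b0E : blow_down (fun t => (center_pencil_lift i (W0 u) u.2 t).[0]) = (fun I => \det u.1 * center i I).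
  by apply/funext => I; rewrite /blow_down /= pencilE scale0r addr0 plucker_mul.
split; last by exists (pencil_wedge (W0 u) u.2 i IJ0 * pencil_wedge (W0 u) u.2 (other i) IJ1) => // x /rX /open_sub.
split; last by rewrite b0E => IJ; rewrite /wedge; ring.
apply: arc_limit r0 rX _ => -[j|].
  have [->|ji] := eqVneq j i.
    by exists (inr (i, IJ0)) => //; rewrite horner_coef0.
  exists (inr (j, IJ1)) => //=; rewrite (negPf ji) pencil_wedgeE scale0r addr0 plucker_mul wedgeZ.
  by move: ji; rewrite eq_sym => /neq_other->; rewrite mulf_neq0.
have [I pI] := center_neq0 i; exists (inl I) => //=.
by rewrite pencilE scale0r addr0 plucker_mul mulf_neq0.
Qed.

(** The pencils that start on the Schubert divisor, parametrized by singular matrices. *)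
Lemma ord_ge_strict_schubert_div i d F m x0 : mhomog gf d F -> schubert_div i x0 -> regular x0 ->
  ord_ge X (strict (schubert_div i)) (pull_down F) m ->
  forall W0 W1, \det (W0 *m U i) = 0 -> 'X^m %| pencil_form F W0 W1.
Proof.
move=> Fd x0D x0r Fm W0 W1 /schubert_div_frameP[u ->]; rewrite -arc_poly_pencil_lift.
have Dc : zclosed gf (schubert_div i) by exact: zclosed_schubert_div.
have DG : schubert_div i `<=` Gr by move=> x [].
pose V := ('M[K]_k * 'M[K]_k * 'M[K]_k * 'M[K]_(k, n))%type.
have lW0 a b : linepoly (fun u : V => schubert_div_frame i u.1 a b).
  by move=> [x x'] [y y']; have [p pE] := linepoly_schubert_div_frame i a b x y; exists p.
have lW1 a b : linepoly (fun u : V => u.2 a b) by apply: linepoly_linear; exists (fun u => u.2).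
apply: (ord_ge_family (V := V) (g := fun u => pencil_lift (schubert_div_frame i u.1) u.2) _ _ (mhomog_pull_down Fd) _ _ Fm (u, W1)).
- exact: zclosed_stable X_closed.
- apply: zclosed_stable; exact: zclosed_closure.
- by move=> t; exact: linefam_pencil_lift.
move=> G GE.
have [v vb Gv] : exists2 v, strict_base (schubert_div i) v & evalp G v != 0.
  apply: not_idealP => h; apply: GE; apply: ideal_zclosure h.
  exact: strict_base_stable.
have [l [l0 vE]] := strict_base_lift_pt vb; have [_ [[W Wf xE] +] vr] := vb.
rewrite xE lform_plucker => /schubert_div_frameP[u0 WE].
have [IJ0 w0] := not_same_wedge (vr ord0); have [IJ1 w1] := not_same_wedge (vr ord_max).
pose w (u : V) j IJ := pencil_wedge (schubert_div_frame i u.1) u.2 j IJ.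
have wE (u1 : V) j IJ : (w u1 j IJ)`_0 = wedge (plucker (schubert_div_frame i u1.1)) (center j) IJ.
  by rewrite -horner_coef0 pencil_wedgeE scale0r addr0.
exists (fun u => (w u ord0 IJ0)`_0 * (w u ord_max IJ1)`_0), (u0, 0), l; split=> //.
- by apply: linepolyM; [exact: (linefam_pencil_wedge lW0 lW1 ord0 IJ0 0%N)|exact: (linefam_pencil_wedge lW0 lW1 ord_max IJ1 0%N)].
- by rewrite !wE -WE -xE mulf_neq0.
- by rewrite pencil_lift_at scale0r addr0 /= -WE -xE -vE.
move=> u1 q1; have := q1; rewrite mulf_eq0 !wE => /norP[q10 q11]; split.
  rewrite pencil_lift_at scale0r addr0; apply: (sub_zclosure (@strict_base_proj (schubert_div i))).
  apply: lift_pt_base => //; last exact: regular_wedge q10 q11.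
  by split; [exact: wedge_plucker_in q10|rewrite lform_plucker det_schubert_div_frame].
exists (w u1 ord0 IJ0 * w u1 ord_max IJ1); last by move=> s; exact: pencil_lift_open.
by apply: (@poly_neq0_at _ 0); rewrite hornerM !horner_coef0.
Qed.

(** A polynomial whose reversal in degree N is divisible by the m-th power of the variable has degree at most N - m. *)
Lemma rev_degree (P R : {poly K}) N m : (forall s, s != 0 -> P.[s] = s ^+ N * R.[s^-1]) ->
  'X^m %| R -> P != 0 -> ((size P).-1 + m <= N)%N.
Proof.
move=> PR /Pdiv.Field.dvdpP[R' RE] P0.
pose d := (size R').-1; pose R1 := \sum_(j < size R') R'`_j *: 'X^(d - j).
have e : P * 'X^(d + m) = 'X^N * R1.
  apply: poly_ext_neq0 => s s0; rewrite !hornerM !hornerXn PR // RE hornerM hornerXn.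
  rewrite exprD -!mulrA; congr (_ * _); rewrite [s ^+ d * _]mulrC mulrA mulrA exprVn mulfVK ?expf_neq0 //.
  rewrite horner_coef horner_sum mulr_suml; apply: eq_bigr => j _.
  rewrite hornerZ hornerXn exprVn -mulrA; congr (_ * _).
  have jd : (j <= d)%N by rewrite /d -ltnS (leq_trans (ltn_ord j)) // leqSpred.
  by rewrite -{1}(subnK jd) exprD mulrCA mulVf ?mulr1 // expf_neq0.
have R10 : R1 != 0 by apply: contra_neq P0 => R10; apply/eqP; move/eqP: e; rewrite R10 mulr0 mulf_eq0 expf_eq0 polyX_eq0 andbF orbF.
have sR1 : (size R1 <= d.+1)%N.
  apply: (leq_trans (size_sum _ _ _)); apply/bigmax_leqP => j _.
  by apply: leq_trans (size_scale_leq _ _) _; rewrite size_polyXn ltnS leq_subr.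
have e1 : size (P * 'X^(d + m)) = (d + m + size P)%N by rewrite size_mulXn.
have e2 : size ('X^N * R1) = (N + size R1)%N by rewrite mulrC size_mulXn.
move: P0; rewrite -size_poly_gt0 => P0; move: e1; rewrite e e2.
by move: (size P) (size R1) P0 sR1; lia.
Qed.

Lemma pencil_form_rev d F W0 W1 s : mhomog gf d F -> s != 0 ->
  (pencil_form F W0 W1).[s] = s ^+ (k * d tt) * (pencil_form F W1 W0).[s^-1].
Proof.
move=> Fd s0; rewrite !pencil_formE.
have -> : W0 + s *: W1 = s%:M *m (W1 + s^-1 *: W0).
  by rewrite mul_scalar_mx scalerDr scalerA divff // scale1r addrC.
rewrite plucker_mul det_scalar.
have -> : (fun I => s ^+ k * plucker (W1 + s^-1 *: W0) I) = scale gf (fun=> s ^+ k) (plucker (W1 + s^-1 *: W0)) by [].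
by rewrite (evalp_scale _ _ Fd) (big_pred1 tt) => [|[]//]; rewrite exprM.
Qed.

Lemma pencil_form_degree d F W0 W1 m : mhomog gf d F -> 'X^m %| pencil_form F W1 W0 -> pencil_form F W0 W1 != 0 ->
  ((size (pencil_form F W0 W1)).-1 + m <= k * d tt)%N.
Proof.
by move=> Fd; apply: rev_degree => s s0; exact: pencil_form_rev.
Qed.

Lemma dvd_Xn_size (p : {poly K}) m : 'X^m %| p -> p != 0 -> (m <= (size p).-1)%N.
Proof.
move=> h p0; have := dvdp_leq p0 h; rewrite size_polyXn => h'.
by rewrite -ltnS prednK // size_poly_gt0.
Qed.

(** A pencil joining a general point of Y to a point where F is nonzero: the order along Y is at most the degree on
    the pencil. *)
Lemma ord_ge_strict Y d F m : mhomog gf d F -> ~ ideal Gr F -> irr_closed gf Y ->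
  ord_ge X (strict Y) (pull_down F) m -> (m <= k * d tt)%N.
Proof.
move=> Fd FG Yi /ord_ge_arc[G GP arc]; have [Yc _ _] := Yi.
have [v vb Gv] : exists2 v, strict_base Y v & evalp G v != 0.
  apply: not_idealP => h; apply: GP; apply: ideal_zclosure h; exact: strict_base_stable.
have [l [l0 vE]] := strict_base_lift_pt vb; have [Xv Yv vr] := vb.
have [W0 _ xE] := blow_down_in Xv.
have [_ [W' _ ->] FW'] := not_idealP FG.
have [IJ0 w0] := not_same_wedge (vr ord0); have [IJ1 w1] := not_same_wedge (vr ord_max).
pose W1 := W' - W0.
have f0 : pencil_form F W0 W1 != 0.
  by apply: (@poly_neq0_at _ 1); rewrite pencil_formE scale1r addrC subrK.
have gE s : (fun t => ((l (bf t))%:P * pencil_lift W0 W1 t).[s]) = scale bf l (fun t => (pencil_lift W0 W1 t).[s]).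
  by apply/funext => t; rewrite hornerM hornerC.
have g0 : (fun t => ((l (bf t))%:P * pencil_lift W0 W1 t).[0]) = v.
  by rewrite gE pencil_lift_at scale0r addr0 -xE -vE.
have F'd := mhomog_pull_down Fd.
have : 'X^m %| (\prod_s l s ^+ (if s is None then d tt else 0))%:P * pencil_form F W0 W1.
  apply: (arc (fun t => (l (bf t))%:P * pencil_lift W0 W1 t) _ (pencil_wedge W0 W1 ord0 IJ0 * pencil_wedge W0 W1 ord_max IJ1)).
  - by apply: (@poly_neq0_at _ 0); rewrite hornerM !pencil_wedgeE scale0r addr0 -xE mulf_neq0.
  - move=> s /pencil_lift_open h; rewrite gE; exact: (zclosed_stable X_closed).
  - by rewrite g0; apply: (sub_zclosure (@strict_base_proj Y)).
  - by rewrite g0.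
  - by move=> s; rewrite gE (evalp_scale _ _ F'd) hornerM hornerC -arc_poly_pencil_lift arc_polyE.
rewrite mul_polyC dvdpZr; last exact: scale_neq0.
move=> /dvd_Xn_size/(_ f0)/leq_trans; apply.
by rewrite -[X in (X <= _)%N]addn0; apply: pencil_form_degree => //; rewrite expr0 dvd1p.
Qed.

(** A pencil that joins the two centers and on which F is not zero: every subspace W is a member of one. The
    restriction of F has a zero of order m0 at s = 0, and of order m1 at infinity. *)
Lemma two_centers d F m0 m1 : mhomog gf d F -> ~ ideal Gr F ->
  ord_ge X (exceptional center ord0) (pull_down F) m0 ->
  ord_ge X (exceptional center ord_max) (pull_down F) m1 -> (m0 + m1 <= k * d tt)%N.
Proof.
move=> Fd FG h0 h1; have [_ [W _ ->] FW] := not_idealP FG.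
have WE := decomp ord0 W; rewrite other0 in WE.
set W0 := _ *m M ord0 in WE; set W1 := _ *m M ord_max in WE.
have f0 : pencil_form F W0 W1 != 0 by apply: (@poly_neq0_at _ 1); rewrite pencil_formE scale1r -WE.
apply: leq_trans (pencil_form_degree Fd (ord_ge_exceptional Fd h1 _ W0) f0).
by rewrite leq_add2r; exact: dvd_Xn_size (ord_ge_exceptional Fd h0 _ W1) f0.
Qed.

Lemma distinct_units N : exists s : seq K, [/\ size s = N, uniq s & 0 \notin s].
Proof.
elim: N => [|N [s [sN us s0]]]; first by exists [::].
have : 'X * \prod_(x <- s) ('X - x%:P) != 0 :> {poly K}.
  by rewrite mulf_neq0 ?polyX_eq0 // prodf_seq_neq0; apply/allP => x _; rewrite polyXsubC_eq0.
move=> /closed_nonrootP[x]; rewrite rootM root_prod_XsubC rootX => /norP[x0 xs].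
by exists (x :: s); rewrite /= sN xs us in_cons negb_or eq_sym x0.
Qed.

Lemma dvd_prod_XsubC (s : seq K) a (p : {poly K}) : uniq s ->
  (forall x, x \in s -> ('X - x%:P) ^+ a %| p) -> \prod_(x <- s) ('X - x%:P) ^+ a %| p.
Proof.
elim: s => [|x s IH] /=; first by rewrite big_nil dvd1p.
move=> /andP[xs us] h; rewrite big_cons Gauss_dvdp.
  by rewrite h ?mem_head // IH // => y ys; apply: h; rewrite in_cons ys orbT.
rewrite prodrXl coprimep_expl // coprimep_expr // coprimep_sym coprimep_XsubC.
by rewrite root_prod_XsubC.
Qed.

Lemma pencil_form_shift F W0 W1 x : pencil_form F (W0 + x *: W1) W1 = pencil_form F W0 W1 \Po ('X + x%:P).
Proof.
apply: poly_ext => s; rewrite horner_comp hornerD hornerX hornerC !pencil_formE.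
by rewrite -addrA -scalerDl [x + s]addrC.
Qed.

(** The determinant of the product of W' + s W1 and U i is det (W' U i) times the product of the 1 - s / s_j,
    for distinct nonzero s_j, by the choice of W1: the pencil meets the Schubert divisor at the k points s_j.
    It passes through the i-th center at infinity. *)
Lemma center_schubert i d F a m x0 : mhomog gf d F -> ~ ideal Gr F -> schubert_div i x0 -> regular x0 ->
  ord_ge X (strict (schubert_div i)) (pull_down F) a ->
  ord_ge X (exceptional center i) (pull_down F) m -> (k * a + m <= k * d tt)%N.
Proof.
move=> Fd FG x0D x0r ha hm; have [_ [W _ ->] FW] := not_idealP FG.
have [||||W' [FW' BW']] := @linepoly_generic _ _ (fun W => evalp F (plucker W)) (fun W => \det (W *m U i)).
- by apply: linepoly_evalp => I; exact: linepoly_plucker.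
- apply: linepoly_det; apply: linepoly_mul; last by move=> ? ?; exact: linepoly_cst.
  by apply: linepoly_linear; exists id.
- by exists W.
- by exists (M i); rewrite MUi det1 oner_neq0.
have [s [sk us s0]] := distinct_units k.
(* the matrix 1 + x D is singular exactly when x is one of the s_j *)
pose D : 'M[K]_k := diag_mx (\row_j (- (s`_j)^-1)).
pose W1 := (W' *m U i) *m D *m M i.
have f0 : pencil_form F W' W1 != 0 by apply: (@poly_neq0_at _ 0); rewrite pencil_formE scale0r addr0.
have h1 := pencil_form_degree Fd (ord_ge_exceptional Fd hm _ W') f0.
have dvd x : x \in s -> ('X - x%:P) ^+ a %| pencil_form F W' W1.
  move=> xs; have j := xs; move: (j); rewrite -index_mem sk => jk.
  have det0' : \det ((W' + x *: W1) *m U i) = 0.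
    have -> : (W' + x *: W1) *m U i = (W' *m U i) *m (1%:M + x *: D).
      rewrite mulmxDl mulmxDr mulmx1 -scalemxAl -scalemxAr; congr (_ + _ *: _).
      by rewrite /W1 -!mulmxA MUi mulmx1.
    rewrite det_mulmx; have -> : 1%:M + x *: D = diag_mx (\row_j (1 - x / s`_j)).
      apply/matrixP => r c; rewrite !mxE; case: eqP => _; last by rewrite !mulr0n mulr0 addr0.
      by rewrite !mulr1n mulrN.
    rewrite det_diag (bigD1 (Ordinal jk)) //= mxE nth_index // divff ?subrr ?mul0r ?mulr0 //.
    by apply: contraNneq s0 => <-.
  have := ord_ge_strict_schubert_div Fd x0D x0r ha W1 det0'.
  rewrite pencil_form_shift => /Pdiv.Field.dvdpP[q qE].
  apply/Pdiv.Field.dvdpP; exists (q \Po ('X - x%:P)).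
  have := congr1 (fun p => p \Po ('X - x%:P)) qE.
  rewrite /= -comp_polyA comp_polyD comp_polyX comp_polyC subrK comp_polyXr => ->.
  by rewrite comp_polyM comp_Xn_poly.
have := dvdp_leq f0 (dvd_prod_XsubC us dvd).
rewrite size_prod_seq; last by move=> x _; rewrite expf_neq0 // polyXsubC_eq0.
under eq_bigr do rewrite size_exp_XsubC.
rewrite big_const_seq count_predT sk iter_addn_0.
by move: h1 k0; case: (size (pencil_form F W' W1)) => [|z] /=; nia.
Qed.

(** * Prime divisors and divisors of forms *)

Lemma lform_same_center_neq0 i (x : J -> K) : Gr x -> same_point x (center i) -> lform (U i) x != 0.
Proof.
by move=> xG /(same_pointP xG)[a a0 ->]; rewrite lformZ lform_center mulr1.
Qed.

(** As k > 1, a singular matrix of rank k - 1 is not zero: its graph is on the divisor and is not a center. *)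
Lemma schubert_div_regular i : exists2 x, schubert_div i x & regular x.
Proof.
exists (graph_pt (other i) corank1).
  by split; [exact: graph_pt_in|rewrite -{1}[i]otherK lform_graph_pt' det_corank1].
exact: (regular_graph_pt corank1_neq0).
Qed.

(** Otherwise Y would be a center, which is not maximal since it lies on a Schubert divisor that has other points. *)
Lemma prime_divisor_Gr_regular Y : prime_divisor gf Gr Y -> exists2 x, Y x & regular x.
Proof.
move=> [Yi [YG GY] Ymax]; apply: contrapT => h.
have [|i Yi'] := irr_over_centers id gf_id Yi; first by move=> x Yx xr; apply: h; exists x.
have YD : Y `<=` schubert_div (other i).
  move=> x Yx; split; first exact: YG.
  by have [a _ ->] := same_pointP (YG _ Yx) (Yi' _ Yx); rewrite lformZ -{2}[i]otherK lform_other_center mulr0.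
have [Di [DG GD] _] := schubert_div_prime (other i).
have [e|e] := Ymax _ Di YD DG; last by apply: GD; rewrite e.
by have [x Dx /(_ i)] := schubert_div_regular (other i); apply; apply: Yi'; rewrite -e.
Qed.

Lemma strict_prime Y : prime_divisor gf Gr Y -> prime_divisor bf X (strict Y).
Proof.
by move=> Yp; have [x Yx xr] := prime_divisor_Gr_regular Yp; exact: (strict_prime_divisor Yp Yx xr).
Qed.

Lemma prime_exc_or_strict P : prime_divisor bf X P ->
  (exists i, P = exc i) \/ (exists2 Y, prime_divisor gf Gr Y & P = strict Y).
Proof.
move=> Pd; have [Pi [PX XP] Pmax] := Pd; have [Pc [v0 Pv0] Pp] := (irr_closedP bf P).1 Pi.
have [[v Pv vr]|h] := pselect (exists2 v, P v & regular (blow_down v)).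
  by right; have [Y [Yd _ e]] := prime_divisor_strict Pd Pv vr; exists Y.
left; have [|i Pi'] := irr_over_centers inl bf_inl Pi; first by move=> v Pv vr; apply: h; exists v.
exists i; have [Ei [EX XE] _] := exceptional_prime i.
have [|->//|e] := Pmax _ Ei _ EX; last by case: XE; rewrite e.
by move=> v Pv; split; [exact: PX|exact: Pi'].
Qed.

Lemma ideal_strict Y d F : prime_divisor gf Gr Y -> mhomog gf d F ->
  ideal (strict Y) (pull_down F) <-> ideal Y F.
Proof.
move=> Yd Fd; have [x0 Yx0 x0r] := prime_divisor_Gr_regular Yd; have [Yi [YG _] _] := Yd.
have [Yc _ _] := Yi; split=> h.
  apply: (irr_regular id gf_id Yi Yx0 x0r Fd) => x Yx xr.
  have := h (lift_pt x); rewrite evalp_pull_down; apply.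
  by exact: strict_lift_pt.
by move=> v /(strict_down Yc) /h; rewrite evalp_pull_down.
Qed.

Lemma strict_inj Y Y' : prime_divisor gf Gr Y -> prime_divisor gf Gr Y' -> strict Y = strict Y' -> Y = Y'.
Proof.
move=> Yd Y'd e; have [x0 Yx0 x0r] := prime_divisor_Gr_regular Yd; have [Yi [YG _] Ymax] := Yd.
have [Y'i [Y'G GY'] _] := Y'd; have [Y'c _ _] := Y'i.
have YY' : Y `<=` Y' by apply: (strict_sub_inv Yi YG Yx0 x0r Y'c); rewrite e.
by have [->|e'] := Ymax _ Y'i YY' Y'G => //; case: GY'; rewrite e'.
Qed.

Lemma strict_neq_exc Y i : prime_divisor gf Gr Y -> strict Y <> exc i.
Proof.
move=> Yd e; have [x0 Yx0 x0r] := prime_divisor_Gr_regular Yd; have [Yi [YG _] _] := Yd.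
have : strict Y (lift_pt x0) by exact: strict_lift_pt.
by rewrite e => -[_]; exact: x0r.
Qed.

Lemma exc_inj i j : exc i = exc j -> i = j.
Proof.
move=> e; have [//|ij] := eqVneq i j; exfalso.
have [[_ [v Ev] _] _ _] := exceptional_prime i.
have [vX vi] := Ev; have : exc j v by rewrite -e.
rewrite (neq_other ij) => -[_]; exact: (not_same_both (blow_down_in vX) vi).
Qed.

(** The powers of the equation of a Schubert divisor have divisors of all the degrees e that are needed for
    comparison. *)
Definition lform_pow i e : mpoly #|J| K := lpoly id (U i) ^+ e.

Lemma mhomog_lform_pow i e : mhomog gf (fun=> e) (lform_pow i e).
Proof.
by apply: (eq_mhomog (mhomog_exp e (@mhomog_lpoly1 _ _ _ (U i)))) => s; rewrite muln1.
Qed.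

Lemma evalp_lform_pow i e x : evalp (lform_pow i e) x = lform (U i) x ^+ e.
Proof. by rewrite evalpXn evalp_lpoly. Qed.

Lemma not_ideal_lform_pow i e : ~ ideal Gr (lform_pow i e).
Proof.
move=> /(_ _ (center_in i)); rewrite evalp_lform_pow lform_center expr1n; apply/eqP; exact: oner_neq0.
Qed.

Lemma nonempty_prime (P : set (T -> K)) : prime_divisor bf X P -> P !=set0.
Proof. by move=> [[]]. Qed.

(** The upper bound is reached on a pencil of diagonal matrices on which the form is s^e. *)
Lemma ord_strict_lform_pow i e : ord X (strict (schubert_div i)) (pull_down (lform_pow i e)) = e.
Proof.
have Dd := schubert_div_prime i; have Pd := strict_prime Dd; have P0 := nonempty_prime Pd.
have [x0 Dx0 x0r] := schubert_div_regular i.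
apply: ord_eq => //.
  apply: (@ord_ge_local _ _ _ _ _ 1 1 (pull_down (lform_pow i 1))).
  - by case: P0 => v Pv /(_ _ Pv)/eqP; rewrite evalp1 oner_eq0.
  - apply: (ideal_strict Dd (@mhomog_lform_pow i 1)).2 => x [_ x0']; rewrite evalp_lform_pow x0' //.
  - by move=> v _; rewrite evalpB !evalpM evalpXn evalp1 !evalp_pull_down !evalp_lform_pow expr1 subrr.
move=> m /(ord_ge_strict_schubert_div (@mhomog_lform_pow i e) Dx0 x0r).
(* the product of the pencil and U i is diagonal, with entries 1 except for one that is s *)
pose W0 : 'M[K]_(k, n) := corank1 *m M i + 1%:M *m M (other i).
pose W1 : 'M[K]_(k, n) := (1%:M - corank1) *m M i.
move=> /(_ W0 W1); rewrite mulU det_corank1 // => /(_ erefl).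
have -> : pencil_form (lform_pow i e) W0 W1 = 'X^e.
  apply: poly_ext => s; rewrite pencil_formE evalp_lform_pow lform_plucker hornerXn; congr (_ ^+ _).
  have -> : (W0 + s *: W1) *m U i = corank1 + s *: (1%:M - corank1).
    rewrite mulmxDl -scalemxAl mulU; congr (_ + _ *: _).
    by rewrite /W1 -mulmxA MUi mulmx1.
  have -> : corank1 + s *: (1%:M - corank1) = diag_mx (\row_(j < k) if (j < k.-1)%N then 1 else s) :> 'M[K]_k.
    apply/matrixP => r c; rewrite !mxE -[nat_of_ord r == c]/(r == c).
    case: eqVneq => [->|_] /=; last by rewrite subrr mulr0 addr0.
    by case: ifP => _; rewrite ?subrr ?subr0 ?mulr0 ?mulr1 ?addr0 ?add0r mulr1n.
  have kk : (k.-1 < k)%N by rewrite prednK.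
  rewrite det_diag (bigD1 (Ordinal kk)) //= mxE /= ltnn big1 ?mulr1 // => j jk.
  rewrite mxE (_ : (j < k.-1)%N) // ltn_neqAle -ltnS prednK // ltn_ord andbT.
  by move: jk; rewrite -val_eqE.
by move=> h; have := dvd_Xn_size h (monic_neq0 (monicXn _ _)); rewrite size_polyXn.
Qed.

(** In the chart at the center the form is det A, whose order at A = 0 is k. On the blow-up this reads
    y Z_t0^k det Y = Y_t0^k y det Z, where Y_t0 is an equation of the exceptional divisor, because the matrices Y
    and Z are proportional. The upper bound is reached on the pencil joining the two centers. *)
Lemma ord_exc_lform_pow i e : ord X (exc (other i)) (pull_down (lform_pow i e)) = (k * e)%N.
Proof.
set j := other i; have Ed := exceptional_prime j; have E0 := nonempty_prime Ed.
apply: ord_eq => //.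
  pose yj : mpoly #|T| K := pull_down (lpoly id (U j)).
  pose Zd : mpoly #|T| K := \det (\matrix_(r, s) YZpoly j (r, s)).
  apply: (@ord_ge_local _ _ _ _ _ ((YZpoly j t0 ^+ k * yj ^+ k) ^+ e) ((yj * Zd) ^+ e) (Ypoly inl j t0)).
  - move=> /(_ (exc_point j 1 1 1%:M)); rewrite evalpXn evalpM !evalpXn evalp_YZpoly evalp_pull_down evalp_lpoly.
    rewrite Ycoord_zcoord_exc_point mxE eqxx expr1n mul1r.
    have -> : (fun I => blow_down (exc_point j 1 1 1%:M) (id I)) = (fun I => 1 * center j I) by [].
    rewrite lformZ lform_center mulr1 !expr1n => h; have /eqP := oner_neq0 K; apply.
    by apply: h; apply: exc_point_in; rewrite ?oner_neq0 ?id_mx_neq0.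
  - move=> v /exceptional_point[a [b [A [_ _ _ ->]]]]; rewrite evalp_Ypoly.
    by rewrite [Ycoord _ _]YcoordZ Ycoord_center scaler0 mxE.
  - move=> v Xv; rewrite evalpB !evalpM !evalpXn !evalpM !evalpXn evalp_YZpoly evalp_Ypoly !evalp_pull_down evalp_lform_pow evalp_lpoly evalp_det.
    apply/eqP; rewrite subr_eq0; apply/eqP.
    set x := blow_down v; rewrite -![fun I => _]/x.
    rewrite exprM -!exprMn; congr (_ ^+ _).
    have -> : (\matrix_(r, s) evalp ((\matrix_(r, s) YZpoly j (r, s)) r s) v) = Ycoord j (zcoord j v).
      by apply/matrixP => r s; rewrite [LHS]mxE [in LHS]mxE evalp_YZpoly.
    have e1 : Ycoord j (zcoord j v) t0.1 t0.2 ^+ k * \det (Ycoord j x) = Ycoord j x t0.1 t0.2 ^+ k * \det (Ycoord j (zcoord j v)).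
      rewrite -!detZ; congr (\det _); apply/matrixP => r s; rewrite [LHS]mxE [RHS]mxE.
      rewrite mulrC [RHS](X_Ycoord j t0 (r, s) Xv) //.
    have e2 : lform (U j) x * \det (Ycoord j x) = lform (U j) x ^+ k * lform (U i) x.
      have [W _ xE] := blow_down_in Xv; rewrite /x xE !lform_plucker.
      rewrite /Ycoord recon_plucker -mulmxA det_mulmx mulrA -det_mulmx mul_mx_adj det_scalar.
      by rewrite /j otherK.
    by rewrite exprMn -mulrA -e2 mulrCA e1; ring.
move=> m /(ord_ge_exceptional (@mhomog_lform_pow i e))/(_ 1%:M (M i)).
have -> : pencil_form (lform_pow i e) (1%:M *m M j) (M i) = 'X^(k * e).
  apply: poly_ext => s; rewrite pencil_formE evalp_lform_pow lform_plucker hornerXn exprM; congr (_ ^+ _).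
  by rewrite mul1mx addrC -mul_scalar_mx -[M j]mul1mx /j mulU det_scalar.
by move=> h; have := dvd_Xn_size h (monic_neq0 (monicXn _ _)); rewrite size_polyXn.
Qed.

Lemma ord_other_lform_pow i e P : prime_divisor bf X P -> P <> exc (other i) -> P <> strict (schubert_div i) ->
  ord X P (pull_down (lform_pow i e)) = 0%N.
Proof.
move=> Pd PE PD; have [Pi [PX _] _] := Pd.
apply: (ord_notin Pi PX (mhomog_pull_down (@mhomog_lform_pow i e))) => hP.
have [[j Pj]|[Y Yd PY]] := prime_exc_or_strict Pd.
  have [ji|/neq_other ij] := eqVneq i j; last by apply: PE; rewrite Pj ij.
  have [v Pv] := nonempty_prime Pd; have := hP v Pv; rewrite evalp_pull_down evalp_lform_pow => /eqP.
  move: Pv; rewrite Pj -ji => -[vX vp].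
  by rewrite expf_eq0 (negPf (lform_same_center_neq0 (blow_down_in vX) vp)) andbF.
apply: PD; rewrite PY; congr strict_transform.
have [Yi [YG _] Ymax] := Yd.
have YD : Y `<=` schubert_div i.
  move=> x Yx; split; first exact: YG.
  have := hP; rewrite PY => /(ideal_strict Yd (@mhomog_lform_pow i e))/(_ x Yx)/eqP.
  by rewrite evalp_lform_pow expf_eq0 => /andP[_ /eqP].
have [Di [DG GD] _] := schubert_div_prime i.
by have [->|e'] := Ymax _ Di YD DG => //; case: GD; rewrite e'.
Qed.

Lemma not_ideal_lform i Y : prime_divisor gf Gr Y -> Y <> schubert_div i -> ~ ideal Y (lpoly id (U i)).
Proof.
move=> [Yi [YG _] Ymax] YD h; apply: YD.
have [Di [DG GD] _] := schubert_div_prime i.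
have [|->|e'] := Ymax _ Di _ DG => //; last by case: GD; rewrite e'.
by move=> x Yx; split; [exact: YG|have := h _ Yx; rewrite evalp_lpoly].
Qed.

(** The equation of Y in the affine chart, homogenized. It may vanish on the complement of the chart, which is a
    Schubert divisor. *)
Lemma prime_divisor_equation i Y : prime_divisor gf Gr Y -> Y <> schubert_div i ->
  exists d F, [/\ mhomog gf d F, ~ ideal Gr F, ideal Y F &
    forall Y', prime_divisor gf Gr Y' -> ideal Y' F -> Y' = Y \/ Y' = schubert_div i].
Proof.
move=> Yd YD; have Girr := Gr_irr; have ch := graph_chart i.
have [g [g0 gT YE gE]] := prime_divisor_chart Girr ch Yd (not_ideal_lform Yd YD).
have [d [F [Fd FE]]] := chart_coord ch g; exists d, F; split=> //.
- move=> h; apply: gT; apply/seteqP; split=> // a _; rewrite /vanishing /= -FE.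
  by apply: h; exact: graph_pt_in.
- by rewrite YE; refine (ideal_homog_zclosure Fd _) => _ [a ga <-]; rewrite FE; exact: ga.
move=> Y' Y'd FY'; have [|Y'D] := pselect (Y' = schubert_div i); [by right|left].
have [g' [_ _ Y'E g'E]] := prime_divisor_chart Girr ch Y'd (not_ideal_lform Y'd Y'D).
have Y'Y : Y' `<=` Y.
  rewrite Y'E YE; apply: zclosure_mono => _ [a ga <-]; exists a => //.
  rewrite /vanishing /= -FE; apply: FY'.
  by have : ((fun a => graph_pt i (frame_mx a)) @^-1` Y') a by rewrite g'E.
have [Yi [YG GY] _] := Yd; have [_ _ Y'max] := Y'd.
by have [->|e] := Y'max _ Yi Y'Y YG => //; case: GY; rewrite e.
Qed.

Lemma ord_other_form P d F : prime_divisor bf X P -> mhomog gf d F ->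
  (forall Y, prime_divisor gf Gr Y -> P = strict Y -> ~ ideal Y F) ->
  (forall i, P <> exc i) -> ord X P (pull_down F) = 0%N.
Proof.
move=> Pd Fd hY hE; have [Pi [PX _] _] := Pd.
have [[j Pj]|[Y Yd PY]] := prime_exc_or_strict Pd; first by case: (hE j).
apply: (ord_notin Pi PX (mhomog_pull_down Fd)); rewrite PY => /(ideal_strict Yd Fd).
exact: hY.
Qed.

(** The form F is the equation of Y in the complement of a Schubert divisor. *)
Lemma equation_orders Y : prime_divisor gf Gr Y -> Y <> schubert_div ord0 ->
  exists e F, [/\ mhomog gf (fun=> e) F, ~ ideal Gr F &
    exists c a m0 m1 : nat, [/\ (0 < c)%N, (m0 + m1 <= k * e)%N, (k * a + m0 <= k * e)%N,
      [/\ ord X (strict Y) (pull_down F) = c, ord X (strict (schubert_div ord0)) (pull_down F) = a,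
          ord X (exc ord0) (pull_down F) = m0 & ord X (exc ord_max) (pull_down F) = m1] &
      forall P, prime_divisor bf X P -> P <> strict Y -> P <> strict (schubert_div ord0) ->
        (forall i, P <> exc i) -> ord X P (pull_down F) = 0%N]].
Proof.
move=> Yd YD; have [d [F [Fd FG FY FY']]] := prime_divisor_equation Yd YD.
have Fd' : mhomog gf (fun=> d tt) F by apply: (eq_mhomog Fd) => -[].
exists (d tt), F; split=> //.
have Yi : irr_closed gf Y by case: Yd.
have Dd := schubert_div_prime ord0; have Di : irr_closed gf (schubert_div ord0) by case: Dd.
have [x0 Dx0 x0r] := schubert_div_regular ord0.
have E0 i := nonempty_prime (exceptional_prime i).
have b0 m : ord_ge X (exc ord0) (pull_down F) m -> (m <= k * d tt)%N.
  by move=> h; rewrite -[m]addn0; apply: (two_centers Fd' FG h); exact: ord_ge0.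
have b1 m : ord_ge X (exc ord_max) (pull_down F) m -> (m <= k * d tt)%N.
  by move=> h; rewrite -[m]add0n; apply: (two_centers Fd' FG _ h); exact: ord_ge0.
have [g0 _] := ord_bounded (E0 ord0) b0; have [g1 _] := ord_bounded (E0 ord_max) b1.
have [ga _] := ord_bounded (nonempty_prime (strict_prime Dd)) (fun m => ord_ge_strict Fd' FG Di (m := m)).
have [gc ngc] := ord_bounded (nonempty_prime (strict_prime Yd)) (fun m => ord_ge_strict Fd' FG Yi (m := m)).
exists (ord X (strict Y) (pull_down F)), (ord X (strict (schubert_div ord0)) (pull_down F)),
  (ord X (exc ord0) (pull_down F)), (ord X (exc ord_max) (pull_down F)); split=> //.
- rewrite lt0n; apply/eqP => c0; apply: ngc; rewrite c0.
  apply: (@ord_ge_local _ _ _ _ _ 1 1 (pull_down F)).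
  + by case: (nonempty_prime (strict_prime Yd)) => v Pv /(_ _ Pv)/eqP; rewrite evalp1 oner_eq0.
  + exact: (ideal_strict Yd Fd).2.
  + by move=> v _; rewrite expr1 subrr evalp0.
- exact: (two_centers Fd' FG g0 g1).
- exact: (center_schubert Fd' FG Dx0 x0r ga g0).
move=> P Pd PY PD PE; apply: (ord_other_form Pd Fd) => // Y' Y'd PY' /(FY' _ Y'd)[e|e].
  by apply: PY; rewrite PY' e.
by apply: PD; rewrite PY' e.
Qed.

(** * Schubert varieties of codimension 1 *)

Context (n2 : n = (2 * k)%N).

(** Extending a basis of the subspace of index [other i] to a basis of the whole space. *)
Definition adapted_flag i j : 'M[K]_n := pid_mx j *m row_ebase (M (other i)).

Lemma adapted_flag_complete i : complete_flag (adapted_flag i).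
Proof.
have Bu := row_ebase_unit (M (other i)).
split=> [j jn|j jn].
  by rewrite /adapted_flag mxrankMfree ?row_free_unit // rank_pid_mx.
rewrite /adapted_flag; apply/submxP; exists (pid_mx j).
by rewrite mulmxA mul_pid_mx; congr (pid_mx _ *m _); clear -jn; lia.
Qed.

Lemma adapted_flag_center i : (adapted_flag i k :=: M (other i))%MS.
Proof.
apply/eqmx_sym/eqmxP; have Mk : \rank (M (other i)) = k by apply/eqP; exact: row_freeM.
have kn : (k <= n)%N by rewrite n2 mul2n -addnn leq_addr.
have MF : (M (other i) <= adapted_flag i k)%MS.
  apply/submxP; exists (col_ebase (M (other i)) *m pid_mx k).
  rewrite /adapted_flag mulmxA -(mulmxA (col_ebase _)) pid_mx_id // -{1}(mulmx_ebase (M (other i))).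
  by rewrite Mk.
rewrite MF -(mxrank_leqif_sup MF).2 Mk; apply/eqP.
by rewrite (adapted_flag_complete i).1.
Qed.

Definition divisor_partition (i : 'I_k) : nat := (i == 0 :> nat).

Lemma divisor_partitionP : is_partition n divisor_partition /\ (\sum_i divisor_partition i = 1)%N.
Proof.
split; last first.
  rewrite (bigD1 (Ordinal k0)) //= big1 // => i /eqP i0.
  by rewrite /divisor_partition; case: eqP => // e; case: i0; exact: val_inj.
split=> [i|i j ij]; rewrite /divisor_partition.
  by rewrite n2; case: (_ == _) => //; lia.
by case: (eqVneq (j : nat) 0%N) ij => [->|//]; rewrite leqn0 => ->.
Qed.

(** In the definition of the Schubert variety the condition of index 0 says that the subspace meets that of index
    [other i]; the others hold for reasons of dimension. *)
Lemma schubert_div_variety i : schubert_div i = schubert divisor_partition (adapted_flag i).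
Proof.
have meet (A : 'M[K]_(k, n)) : row_free A ->
    \det (A *m U i) = 0 <-> (0 < \rank (A :&: adapted_flag i k)%MS)%N.
  move=> Af; have cE : (A :&: adapted_flag i k :=: A :&: M (other i))%MS.
    exact: (cap_eqmx (eqmx_refl A) (adapted_flag_center i)).
  rewrite cE lt0n mxrank_eq0; split.
    move=> /eqP/det0P[a a0 aA]; apply/rowV0Pn; exists (a *m A).
      rewrite sub_capmx submxMl {1}(decomp i A) mulmxDr !(mulmxA a) -(mulmxA a A (U i)) aA mul0mx add0r.
      exact: submxMl.
    by rewrite mulmx_free_eq0.
  move=> /rowV0Pn[v]; rewrite sub_capmx => /andP[/submxP[a ->] /submxP[b e]] v0.
  apply/eqP/det0P; exists a; first by apply: contra_neq v0 => ->; rewrite mul0mx.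
  by rewrite mulmxA e -mulmxA MUo' mulmx0.
apply/seteqP; split=> x.
  move=> [[A Af ->]]; rewrite lform_plucker => A0; exists A; split=> // j.
  have [j0|j0] := eqVneq (j : nat) 0%N.
    have -> : (n - k + j.+1 - divisor_partition j = k)%N by rewrite /divisor_partition j0 n2; lia.
    by rewrite j0; apply/(meet A Af).
  rewrite /divisor_partition (negPf j0) subn0.
  have := mxrank_sum_cap A (adapted_flag i (n - k + j.+1)).
  rewrite (adapted_flag_complete i).1; last by have := ltn_ord j; lia.
  have := rank_leq_col (A + adapted_flag i (n - k + j.+1))%MS; have /eqP -> := Af.
  move: (\rank _) (\rank _) => r1 r2; lia.
move=> [A [Af -> h]]; split; first by exists A.
rewrite lform_plucker; apply/(meet A Af); have := h (Ordinal k0).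
by have -> : (n - k + (Ordinal k0).+1 - divisor_partition (Ordinal k0) = k)%N
  by rewrite /divisor_partition /= n2; lia.
Qed.

(** * The two cones *)

Context {R : realType}.
Notation rdiv := (set (T -> K) -> R).
Notation leq_div := (@lin_equiv _ _ _ bf R X).

Lemma lin_equiv_comb (D E A1 B1 A2 B2 : rdiv) (s t : R) : leq_div A1 B1 -> leq_div A2 B2 ->
  (forall P, D P - E P = s * (A1 P - B1 P) + t * (A2 P - B2 P)) -> leq_div D E.
Proof.
move=> h1 h2 e; have [m [b [N [p e']]]] := lin_equivD (lin_equivZ s h1) (lin_equivZ t h2).
by exists m, b, N; split=> //; rewrite -e'; apply/funext => P; rewrite e; ring.
Qed.

Lemma not_ideal_pull_down d F : mhomog gf d F -> ~ ideal Gr F -> ~ ideal X (pull_down F).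
Proof.
move=> Fd FG h; apply: FG.
apply: (irr_regular id gf_id Gr_irr (graph_pt_in ord0 1%:M) regular_graph_pt1 Fd) => x xG xr.
have := h (lift_pt x); rewrite evalp_pull_down; apply.
by apply: open_sub; exact: lift_pt_open.
Qed.

Lemma prime_div_neq (P Q : set (T -> K)) : P <> Q -> (prime_div Q : rdiv) P = 0.
Proof. by rewrite /prime_div; case: asboolP. Qed.

Lemma prime_div_eq (P : set (T -> K)) : (prime_div P : rdiv) P = 1.
Proof. by rewrite /prime_div; case: asboolP. Qed.

Lemma div_lform_pow i e P : div_of bf X (pull_down (lform_pow i e)) P =
  e%:R * (prime_div (strict (schubert_div i)) : rdiv) P + k%:R * e%:R * (prime_div (exc (other i)) : rdiv) P.
Proof.
have SP := strict_prime (schubert_div_prime i); have EP := exceptional_prime (other i).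
rewrite /div_of; case: (pselect (P = strict (schubert_div i))) => [->|PS].
  rewrite asboolT // ord_strict_lform_pow // prime_div_eq prime_div_neq; first by rewrite mulr1 mulr0 addr0.
  exact: (strict_neq_exc (schubert_div_prime i)).
rewrite (prime_div_neq PS); case: (pselect (P = exc (other i))) => [->|PE].
  by rewrite asboolT // ord_exc_lform_pow // prime_div_eq natrM mulr1 mulr0 add0r.
rewrite (prime_div_neq PE) !mulr0 addr0; case: asboolP => // Pd.
by rewrite ord_other_lform_pow.
Qed.

Lemma pull_down_equiv e F i : mhomog gf (fun=> e) F -> ~ ideal Gr F ->
  leq_div (div_of bf X (pull_down F)) (div_of bf X (pull_down (lform_pow i e))).
Proof.
move=> Fd FG; apply: (lin_equiv_div (mhomog_pull_down Fd) (mhomog_pull_down (@mhomog_lform_pow i e))).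
  exact: not_ideal_pull_down Fd FG.
exact (not_ideal_pull_down (@mhomog_lform_pow i e) (@not_ideal_lform_pow i e)).
Qed.

Lemma hyperplane_equiv (H : rdiv) i : hyperplane_pullback center H ->
  leq_div H (div_of bf X (pull_down (lform_pow i 1))).
Proof.
move=> [F [Fd FX ->]].
apply: (lin_equiv_div Fd (mhomog_pull_down (@mhomog_lform_pow i 1)) FX).
exact (not_ideal_pull_down (@mhomog_lform_pow i 1) (@not_ideal_lform_pow i 1)).
Qed.

Lemma div_equation e F Y c a m0 m1 : mhomog gf (fun=> e) F -> prime_divisor gf Gr Y ->
  Y <> schubert_div ord0 ->
  [/\ ord X (strict Y) (pull_down F) = c, ord X (strict (schubert_div ord0)) (pull_down F) = a,
      ord X (exc ord0) (pull_down F) = m0 & ord X (exc ord_max) (pull_down F) = m1] ->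
  (forall P, prime_divisor bf X P -> P <> strict Y -> P <> strict (schubert_div ord0) ->
     (forall i, P <> exc i) -> ord X P (pull_down F) = 0%N) ->
  forall P, div_of bf X (pull_down F) P = c%:R * (prime_div (strict Y) : rdiv) P +
    a%:R * (prime_div (strict (schubert_div ord0)) : rdiv) P + m0%:R * (prime_div (exc ord0) : rdiv) P
    + m1%:R * (prime_div (exc ord_max) : rdiv) P.
Proof.
move=> Fd Yd Y0 [oY oD o0 o1] oP P; rewrite /div_of.
have D0d := schubert_div_prime ord0.
case: (pselect (P = strict Y)) => [->|PY].
  rewrite (asboolT (strict_prime Yd)) oY prime_div_eq !prime_div_neq ?mulr1 ?mulr0 ?addr0 //.
  - exact: (strict_neq_exc Yd).
  - exact: (strict_neq_exc Yd).
  - by move=> /(strict_inj Yd D0d).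
case: (pselect (P = strict (schubert_div ord0))) => [PE|PD].
  rewrite PE in PY *.
  rewrite (asboolT (strict_prime D0d)) oD prime_div_eq (prime_div_neq PY).
  rewrite !prime_div_neq ?mulr1 ?mulr0 ?addr0 ?add0r //.
  - exact: (strict_neq_exc D0d).
  - exact: (strict_neq_exc D0d).
rewrite (prime_div_neq PY) (prime_div_neq PD).
have exc01 : exc ord0 <> exc ord_max by move=> /exc_inj.
case: (pselect (P = exc ord0)) => [->|P0].
  rewrite (asboolT (exceptional_prime _)) o0 prime_div_eq (prime_div_neq exc01).
  by rewrite !mulr0 !add0r mulr1 addr0.
case: (pselect (P = exc ord_max)) => [->|P1].
  rewrite (asboolT (exceptional_prime _)) o1 prime_div_eq prime_div_neq; last by move=> /esym.
  by rewrite !mulr0 !add0r mulr1.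
rewrite (prime_div_neq P0) (prime_div_neq P1) !mulr0 !addr0.
case: asboolP => // Pd; rewrite oP // => i.
have [<-//|/neq_other->] := eqVneq ord0 i.
by rewrite other0.
Qed.

Definition prime_gen (j : 'I_4) : set (T -> K) :=
  nth X [:: exc ord0; exc ord_max; strict (schubert_div ord0); strict (schubert_div ord_max)] j.

Definition coefs (b0 b1 b2 b3 : R) (j : 'I_4) : R := nth 0 [:: b0; b1; b2; b3] j.

Lemma sum_gen b0 b1 b2 b3 Q :
  \sum_j coefs b0 b1 b2 b3 j * (prime_div (prime_gen j) : rdiv) Q =
  b0 * prime_div (exc ord0) Q + b1 * prime_div (exc ord_max) Q +
  b2 * prime_div (strict (schubert_div ord0)) Q + b3 * prime_div (strict (schubert_div ord_max)) Q.
Proof. by rewrite !big_ord_recl big_ord0 /= addr0 !addrA. Qed.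

Lemma coefs_ge0 b0 b1 b2 b3 : 0 <= b0 -> 0 <= b1 -> 0 <= b2 -> 0 <= b3 ->
  forall j, 0 <= coefs b0 b1 b2 b3 j.
Proof. by move=> ? ? ? ?; case=> -[|[|[|[|]]]]. Qed.

(** Both sides are hyperplane sections. *)
Lemma lform_pow_classes : leq_div
  (fun P => prime_div (strict (schubert_div ord0)) P + k%:R * prime_div (exc ord_max) P)
  (fun P => prime_div (strict (schubert_div ord_max)) P + k%:R * prime_div (exc ord0) P).
Proof.
have := pull_down_equiv ord_max (@mhomog_lform_pow ord0 1) (@not_ideal_lform_pow ord0 1).
congr lin_equiv; apply/funext => P; by rewrite div_lform_pow mul1r mulr1 ?other0 ?other1.
Qed.

(** The class of a strict transform is computed in [equation_class]; the coefficients are nonnegative by the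
    inequalities of [equation_orders]. *)
Lemma prime_gen_generate P : prime_divisor bf X P -> exists2 b : 'I_4 -> R, forall j, 0 <= b j &
   leq_div (prime_div P) (fun Q => \sum_j b j * prime_div (prime_gen j) Q).
Proof.
move=> Pd.
have gen0 j : P = prime_gen j -> exists2 b : 'I_4 -> R, forall j, 0 <= b j &
   leq_div (prime_div P) (fun Q => \sum_j b j * prime_div (prime_gen j) Q).
  move=> ->; exists (fun i => (i == j)%:R) => [i|]; first exact: ler0n.
  apply: lin_equiv_eq; apply/funext => Q; rewrite (bigD1 j) //= eqxx mul1r big1 ?addr0 // => i /negPf->.
  by rewrite mul0r.
have [[i e]|[Y Yd e]] := prime_exc_or_strict Pd.
  have [i0|/neq_other i1] := eqVneq ord0 i.
    by apply: (gen0 (inord 0)); rewrite e -i0 /prime_gen inordK.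
  by apply: (gen0 (inord 1)); rewrite e i1 /prime_gen inordK //= other0.
case: (pselect (Y = schubert_div ord0)) => [Y0|Y0].
  by apply: (gen0 (inord 2)); rewrite e Y0 /prime_gen inordK.
have [deg [F [Fd FG [c [a [m0 [m1 [c0 le1 le2 o oP]]]]]]]] := equation_orders Yd Y0.
have divF := div_equation Fd Yd Y0 o oP.
have kR : (k%:R : R) != 0 by rewrite pnatr_eq0 -lt0n ltnW.
have cR : (c%:R : R) != 0 by rewrite pnatr_eq0 -lt0n.
exists (coefs 0 ((k%:R * deg%:R - (m0%:R + m1%:R)) / c%:R)
   ((k%:R * deg%:R - (k%:R * a%:R + m0%:R)) / (k%:R * c%:R)) (m0%:R / (k%:R * c%:R))).
  apply: coefs_ge0 => //.
  - by rewrite divr_ge0 // subr_ge0 -natrM -natrD ler_nat.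
  - by rewrite divr_ge0 ?mulr_ge0 // subr_ge0 -!natrM -natrD ler_nat.
  - by rewrite divr_ge0 ?mulr_ge0.
rewrite e; apply: (lin_equiv_comb (s := c%:R^-1) (t := m0%:R / (k%:R * c%:R))
  (pull_down_equiv ord0 Fd FG) lform_pow_classes) => Q.
rewrite sum_gen divF div_lform_pow.
rewrite other0; exact: equation_class.
Qed.

Lemma prime_gen_S_generator j : @S_generators _ _ _ _ center R (prime_div (prime_gen j)).
Proof.
have E i : @S_generators _ _ _ _ center R (prime_div (exc i)).
  left; exists i, (exc i); split=> //; first exact: exceptional_prime.
  exact: exceptional_linear.
have S i : @S_generators _ _ _ _ center R (prime_div (strict (schubert_div i))).
  right; exists (schubert_div i) => //; split; first exact: schubert_div_prime.
  exists divisor_partition, (adapted_flag i); have [pP sP] := divisor_partitionP.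
  split=> //; first exact: adapted_flag_complete.
  by rewrite -schubert_div_variety; exact: num_equiv_refl.
by case: j => -[|[|[|[|//]]]] ?; [exact: E|exact: E|exact: S|exact: S].
Qed.

Lemma S_generator_effective D : @S_generators _ _ _ _ center R D -> effective bf X D.
Proof.
move=> [[i [L [Ld _ ->]]]|[Y [Yd _] ->]]; first exact: (effective_prime Ld).
exact: (effective_prime (strict_prime Yd)).
Qed.

Lemma pseff_S_generated : @S_generated K k n 2 center R.
Proof.
rewrite /S_generated; apply: (pseff_finite_cone prime_gen_generate) => [j|E EG].
  by exists (prime_div (prime_gen j)); [exact: prime_gen_S_generator|exact: num_equiv_refl].
by exists E; [exact: S_generator_effective|exact: num_equiv_refl].
Qed.

(** The classes H - m E_0 - (k - m) E_1 lie on the segment that joins the classes of the two Schubert divisors. *)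
Lemma pseff_hyperplane_cone (H : rdiv) : hyperplane_pullback center H ->
  pseff bf X = cone bf X
    [set D | (exists i : 'I_2, D = exc_div center i) \/
       exists2 m : nat, (m <= k)%N &
         D = fun P => H P - m%:R * exc_div center ord0 P - (k - m)%:R * exc_div center ord_max P].
Proof.
move=> Hp.
have H0 : leq_div H (fun P => prime_div (strict (schubert_div ord0)) P + k%:R * prime_div (exc ord_max) P).
  have := hyperplane_equiv ord0 Hp; congr lin_equiv; apply/funext => P.
  by rewrite div_lform_pow mul1r mulr1 other0.
have H1 : leq_div H (fun P => prime_div (strict (schubert_div ord_max)) P + k%:R * prime_div (exc ord0) P).
  have := hyperplane_equiv ord_max Hp; congr lin_equiv; apply/funext => P.
  by rewrite div_lform_pow mul1r mulr1 other1.
have kR : (k%:R : R) != 0 by rewrite pnatr_eq0 -lt0n ltnW.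
apply: (pseff_finite_cone prime_gen_generate) => [j|E [[i ->]|[m mk ->]]].
- have E i : exists2 E, [set D | (exists i : 'I_2, D = exc_div center i) \/
       exists2 m : nat, (m <= k)%N &
         D = fun P => H P - m%:R * exc_div center ord0 P - (k - m)%:R * exc_div center ord_max P] E &
         num_equiv bf X (prime_div (exc i)) E.
    by exists (exc_div center i); [left; exists i|exact: num_equiv_refl].
  case: j => -[|[|[|[|//]]]] ?; [exact: E|exact: E| |].
    exists (fun P => H P - 0%:R * exc_div center ord0 P - (k - 0)%:R * exc_div center ord_max P).
      by right; exists 0%N.
    apply/lin_equiv_num/(lin_equiv_comb (s := -1) (t := 0) H0 H0) => P.
    by rewrite /prime_gen /= /exc_div subn0; ring.
  exists (fun P => H P - k%:R * exc_div center ord0 P - (k - k)%:R * exc_div center ord_max P).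
    by right; exists k.
  apply/lin_equiv_num/(lin_equiv_comb (s := -1) (t := 0) H1 H1) => P.
  by rewrite /prime_gen /= /exc_div subnn; ring.
- exists (exc_div center i); last exact: num_equiv_refl.
  exact: (effective_prime (exceptional_prime i)).
exists (fun P => (m%:R / k%:R) * prime_div (strict (schubert_div ord_max)) P +
   ((k - m)%:R / k%:R) * prime_div (strict (schubert_div ord0)) P).
  have De i := effective_prime (R := R) (strict_prime (schubert_div_prime i)).
  have [r0 _] := De ord0; have [r1 _] := De ord_max.
  split; first by apply: is_rdivD; apply: is_rdivZ.
  by move=> P; rewrite addr_ge0 // mulr_ge0 ?divr_ge0 //; [case: (De ord_max)|case: (De ord0)].
apply/lin_equiv_num/(lin_equiv_comb (s := (k - m)%:R / k%:R) (t := m%:R / k%:R) H0 H1) => P.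
by rewrite /exc_div natrB //; field.
Qed.

End TwoCenters.
(** * Two general points *)

Section GeneralPosition.
Context {K : closedFieldType} {k : nat} (hk : (1 < k)%N).
Notation J := (plucker_index k (k + k)).
Notation Gr := (@grassmannian K k (k + k)).
Notation T := ('I_2 * J)%type.
Notation tpoly := (mpoly #|{: T}| K).
Notation tf := (@tuple_factor k (k + k) 2).
Notation pairs := ('M[K]_(k, k + k) * 'M[K]_(k, k + k))%type.

(** A frame with invertible product with those of both coordinate subspaces, so that the
    determinant below is not identically zero. *)
Definition diag_frame : 'M[K]_(k + k, k) := col_mx 1%:M 1%:M.

Definition pair_point (W : pairs) : T -> K := fun t => plucker (if t.1 == ord0 then W.1 else W.2) t.2.

(** The determinant of the two reconstructed frames, one above the other, so that it is a form in the Plücker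
    coordinates of two subspaces; if it is nonzero, they are complementary. *)
Definition transversality : tpoly :=
  \det (\matrix_(a < k + k, j < k + k)
     match fintype.split a with
     | inl r => lpoly (fun I => (ord0, I) : T) (repl_col diag_frame r j)
     | inr r => lpoly (fun I => (ord_max, I) : T) (repl_col diag_frame r j)
     end).

Lemma mhomog_transversality : exists d, mhomog tf d transversality.
Proof.
pose rf (a : 'I_(k + k)) : 'I_2 := match fintype.split a with inl _ => ord0 | inr _ => ord_max end.
exists (fun s => \sum_a ((rf a == s) : nat))%N.
apply: (@mhomog_det _ _ _ _ _ (fun a s => (rf a == s) : nat)) => a j.
rewrite mxE /rf; case: (fintype.split a) => r; exact: mhomog_lpoly.
Qed.

Lemma evalp_transversality W : evalp transversality (pair_point W) =
  \det (col_mx (\adj (W.1 *m diag_frame) *m W.1) (\adj (W.2 *m diag_frame) *m W.2)).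
Proof.
rewrite evalp_det -!recon_plucker; congr (\det _); apply/matrixP => a j.
rewrite [LHS]mxE [X in evalp X _]mxE [RHS]mxE.
by case: (fintype.split a) => r; rewrite evalp_lpoly /recon [RHS]mxE.
Qed.

Lemma transversality_rank W : evalp transversality (pair_point W) != 0 -> \rank (W.1 + W.2)%MS = (k + k)%N.
Proof.
rewrite evalp_transversality -unitfE -unitmxE -row_free_unit => /eqP r.
apply/eqP; rewrite eqn_leq rank_leq_col -{1}r mxrankS // col_mx_sub.
by rewrite (submx_trans (submxMl _ _) (addsmxSl _ _)) (submx_trans (submxMl _ _) (addsmxSr _ _)).
Qed.

Lemma dual_frames_exist (M : 'I_2 -> 'M[K]_(k, k + k)) :
  \rank (M ord0 + M ord_max)%MS = (k + k)%N -> exists U, dual_frames M U.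
Proof.
rewrite addsmxE => /eqP r; pose C := col_mx (M ord0) (M ord_max).
have Cu : C \in unitmx by rewrite -row_free_unit.
exists (fun i => if i == ord0 then lsubmx (invmx C) else rsubmx (invmx C)).
have := mulmxV Cu; have := mulVmx Cu; rewrite -{1 2}[invmx C]hsubmxK mul_row_col mul_col_row.
rewrite scalar_mx_block => e1 /eq_block_mx[e2 e3 e4 e5].
by split; apply: ind2; rewrite /= ?other0 ?other1 ?row_mxKl ?row_mxKr //= ?[RHS]scalar_mx_block -?e1 // addrC.
Qed.

Lemma pair_point_grass W : row_free W.1 -> row_free W.2 -> @grass_tuples K k (k + k) 2 (pair_point W).
Proof. by move=> W1 W2 i; rewrite /pair_point /=; case: (i == ord0); [exists W.1|exists W.2]. Qed.

Lemma grass_pair_point v : @grass_tuples K k (k + k) 2 v ->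
  exists W, [/\ row_free W.1, row_free W.2 & v = pair_point W].
Proof.
move=> vG; have [W0 W0f e0] := vG ord0; have [W1 W1f e1] := vG ord_max.
exists (W0, W1); split=> //; apply/funext => -[i I]; rewrite /pair_point /=.
by move: i; apply: ind2; rewrite /= -?e0 -?e1.
Qed.

Lemma transversality_base : evalp transversality (pair_point (row_mx 1%:M 0, row_mx 0 1%:M)) != 0.
Proof.
rewrite evalp_transversality /= !mul_row_col !mulmx1 addr0 add0r adj1 !mul1mx.
by rewrite -/(block_mx _ _ _ _) -scalar_mx_block det1 oner_neq0.
Qed.

Lemma linepoly_pair_point t : linepoly (fun W : pairs => pair_point W t).
Proof.
apply: linepoly_pluckerW => i j; rewrite /pair_point; case: (t.1 == ord0).
  by apply: linepoly_linear; exists fst.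
by apply: linepoly_linear; exists snd.
Qed.

Lemma grass_tuples_proj : @grass_tuples K k (k + k) 2 `<=` proj_points tf.
Proof.
move=> v vG i; have [I _ vI] := grass_proj (vG i) tt.
by exists (i, I).
Qed.

(** Pairs of subspaces are parametrized by pairs of matrices, on which a product of polynomials vanishes only if
    one of them does. *)
Lemma transversality_generic :
  @grass_tuples K k (k + k) 2 `<=`
    zclosure tf (@grass_tuples K k (k + k) 2 `\` zero_locus tf [set transversality]).
Proof.
move=> v vG; split; first exact: grass_tuples_proj.
move=> F [_ F0]; have [W [_ _ ->]] := grass_pair_point vG.
apply/eqP; apply: contraT => FW.
have [||||W' [FW' GW']] := @linepoly_generic _ _ (fun W => evalp F (pair_point W)) (fun W => evalp transversality (pair_point W)).
- exact: (linepoly_evalp _ linepoly_pair_point).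
- exact: (linepoly_evalp _ linepoly_pair_point).
- by exists W.
- by exists (row_mx 1%:M 0, row_mx 0 1%:M); exact: transversality_base.
case/eqP: FW'; apply: F0; have r := transversality_rank GW'.
have [r1 r2] : row_free W'.1 /\ row_free W'.2.
  have := mxrank_adds_leqif W'.1 W'.2; have := rank_leq_row W'.1; have := rank_leq_row W'.2.
  by rewrite /row_free r => h2 h1 [h3 _]; split; lia.
split; first exact: pair_point_grass.
by move=> [_ /(_ _ erefl)] e; rewrite e eqxx in GW'.
Qed.

Lemma general_dual_frames : exists Z : set ('I_2 * J -> K),
  [/\ zclosed tf Z,
     @grass_tuples K k (k + k) 2 `<=` zclosure tf (@grass_tuples K k (k + k) 2 `\` Z) &
     forall p, (forall i, Gr (p i)) -> ~ Z (fun t => p t.1 t.2) ->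
       exists M U, dual_frames M U /\ p = center M].
Proof.
exists (zero_locus tf [set transversality]); split.
- by exists [set transversality] => // F ->; exact: mhomog_transversality.
- exact: transversality_generic.
move=> p pG pZ; have vG : @grass_tuples K k (k + k) 2 (fun t => p t.1 t.2) by exact: pG.
have [W [_ _ e]] := grass_pair_point vG.
pose M (i : 'I_2) := if i == ord0 then W.1 else W.2.
have [|U MU] := @dual_frames_exist M; last first.
  exists M, U; split=> //; apply/funext => i; apply/funext => I.
  by have := congr1 (@^~ (i, I)) e; rewrite /pair_point /center /M /=.
rewrite /M /=; apply: transversality_rank; rewrite -e; apply/negP => /eqP h; apply: pZ.
by split; [exact: grass_tuples_proj|move=> F ->].
Qed.

End GeneralPosition.

Theorem theorem4p2 (R : realType) (K : closedFieldType) (k : nat) (hk : (2 <= k)%N) :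
  @general_points K k (2 * k) 2 (fun p =>
    @S_generated K k (2 * k) 2 p R /\
    forall H : set (blowup_index k (2 * k) -> K) -> R,
      hyperplane_pullback p H ->
      pseff (@blowup_factor k (2 * k) 2) (blowup p) =
      cone (@blowup_factor k (2 * k) 2) (blowup p)
        [set D | (exists i : 'I_2, D = exc_div p i) \/
           exists2 m : nat, (m <= k)%N &
             D = fun P => H P - m%:R * exc_div p ord0 P
                              - (k - m)%:R * exc_div p ord_max P]).
Proof.
rewrite mul2n -addnn; have [Z [Zc Zd Zp]] := @general_dual_frames K k hk.
exists Z; split=> // p pG /(Zp p pG)[M [U [MU ->]]].
have n2 : (k + k = 2 * k)%N by rewrite mul2n addnn.
by split=> [|H Hp]; [exact: (pseff_S_generated MU hk n2)|exact: (pseff_hyperplane_cone MU hk Hp)].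
Qed.
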